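(* There is a constant $\kappa>0$ such that the following holds. Let $\Sigma$ be a compact Riemann surface with conformal metric $h$ of curvature $-1$, $U$ a holomorphic cubic differential on $\Sigma$ and $u$ a small solution to $$\Delta u-16\|U\|_h^2e^{-2u}-2e^u+2=0,$$ with associated Legendrian frame $F=(f_1\ f_2\ f_3)$ on the universal cover $\tilde\Sigma$. If $\|U\|_h<\kappa$ on all of $\Sigma$, then the map $\Phi:\tilde\Sigma\times\mathcal D\to\mathbb{CH}^2$, $$\Phi(z,a,b)=\pi\bigl[(ia-b)f_1(z)+(ia+b)f_2(z)+f_3(z)\bigr],\qquad \mathcal D=\{(a,b)\in\mathbb R^2:a^2+b^2<\tfrac12\},$$ is a diffeomorphism from $\tilde\Sigma\times\mathcal D$ to $\mathbb{CH}^2$. Moreover, the natural continuous extension $\bar\Phi:\tilde\Sigma\times\bar{\mathcal D}\to\overline{\mathbb{CH}^2}$ (given by the same formula) is injective.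
   Context: If locally $h=\gamma|dz|^2$ and $U=Q\,dz^3$, then $\|U\|_h^2=|Q|^2/\gamma^3$, and $\Delta=\frac4\gamma\partial_z\partial_{\bar z}$. A function $u$ on $\Sigma$ is small if $u\ge\frac13\log(16\max_\Sigma\|U\|_h^2)$ (no constraint when $U=0$). On $\mathbb C^3$ let $\langle u,v\rangle=u_1\bar v_1+u_2\bar v_2-u_3\bar v_3$, $W_-=\{u:\langle u,u\rangle<0\}$, $\mathbb{CH}^2=\mathbb PW_-\subset\mathbb{CP}^2$ with closure $\overline{\mathbb{CH}^2}$ taken in $\mathbb{CP}^2$ (a closed ball), and $\pi$ the projection $\mathbb C^3\setminus\{0\}\to\mathbb{CP}^2$. Legendrian frame: identify $\tilde\Sigma$ with the Poincaré disc with coordinate $z$; write $e^uh=2s^2|dz|^2$ ($s>0$), $U=Q\,dz^3$ and $\alpha=A\,dz+B\,d\bar z$ with $$A=\begin{pmatrix}s^{-1}s_z & 0 & s \\ -Qs^{-2} & -s^{-1}s_z & 0 \\ 0 & s & 0\end{pmatrix},\quad B=\begin{pmatrix}-s^{-1}s_{\bar z} & \bar Qs^{-2} & 0 \\ 0 & s^{-1}s_{\bar z} & s \\ s & 0 & 0\end{pmatrix}.$$ The equation for $u$ is equivalent to $d\alpha+\alpha\wedge\alpha=0$, so there is $F:\tilde\Sigma\to SU(2,1)$, unique up to left multiplication by a constant, with $F^{-1}dF=\alpha$. Its columns satisfy $f_1=f_z/s$, $f_2=f_{\bar z}/s$, $f_3=f$, with $\langle f,f\rangle=-1$. *)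

(* Defs.v *)
From HB Require Import structures.
From mathcomp Require Import all_boot all_order all_algebra.
From mathcomp Require Import generic_quotient complex.
From mathcomp Require Import all_classical all_reals all_analysis.

Set Implicit Arguments.
Unset Strict Implicit.
Unset Printing Implicit Defensive.
Import Order.TTheory GRing.Theory Num.Theory.
Import numFieldNormedType.Exports.
Local Open Scope classical_set_scope.
Local Open Scope ring_scope.
Local Open Scope quotient_scope.

(* The type of complex numbers is [Rcomplex R], the alias of [R[i]] on which
   scalars are real and the norm is the real-valued modulus.  It is made here
   a normed module over [R], so that ['D_v f] is the real directional
   derivative.  *)
Section RcomplexNormedModule.
Variable R : realType.

Fact Rcomplex_normrZ (l : R) (x : Rcomplex R) : `|l *: x| = `|l| * `|x|.
Proof.
case: x => a b; rewrite /Num.norm /=.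
by rewrite !exprMn -mulrDr sqrtrM ?sqr_ge0// sqrtr_sqr.
Qed.

HB.instance Definition _ :=
  PseudoMetric.copy (Rcomplex R) (pseudoMetric_normed (Rcomplex R)).
HB.instance Definition _ := isPointed.Build (Rcomplex R) 0.
HB.instance Definition _ :=
  NormedZmod_PseudoMetric_eq.Build R (Rcomplex R) erefl.
HB.instance Definition _ :=
  PseudoMetricNormedZmod_Lmodule_isNormedModule.Build R (Rcomplex R)
    Rcomplex_normrZ.

End RcomplexNormedModule.

(* The same field, as scalars for complex differentiation.  *)
Definition Cfield (R : realType) : numFieldType := R[i].

Section Calculus.
Variable R : realType.
Local Notation C := (Rcomplex R).

Definition toC (x : R) : C := Complex x 0.
Definition iC : C := Complex 0 1.

Definition cderivable (f : C -> C) (z : C) : Prop :=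
  derivable (f : Cfield R -> Cfield R) z 1.
Definition cderiv (f : C -> C) (z : C) : C :=
  'D_1 (f : Cfield R -> Cfield R) z.

Definition dz (f : C -> C) (z : C) : C :=
  toC 2^-1 * ('D_(1 : C) f z - iC * 'D_iC f z).
Definition dzbar (f : C -> C) (z : C) : C :=
  toC 2^-1 * ('D_(1 : C) f z + iC * 'D_iC f z).

(* C^n and C^oo maps on an open subset [A]; the source [E] is always finite
   dimensional below, where continuity of all directional derivatives up to
   order n is the usual notion.  *)
Fixpoint Cn (E F : normedModType R) (n : nat) (A : set E) (f : E -> F) : Prop :=
  if n is m.+1 then
    forall v : E, (forall x, A x -> derivable f x v) /\ Cn m A ('D_v f)
  else forall x, A x -> {for x, continuous f}.

Definition smooth (E F : normedModType R) (A : set E) (f : E -> F) : Prop :=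
  forall n, Cn n A f.

End Calculus.
Arguments iC {R}.

(* The chart [i] is the homeomorphism [chart_map i] from [chart_dom i] to an
   open subset of C, with inverse [chart_inv i]; the values of these maps
   outside [chart_dom i] and its image are irrelevant.  Second countability is
   automatic (Rado).  *)
Record riemannSurface (R : realType) := RiemannSurface {
  rs_space :> topologicalType ;
  rs_hausdorff : hausdorff_space rs_space ;
  rs_connected : connected [set: rs_space] ;
  chart : Type ;
  chart_dom : chart -> set rs_space ;
  chart_map : chart -> rs_space -> Rcomplex R ;
  chart_inv : chart -> Rcomplex R -> rs_space ;
  chart_at : rs_space -> chart ;
  mem_chart_at : forall x, chart_dom (chart_at x) x ;
  chart_dom_open : forall i, open (chart_dom i) ;
  chart_map_open : forall i, open (chart_map i @` chart_dom i) ;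
  chart_mapK : forall i x, chart_dom i x -> chart_inv i (chart_map i x) = x ;
  chart_map_continuous : forall i x, chart_dom i x -> {for x, continuous (chart_map i)} ;
  chart_inv_continuous : forall i x, chart_dom i x ->
    {for chart_map i x, continuous (chart_inv i)} ;
  transition_holomorphic : forall i j x, chart_dom i x -> chart_dom j x ->
    cderivable (chart_map j \o chart_inv i) (chart_map i x)
}.

Section RiemannSurfaceTheory.
Variables (R : realType) (S : riemannSurface R).
Local Notation C := (Rcomplex R).

Definition smooth_fun (u : S -> R) : Prop :=
  forall i, smooth (chart_map (r := S) i @` chart_dom i) (u \o chart_inv i).

Definition transition_deriv (i j : chart S) (x : S) : C :=
  cderiv (chart_map j \o chart_inv i) (chart_map i x).

(* h = (dens i) |dz|^2 in the chart i  *)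
Record conformalMetric := ConformalMetric {
  dens : chart S -> C -> R ;
  dens_gt0 : forall i x, chart_dom i x -> 0 < dens i (chart_map i x) ;
  dens_smooth : forall i, smooth (chart_map i @` chart_dom i) (dens i) ;
  dens_change : forall i j x, chart_dom i x -> chart_dom j x ->
    dens i (chart_map i x) = dens j (chart_map j x) * `|transition_deriv i j x| ^+ 2
}.

(* U = (coef i) dz^3 in the chart i  *)
Record cubicDifferential := CubicDifferential {
  coef : chart S -> C -> C ;
  coef_holomorphic : forall i x, chart_dom i x -> cderivable (coef i) (chart_map i x) ;
  coef_change : forall i j x, chart_dom i x -> chart_dom j x ->
    coef i (chart_map i x) = coef j (chart_map j x) * transition_deriv i j x ^+ 3
}.

Definition cubic_zero (U : cubicDifferential) : Prop :=
  forall i x, chart_dom i x -> coef U i (chart_map i x) = 0.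

Variable h : conformalMetric.

(* (4 / gamma) d/dz d/dzbar f; the iterated Wirtinger derivative of a smooth
   real function is real, so taking the real part only changes the type.  *)
Definition chart_laplacian (i : chart S) (f : C -> R) (z : C) : R :=
  4 / dens h i z * complex.Re (dz (dzbar (fun w => toC (f w))) z).

Definition laplacian (u : S -> R) (x : S) : R :=
  let i := chart_at x in chart_laplacian i (u \o chart_inv i) (chart_map i x).

(* Gauss curvature of gamma |dz|^2 is - (1/2) Delta (log gamma).  *)
Definition curvature (x : S) : R :=
  let i := chart_at x in
  - (chart_laplacian i (fun z => ln (dens h i z)) (chart_map i x) / 2).

Definition cubic_norm2 (U : cubicDifferential) (x : S) : R :=
  let i := chart_at x in
  `|coef U i (chart_map i x)| ^+ 2 / dens h i (chart_map i x) ^+ 3.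

Definition cubic_norm (U : cubicDifferential) (x : S) : R :=
  Num.sqrt (cubic_norm2 U x).

(* On a compact surface [sup (range (cubic_norm2 U))] is a maximum.  *)
Definition small_fun (U : cubicDifferential) (u : S -> R) : Prop :=
  ~ cubic_zero U ->
  forall x, ln (16 * sup (range (cubic_norm2 U))) / 3 <= u x.

Definition solution (U : cubicDifferential) (u : S -> R) : Prop :=
  smooth_fun u /\
  forall x, laplacian u x - 16 * cubic_norm2 U x * expR (- 2 * u x)
            - 2 * expR (u x) + 2 = 0.

End RiemannSurfaceTheory.

Section UniversalCover.
Variables (R : realType) (S : riemannSurface R).
Local Notation C := (Rcomplex R).

Definition disc : set C := [set z | `|z| < 1].

Definition covering_on (X Y : topologicalType) (A : set X) (p : X -> Y) : Prop :=
  [/\ forall x, A x -> {for x, continuous p},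
      p @` A = setT &
      forall y, exists V : set Y, [/\ open V, V y &
        exists sheets : set (set X),
          [/\ trivIset sheets id,
              A `&` p @^-1` V = \bigcup_(W in sheets) W &
              forall W, sheets W ->
                [/\ open W, set_bij W V p &
                    forall O, open O -> O `<=` W -> open (p @` O)]]]].

Variable p : C -> S.

Definition cover_deriv (z : C) : C :=
  cderiv (chart_map (chart_at (p z)) \o p) z.

(* p^* h = (pull_dens h) |dz|^2 and p^* U = (pull_coef U) dz^3  *)
Definition pull_dens (h : conformalMetric S) (z : C) : R :=
  let i := chart_at (p z) in
  dens h i (chart_map i (p z)) * `|cover_deriv z| ^+ 2.

Definition pull_coef (U : cubicDifferential S) (z : C) : C :=
  let i := chart_at (p z) in coef U i (chart_map i (p z)) * cover_deriv z ^+ 3.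

(* [p] identifies the universal cover of (S, h) with the Poincare disc: it is
   a holomorphic covering map from the disc, isometric for the metric
   4 |dz|^2 / (1 - |z|^2)^2 of curvature -1.  *)
Definition poincare_cover (h : conformalMetric S) : Prop :=
  [/\ covering_on disc p,
      forall z i, disc z -> chart_dom i (p z) -> cderivable (chart_map i \o p) z &
      forall z, disc z -> pull_dens h z = 4 / (1 - `|z| ^+ 2) ^+ 2].

(* e^u h = 2 s^2 |dz|^2  *)
Definition frame_s (h : conformalMetric S) (u : S -> R) (z : C) : R :=
  Num.sqrt (expR (u (p z)) * pull_dens h z / 2).

End UniversalCover.
Arguments disc {R}.

Section Frame.
Variable R : realType.
Local Notation C := (Rcomplex R).

Definition mx3 (a b c d e f g h k : C) : 'M[C]_3 :=
  \matrix_(i, j) nth 0 (nth [::] [:: [:: a; b; c]; [:: d; e; f]; [:: g; h; k]] i) j.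

Definition herm (u v : 'cV[C]_3) : C :=
  u 0 0 * conjc (v 0 0) + u 1 0 * conjc (v 1 0) - u 2 0 * conjc (v 2 0).

Definition SU21 (M : 'M[C]_3) : Prop :=
  (forall u v : 'cV[C]_3, herm (M *m u) (M *m v) = herm u v) /\ \det M = 1.

Section Connection.
Variables (s : C -> R) (Q : C -> C) (z : C).
Let sC : C := toC (s z).
Let s_z : C := dz (fun w => toC (s w)) z.
Let s_zbar : C := dzbar (fun w => toC (s w)) z.

Definition frameA : 'M[C]_3 :=
  mx3 (sC^-1 * s_z)         0                 sC
      (- Q z * sC ^- 2)     (- (sC^-1 * s_z)) 0
      0                     sC                0.

Definition frameB : 'M[C]_3 :=
  mx3 (- (sC^-1 * s_zbar))  (conjc (Q z) * sC ^- 2)  0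
      0                     (sC^-1 * s_zbar)         sC
      sC                    0                        0.

End Connection.

Definition mx_dz (F : C -> 'M[C]_3) (z : C) : 'M[C]_3 :=
  \matrix_(i, j) dz (fun w => F w i j) z.
Definition mx_dzbar (F : C -> 'M[C]_3) (z : C) : 'M[C]_3 :=
  \matrix_(i, j) dzbar (fun w => F w i j) z.

(* F^-1 dF = A dz + B dzbar  *)
Definition legendrian_frame (s : C -> R) (Q : C -> C) (F : C -> 'M[C]_3) : Prop :=
  [/\ forall i j, smooth disc (fun z => F z i j),
      forall z, disc z -> SU21 (F z) &
      forall z, disc z ->
        invmx (F z) *m mx_dz F z = frameA s Q z /\
        invmx (F z) *m mx_dzbar F z = frameB s Q z].

End Frame.

Section Projective.
Variable R : realType.
Local Notation C := (Rcomplex R).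

Definition nonzero3 : set 'cV[C]_3 := [set v | v != 0].

Definition same_line (v w : nonzero3) : bool :=
  `[< exists c : C, c != 0 /\ \val v = c *: \val w >].

Fact same_line_refl : reflexive same_line.
Proof. by move=> v; apply/asboolP; exists 1; rewrite oner_neq0 scale1r. Qed.

Fact same_line_sym : symmetric same_line.
Proof.
suff sub v w : same_line v w -> same_line w v by move=> v w; apply/idP/idP; exact: sub.
move=> /asboolP[c [c0 e]]; apply/asboolP; exists c^-1.
by rewrite invr_eq0 c0 e scalerA mulVf// scale1r.
Qed.

Fact same_line_trans : transitive same_line.
Proof.
move=> w v x /asboolP[c [c0 e]] /asboolP[d [d0 e']]; apply/asboolP.
by exists (c * d); rewrite mulf_neq0// e e' scalerA.
Qed.

Canonical same_line_equiv :=
  EquivRel same_line same_line_refl same_line_sym same_line_trans.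

Definition CP2 := quotient_topology {eq_quot same_line_equiv}.

Fact e3_neq0 : (delta_mx 2 0 : 'cV[C]_3) \in nonzero3.
Proof.
rewrite inE /nonzero3/=; apply/eqP => /matrixP/(_ 2 0).
by rewrite !mxE eqxx; apply/eqP; rewrite oner_eq0.
Qed.

(* The projection of C^3 minus 0 to CP^2; its value at 0 is irrelevant.  *)
Definition toCP2 (v : 'cV[C]_3) : CP2 :=
  \pi_CP2 (insubd (Sub (delta_mx 2 0) e3_neq0 : nonzero3) v).

Definition Wneg : set 'cV[C]_3 := [set v | (herm v v : R[i]) < 0].

Definition CH2 : set CP2 := @toCP2 @` Wneg.

(* The affine chart w_3 <> 0 of CP^2.  It contains CH^2, an open subset, and
   so it defines the smooth structure of CH^2.  *)
Definition affine (P : CP2) : C * C :=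
  let v := \val (repr P : nonzero3) in (v 0 0 / v 2 0, v 1 0 / v 2 0).

(* [f] restricts to a diffeomorphism from the open set [A] onto CH^2; the
   inverse of f, read in the affine chart, is g.  *)
Definition diffeo_CH2 (E : normedModType R) (A : set E) (f : E -> CP2) : Prop :=
  [/\ set_bij A CH2 f,
      smooth A (affine \o f) &
      exists g : C * C -> E, smooth (affine @` CH2) g /\
        forall x, A x -> g (affine (f x)) = x].

Definition Phi_vec (F : C -> 'M[C]_3) (x : C * (R * R)) : 'cV[C]_3 :=
  let: (z, (a, b)) := x in
  (iC * toC a - toC b) *: col 0 (F z) + (iC * toC a + toC b) *: col 1 (F z)
  + col 2 (F z).

Definition Phi (F : C -> 'M[C]_3) (x : C * (R * R)) : CP2 := toCP2 (Phi_vec F x).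

Definition open_D : set (R * R) := [set ab | ab.1 ^+ 2 + ab.2 ^+ 2 < 2^-1].
Definition closed_D : set (R * R) := [set ab | ab.1 ^+ 2 + ab.2 ^+ 2 <= 2^-1].

End Projective.
Arguments open_D {R}.
Arguments closed_D {R}.
Arguments CH2 {R}.

(* Main.v *)
(* For a nonzero w with <w,w> <= 0 put psi(z) = |<f(z),w>|^2.  The frame
   equations identify the critical points of psi with the z for which [w] lies
   in Phi(z, closure of D), so injectivity and surjectivity of Phi are the
   uniqueness and existence of a critical point.  The maximum principle and
   smallness give 1 - 18 kappa^2 <= e^u <= 1; an odd reflection barrier turns
   this into a bound on du, and then psi'' >= psi > 0 along unit speed
   hyperbolic geodesics.  Convexity gives uniqueness, and growth along the rays
   from 0 gives existence when <w,w> < 0.  The critical point is nondegenerate,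
   hence a smooth function of w by implicit differentiation, which makes the
   inverse of Phi smooth. *)
Require Import Defs.
From HB Require Import structures.
From mathcomp Require Import all_boot all_order all_algebra.
From mathcomp Require Import complex ring lra generic_quotient.
From mathcomp Require Import all_classical all_reals all_analysis.
Import Order.TTheory GRing.Theory Num.Theory.
Import numFieldNormedType.Exports.
Local Open Scope classical_set_scope.
Local Open Scope ring_scope.

Set Implicit Arguments.
Unset Strict Implicit.
Unset Printing Implicit Defensive.

(** * Differentiable maps of class C^n *)

(** Hyperbolic geodesics are explicit and join any two points of the disc, but in general they are
    not geodesics of e^u h. The price is that psi'' contains error terms in u_z and Q / s^2,
    multiplied by <f_1, w> and <f_2, w>. When <w,w> <= 0 both products are at most |<f, w>| in
    modulus, so it is enough that u_z and Q / s^2 are at most s / 20. Smallness selects the right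
    branch of solutions. At a minimum of u the maximum principle gives only 16 ||U||^2 e^{-2u} + 2
    e^u - 2 >= 0, which where U does not vanish also allows e^u near 0; the pointwise form 16
    ||U||^2 <= e^{3u} of smallness rules this out. Existence of a critical point rests on psi >= -
    <w,w>, which forces quadratic growth along rays. This degenerates when <w,w> = 0, so at the
    boundary of the ball only uniqueness is used. For smooth dependence no local solution has to be
    constructed: the critical point is globally unique, its continuity in w follows from compactness
    of a small circle, and only the differentiation step of the implicit function theorem
    remains. *)

Section FrechetSmooth.
Context {R : realType}.
Implicit Types E F G : normedModType R.

Lemma is_diffP E F (f : E -> F) (x : E) (L : {linear E -> F}) :
  continuous L ->
  (forall e : R, 0 < e -> \forall h \near (0 : E), `|f (h + x) - f x - L h| <= e * `|h|) ->
  is_diff x f L.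
Proof.
move=> cL H.
have E0 : f \o shift x = cst (f x) + L +o_ 0 id.
  apply/eqaddoP => e e0; have := H e e0.
  by apply: filterS => h /=; rewrite opprD addrA.
have E1 := diff_unique cL E0.
apply: DiffDef => //; apply/diff_locallyP; split; first by rewrite E1.
by rewrite E1.
Qed.

Lemma is_diff_eps E F (f : E -> F) (x : E) : differentiable f x ->
  forall e : R, 0 < e ->
    \forall h \near (0 : E), `|f (h + x) - f x - 'd f x h| <= e * `|h|.
Proof.
move=> /diff_locallyP[_ /eqaddoP H] e e0; have := H e e0.
by apply: filterS => h /=; rewrite opprD addrA.
Qed.

Lemma near_eq_open E F (A : set E) (f g : E -> F) x : open A -> A x ->
  (forall y, A y -> f y = g y) -> \forall y \near x, f y = g y.
Proof.
move=> oA Ax fg; have := open_nbhs_nbhs (conj oA Ax).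
by apply: filterS => y /fg.
Qed.

Lemma derive_eq_on E F (A : set E) (f g : E -> F) x v : open A -> A x ->
  (forall y, A y -> f y = g y) -> 'D_v f x = 'D_v g x.
Proof. by move=> oA Ax fg; exact/near_eq_derive/(near_eq_open oA Ax fg). Qed.

Lemma differentiable_eq_on E F (A : set E) (f g : E -> F) x : open A -> A x ->
  (forall y, A y -> f y = g y) -> differentiable f x -> differentiable g x.
Proof.
move=> oA Ax fg df; suff: is_diff x g ('d f x) by move=> H; exact: ex_diff.
apply: (is_diffP (L := 'd f x)); first exact: diff_continuous.
move=> e e0; have := is_diff_eps df e0; apply: filter_app.
have := near_eq_open oA Ax fg; rewrite (near_shift 0) /=.
by apply: filterS => h; rewrite /= subr0 -(fg x)// => ->.
Qed.

Lemma continuous_eq_on E F (A : set E) (f g : E -> F) x : open A -> A x ->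
  (forall y, A y -> f y = g y) -> {for x, continuous f} -> {for x, continuous g}.
Proof.
move=> oA Ax fg; rewrite /prop_for /continuous_at -(fg x Ax) => cf.
by apply: cvg_trans cf; exact/near_eq_cvg/(near_eq_open oA Ax fg).
Qed.

(* Unlike [Cn], which only sees directional derivatives, this class obeys the
   chain rule; on the plane the two agree for smooth maps ([smooth_Fsmooth]). *)
Fixpoint Fn E F (n : nat) (A : set E) (f : E -> F) : Prop :=
  if n is m.+1 then
    (forall x, A x -> differentiable f x) /\ forall v : E, Fn m A ('D_v f)
  else forall x, A x -> {for x, continuous f}.

Definition Fsmooth E F (A : set E) (f : E -> F) : Prop := forall n, Fn n A f.

Lemma Fn_ext E F n (A : set E) (f g : E -> F) : open A ->
  (forall y, A y -> f y = g y) -> Fn n A f -> Fn n A g.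
Proof.
move=> oA; elim: n f g => [|n IH] f g fg /=.
  by move=> cf x Ax; exact: (continuous_eq_on oA Ax fg (cf x Ax)).
move=> [df Df]; split; first by move=> x Ax; apply: (differentiable_eq_on oA Ax fg); exact: df.
by move=> v; apply: IH (Df v) => y Ay; exact: (derive_eq_on v oA Ay fg).
Qed.

Lemma FnW E F n (A : set E) (f : E -> F) : Fn n.+1 A f -> Fn n A f.
Proof.
elim: n f => [|n IH] f [df Df]; first by move=> x /df; exact: differentiable_continuous.
by split=> // v; exact/IH/Df.
Qed.

Lemma Fn_Cn E F n (A : set E) (f : E -> F) : Fn n A f -> Cn n A f.
Proof.
elim: n f => // n IH f [df Df] v; split; last exact/IH/Df.
by move=> x /df; exact: diff_derivable.
Qed.

Lemma Fn_sub E F n (A B : set E) (f : E -> F) : B `<=` A -> Fn n A f -> Fn n B f.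
Proof.
move=> BA; elim: n f => [|n IH] f; first by move=> cf x /BA/cf.
by move=> [df Df]; split=> [x /BA/df//|v]; exact/IH/Df.
Qed.

Lemma Fsmooth_diff E F (A : set E) (f : E -> F) x :
  Fsmooth A f -> A x -> differentiable f x.
Proof. by move=> /(_ 1%N)[df _]; exact: df. Qed.

Lemma Fsmooth_derive E F (A : set E) (f : E -> F) v :
  Fsmooth A f -> Fsmooth A ('D_v f).
Proof. by move=> sf n; have [_] := sf n.+1; exact. Qed.

Lemma Fn_cst E F n (A : set E) (c : F) : Fn n A (cst c : E -> F).
Proof.
elim: n c => [|n IH] c /=; first by move=> x _; exact: cvg_cst.
split=> [x _|v]; first exact: differentiable_cst.
by have -> : 'D_v (cst c : E -> F) = cst 0; [apply/funext => x; exact: derive_cst|exact: IH].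
Qed.

Lemma Fn_linear E F n (A : set E) (L : {linear E -> F}) : continuous L -> Fn n A L.
Proof.
case: n => [|n] cL /=; first by move=> x _; exact: cL.
split=> [x _|v]; first exact: linear_differentiable.
have -> : 'D_v L = cst (L v); last exact: Fn_cst.
by apply/funext => x; rewrite deriveE ?diff_lin//; exact: linear_differentiable.
Qed.

Lemma FnD E F n (A : set E) (f g : E -> F) : open A ->
  Fn n A f -> Fn n A g -> Fn n A (fun x => f x + g x).
Proof.
move=> oA; elim: n f g => [|n IH] f g.
  by move=> cf cg x Ax; apply: continuousD; [exact: cf|exact: cg].
move=> [df Df] [dg Dg]; split; first by move=> x Ax; apply: differentiableD; [exact: df|exact: dg].
move=> v; apply: (Fn_ext oA _ (IH _ _ (Df v) (Dg v))) => y Ay.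
by rewrite -[RHS]/('D_v (f + g) y) deriveD//; apply: diff_derivable; [exact: df|exact: dg].
Qed.

Lemma Fn_sum E F n (A : set E) (I : Type) (r : seq I) (f : I -> E -> F) : open A ->
  (forall i, Fn n A (f i)) -> Fn n A (fun x => \sum_(i <- r) f i x).
Proof.
move=> oA Hf; elim: r => [|i r IH].
  apply: (Fn_ext (f := cst 0) oA); last exact: Fn_cst.
  by move=> y _; rewrite big_nil.
apply: (Fn_ext oA _ (FnD oA (Hf i) IH)).
by move=> y _; rewrite big_cons.
Qed.

Lemma Fn_lin E F G n (A : set E) (L : {linear F -> G}) (f : E -> F) : open A ->
  continuous L -> Fn n A f -> Fn n A (fun x => L (f x)).
Proof.
move=> oA cL; elim: n f => [|n IH] f.
  by move=> cf x Ax; apply: continuous_comp; [exact: cf|exact: cL].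
move=> [df Df]; split=> [x Ax|v].
  by apply: differentiable_comp; [exact: df|exact: linear_differentiable].
apply: (Fn_ext oA _ (IH _ (Df v))) => y Ay.
have dfy := df y Ay; have dL : differentiable L (f y) by exact: linear_differentiable.
rewrite -[RHS]/('D_v (L \o f) y) !deriveE//; last exact: differentiable_comp.
by rewrite (diff_comp dfy dL)/= diff_lin.
Qed.

Lemma is_diff_bil E F1 F2 G (b : {bilinear F1 -> F2 -> G}) (f df : E -> F1)
    (g dg : E -> F2) x : continuous (fun p => b p.1 p.2) ->
  is_diff x f df -> is_diff x g dg ->
  is_diff x (fun y => b (f y) (g y)) (fun v => b (f x) (dg v) + b (df v) (g x)).
Proof.
move=> cb Hf Hg.
have Hb : is_diff (f x, g x) (fun p => b p.1 p.2) (fun q => b (f x) q.2 + b q.1 (g x)).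
  by apply: DiffDef; [exact: differentiable_bilin|exact: diff_bilin].
exact: (is_diff_comp (is_diff_pair Hf Hg) Hb).
Qed.

(** The derivative of b(f, g) is a sum of two terms of the same shape, so one induction serves
    scaling and complex multiplication alike. *)
Lemma Fn_bil E F1 F2 G n (A : set E) (b : {bilinear F1 -> F2 -> G}) (f : E -> F1)
    (g : E -> F2) : open A -> continuous (fun p => b p.1 p.2) ->
  Fn n A f -> Fn n A g -> Fn n A (fun y => b (f y) (g y)).
Proof.
move=> oA cb; elim: n f g => [|n IH] f g.
  move=> cf cg x Ax.
  apply: (continuous_comp (f := fun y => (f y, g y)) (g := fun p => b p.1 p.2)); last exact: cb.
  by apply: cvg_pair => /=; [exact: cf|exact: cg].
move=> Hf Hg; have [df Df] := Hf; have [dg Dg] := Hg.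
have D x (Ax : A x) := is_diff_bil cb
  (differentiableP (df x Ax)) (differentiableP (dg x Ax)).
split=> [x Ax|v]; first by have [] := D x Ax.
apply: (Fn_ext oA _ (FnD oA
  (IH _ _ (FnW Hf) (Dg v)) (IH _ _ (Df v) (FnW Hg)))) => y Ay.
have [dd dv] := D y Ay; rewrite [RHS]deriveE// dv.
by rewrite !deriveE//; [exact: df|exact: dg].
Qed.

Lemma Fn_pair E F1 F2 n (A : set E) (f : E -> F1) (g : E -> F2) : open A ->
  Fn n A f -> Fn n A g -> Fn n A (fun y => (f y, g y)).
Proof.
move=> oA; elim: n f g => [|n IH] f g.
  by move=> cf cg x Ax; apply: cvg_pair => /=; [exact: cf|exact: cg].
move=> [df Df] [dg Dg].
split=> [x Ax|v]; first by apply: differentiable_pair; [exact: df|exact: dg].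
apply: (Fn_ext oA _ (IH _ _ (Df v) (Dg v))) => y Ay.
have dfy := df y Ay; have dgy := dg y Ay.
by rewrite !deriveE// ?diff_pair//; exact: differentiable_pair.
Qed.

(** Coordinates by continuous linear forms. [Fn] controls derivatives in fixed directions only, so
    the chain rule has to expand the moving vector ['D_v f x] in a fixed basis. *)
Definition findim F := exists (I : finType) (e : I -> F) (l : I -> {linear F -> R}),
  (forall i, continuous (l i)) /\ forall v, v = \sum_i l i v *: e i.

Definition scaleb F (a : R) (x : F) : F := a *: x.

Lemma scaleb_bilinear F : bilinear_for
    (GRing.Scale.Law.clone _ _ *:%R _) (GRing.Scale.Law.clone _ _ *:%R _)
    (@scaleb F).
Proof.
rewrite /scaleb.
split=> [u'|u] a x y /=; first by rewrite scalerDl scalerA.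
by rewrite scalerDr !scalerA mulrC.
Qed.
HB.instance Definition _ F := bilinear_isBilinear.Build R R F F _ _
  (@scaleb F) (scaleb_bilinear F).

Lemma Fn_scale E F n (A : set E) (f : E -> R) (g : E -> F) : open A ->
  Fn n A f -> Fn n A g -> Fn n A (fun y => f y *: g y).
Proof.
move=> oA; apply: (Fn_bil (b := @scaleb F)) => //.
by move=> p; exact: scale_continuous.
Qed.

Lemma Fn_comp E F G n (A : set E) (B : set F) (f : E -> F) (g : F -> G) :
  findim F -> open A -> (forall x, A x -> B (f x)) ->
  Fn n A f -> Fn n B g -> Fn n A (g \o f).
Proof.
move=> [m [e [l [cl le]]]] oA AB; elim: n g => [|n IH] g.
  move=> cf cg x Ax; apply: continuous_comp; [exact: cf|exact/cg/AB].
move=> Hf; have Hf' := FnW Hf; have [df Df] := Hf; move=> [dg Dg].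
split=> [x Ax|v].
  by apply: differentiable_comp; [exact: df|exact/dg/AB].
(* The chain rule with ['d g] expanded on the basis [e]: each summand is a scaling of a composition
   covered by the induction hypothesis. *)
have H : Fn n A (fun x => \sum_i l i ('D_v f x) *: ('D_(e i) g) (f x)).
  apply: Fn_sum => // i; apply: Fn_scale => //; last exact: (IH _ Hf' (Dg (e i))).
  exact: (Fn_lin oA (cl i) (Df v)).
apply: (Fn_ext oA _ H) => y Ay.
have dfy := df y Ay; have dgy := dg _ (AB _ Ay).
have -> : 'D_v (g \o f) y = 'd g (f y) ('D_v f y).
  rewrite (deriveE v dfy) (deriveE v (differentiable_comp dfy dgy)).
  by rewrite (diff_comp dfy dgy).
move: ('D_v f y) => w; rewrite [X in _ = 'd _ _ X](le w) linear_sum.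
by apply: eq_bigr => i _; rewrite linearZ (deriveE _ dgy).
Qed.

Lemma Fn_inv E n (A : set E) (f : E -> R) : open A ->
  (forall x, A x -> f x != 0) -> Fn n A f -> Fn n A (fun x => (f x)^-1).
Proof.
move=> oA f0; elim: n => [|n IH].
  by move=> cf x Ax; apply: cvgV; [exact: f0|exact: cf].
move=> Hf; have [df Df] := Hf.
split=> [x Ax|v]; first by apply: (@differentiableV _ _ f); [exact: df|exact: f0].
have I := IH (FnW Hf).
have H : Fn n A (fun x => (-1) *: ((f x)^-1 *: ((f x)^-1 *: 'D_v f x))).
  apply: (Fn_scale oA (Fn_cst _ _ _)); apply: (Fn_scale oA I).
  exact: (Fn_scale oA I (Df v)).
apply: (Fn_ext oA _ H) => y Ay.
rewrite -[in RHS]/('D_v (fun x => (f x)^-1) y).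
rewrite (@deriveV _ _ f); [|exact: f0|exact/diff_derivable/df].
by rewrite scaleN1r scalerA -scaleNr -expr2 exprVn.
Qed.

End FrechetSmooth.

(** * The complex plane *)

Section ComplexPlane.
Context {R : realType}.
Local Notation C := (Rcomplex R).
Implicit Types (x y z : C) (a b r : R).

(** Copies at type [Rcomplex R], which receive real-linear structures below so that the differential
    calculus applies to them. *)
Definition reC z : R := complex.Re z.
Definition imC z : R := complex.Im z.
Definition cj z : C := conjc z.

Lemma complexP x y : reC x = reC y -> imC x = imC y -> x = y.
Proof. by case: x y => [a b] [c d] /= -> ->. Qed.

Lemma reCD x y : reC (x + y) = reC x + reC y. Proof. by case: x y => [? ?] []. Qed.
Lemma imCD x y : imC (x + y) = imC x + imC y. Proof. by case: x y => [? ?] []. Qed.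
Lemma reCN x : reC (- x) = - reC x. Proof. by case: x. Qed.
Lemma imCN x : imC (- x) = - imC x. Proof. by case: x. Qed.
Lemma reCM x y : reC (x * y) = reC x * reC y - imC x * imC y.
Proof. by case: x y => [? ?] []. Qed.
Lemma imCM x y : imC (x * y) = reC x * imC y + imC x * reC y.
Proof. by case: x y => [? ?] []. Qed.
Lemma reCZ a x : reC (a *: x) = a * reC x. Proof. by case: x. Qed.
Lemma imCZ a x : imC (a *: x) = a * imC x. Proof. by case: x. Qed.
Lemma reC_cj x : reC (cj x) = reC x. Proof. by case: x. Qed.
Lemma imC_cj x : imC (cj x) = - imC x. Proof. by case: x. Qed.
Lemma reC_toC a : reC (toC a) = a. Proof. by []. Qed.
Lemma imC_toC a : imC (toC a) = 0. Proof. by []. Qed.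
Lemma reC_i : reC iC = 0. Proof. by []. Qed.
Lemma imC_i : imC iC = 1. Proof. by []. Qed.
Lemma reC0 : reC 0 = 0. Proof. by []. Qed.
Lemma imC0 : imC 0 = 0. Proof. by []. Qed.
Lemma reC1 : reC 1 = 1. Proof. by []. Qed.
Lemma imC1 : imC 1 = 0. Proof. by []. Qed.
Definition reimE := (reCD, imCD, reCN, imCN, reCM, imCM, reCZ, imCZ, reC_cj, imC_cj,
  reC_toC, imC_toC, reC_i, imC_i, reC0, imC0, reC1, imC1).

Ltac by_reim := apply: complexP; rewrite !reimE; ring.

Lemma cjD x y : cj (x + y) = cj x + cj y. Proof. by_reim. Qed.
Lemma cjN x : cj (- x) = - cj x. Proof. by_reim. Qed.
Lemma cjB x y : cj (x - y) = cj x - cj y. Proof. by_reim. Qed.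
Lemma cjM x y : cj (x * y) = cj x * cj y. Proof. by_reim. Qed.
Lemma cjK x : cj (cj x) = x. Proof. by_reim. Qed.
Lemma cj_toC a : cj (toC a) = toC a. Proof. by_reim. Qed.
Lemma cj_i : cj iC = - iC. Proof. by_reim. Qed.
Lemma cj0 : cj 0 = 0. Proof. by_reim. Qed.
Lemma cj1 : cj 1 = 1. Proof. by_reim. Qed.
Lemma toCD a b : toC (a + b) = toC a + toC b. Proof. by_reim. Qed.
Lemma toCN a : toC (- a) = - toC a. Proof. by_reim. Qed.
Lemma toCB a b : toC (a - b) = toC a - toC b. Proof. by_reim. Qed.
Lemma toCM a b : toC (a * b) = toC a * toC b. Proof. by_reim. Qed.
Lemma toC0 : toC 0 = 0 :> C. Proof. by_reim. Qed.
Lemma toC1 : toC 1 = 1 :> C. Proof. by_reim. Qed.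
Lemma toC_nat n : toC n%:R = n%:R :> C.
Proof. by elim: n => [|n IH]; rewrite ?toC0// -!natr1 toCD IH toC1. Qed.
Lemma toC_inj : injective (@toC R). Proof. by move=> a b [->]. Qed.
Lemma toC_eq0 a : (toC a == 0) = (a == 0).
Proof. by rewrite -toC0; apply/eqP/eqP => [/toC_inj|->]. Qed.
Lemma toCV a : toC a^-1 = (toC a)^-1.
Proof.
have [->|a0] := eqVneq a 0; first by rewrite invr0 toC0 invr0.
apply: (mulfI (x := toC a)); first by rewrite toC_eq0.
by rewrite -toCM !divff ?toC_eq0// toC1.
Qed.
Lemma toCX a n : toC (a ^+ n) = toC a ^+ n.
Proof. by elim: n => [|n IH]; rewrite ?expr0 ?toC1// !exprS toCM IH. Qed.
Lemma iCM : iC * iC = -1 :> C. Proof. by_reim. Qed.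
Lemma scaleC a x : a *: x = toC a * x. Proof. by_reim. Qed.
Lemma reim x : x = toC (reC x) + iC * toC (imC x). Proof. by_reim. Qed.
Lemma addcj x : x + cj x = toC (2 * reC x). Proof. by_reim. Qed.
Lemma cj_eq0 x : (cj x == 0) = (x == 0).
Proof. by apply/eqP/eqP => [e|->]; [rewrite -(cjK x) e cj0|rewrite cj0]. Qed.
Lemma cjV x : cj x^-1 = (cj x)^-1.
Proof.
have [->|x0] := eqVneq x 0; first by rewrite invr0 cj0 invr0.
apply: (mulfI (x := cj x)); first by rewrite cj_eq0.
by rewrite -cjM !divff ?cj_eq0// cj1.
Qed.
Lemma cjX x n : cj (x ^+ n) = cj x ^+ n.
Proof. by elim: n => [|n IH]; rewrite ?expr0 ?cj1// !exprS cjM IH. Qed.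

Definition nC z : R := `|z|.

Lemma nCE x : nC x = Num.sqrt (reC x ^+ 2 + imC x ^+ 2). Proof. by case: x. Qed.
Lemma nC2 x : nC x ^+ 2 = reC x ^+ 2 + imC x ^+ 2.
Proof. by rewrite nCE sqr_sqrtr// addr_ge0// sqr_ge0. Qed.
Lemma nC_ge0 x : 0 <= nC x. Proof. exact: normr_ge0. Qed.
Lemma nC_eq0 x : (nC x == 0) = (x == 0). Proof. exact: normr_eq0. Qed.
Lemma nC_gt0 x : (0 < nC x) = (x != 0). Proof. exact: normr_gt0. Qed.
Lemma nC0 : nC 0 = 0. Proof. exact: normr0. Qed.
Lemma nCD x y : nC (x + y) <= nC x + nC y. Proof. exact: ler_normD. Qed.
Lemma nCN x : nC (- x) = nC x. Proof. exact: normrN. Qed.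
Lemma mulcj x : x * cj x = toC (nC x ^+ 2). Proof. by rewrite nC2; by_reim. Qed.
Lemma nCM x y : nC (x * y) = nC x * nC y.
Proof.
apply/eqP; rewrite -(@eqrXn2 _ 2)// ?mulr_ge0 ?nC_ge0// exprMn !nC2 !reimE.
by apply/eqP; ring.
Qed.
Lemma nC_cj x : nC (cj x) = nC x. Proof. by rewrite !nCE !reimE sqrrN. Qed.
Lemma nC_toC a : nC (toC a) = `|a|.
Proof. by rewrite nCE !reimE expr0n addr0 sqrtr_sqr. Qed.
Lemma nC_iC : nC iC = 1.
Proof. by rewrite nCE !reimE expr0n add0r expr1n sqrtr1. Qed.
Lemma nC1 : nC 1 = 1. Proof. by rewrite -toC1 nC_toC normr1. Qed.
Lemma nCV x : nC x^-1 = (nC x)^-1.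
Proof.
have [->|x0] := eqVneq x 0; first by rewrite invr0 nC0 invr0.
apply: (mulfI (x := nC x)); first by rewrite nC_eq0.
by rewrite -nCM !divff ?nC_eq0// nC1.
Qed.
Lemma nCX x n : nC (x ^+ n) = nC x ^+ n.
Proof. by elim: n => [|n IH]; rewrite ?expr0 ?nC1// !exprS nCM IH. Qed.
Lemma nC_Z a x : nC (a *: x) = `|a| * nC x. Proof. exact: normrZ. Qed.
Lemma reC_le x : `|reC x| <= nC x.
Proof.
rewrite -(@ler_pXn2r _ 2)// ?nnegrE ?nC_ge0// nC2 real_normK ?num_real//.
by rewrite lerDl sqr_ge0.
Qed.
Lemma imC_le x : `|imC x| <= nC x.
Proof.
rewrite -(@ler_pXn2r _ 2)// ?nnegrE ?nC_ge0// nC2 real_normK ?num_real//.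
by rewrite lerDr sqr_ge0.
Qed.
Lemma nC_le x : nC x <= `|reC x| + `|imC x|.
Proof.
rewrite -(@ler_pXn2r _ 2)// ?nnegrE ?nC_ge0 ?addr_ge0// nC2 sqrrD !real_normK ?num_real//.
by rewrite addrAC lerDl mulrn_wge0// mulr_ge0.
Qed.

Fact reC_scalar : linear reC. Proof. by move=> a x y; rewrite !reimE. Qed.
HB.instance Definition _ := GRing.isLinear.Build R C R _ reC reC_scalar.
Fact imC_scalar : linear imC. Proof. by move=> a x y; rewrite !reimE. Qed.
HB.instance Definition _ := GRing.isLinear.Build R C R _ imC imC_scalar.
Fact toC_linear : linear (@toC R : R -> C).
Proof. by move=> a x y; rewrite -[a *: x]/(a * x); by_reim. Qed.
HB.instance Definition _ := GRing.isLinear.Build R R C _ (@toC R) toC_linear.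
Fact cj_linear : linear cj. Proof. by move=> a x y; by_reim. Qed.
HB.instance Definition _ := GRing.isLinear.Build R C C _ cj cj_linear.

Definition mulCx x y : C := x * y.
Fact mulCx_bilinear : bilinear_for
    (GRing.Scale.Law.clone _ _ *:%R _) (GRing.Scale.Law.clone _ _ *:%R _) mulCx.
Proof. by split=> [u'|u] a x y /=; rewrite /mulCx !scaleC; ring. Qed.
HB.instance Definition _ := bilinear_isBilinear.Build R C C C _ _ mulCx mulCx_bilinear.

Lemma norm_le_linear_continuous (E F : normedModType R) (L : {linear E -> F}) (k : R) :
  (forall v, `|L v| <= k * `|v|) -> continuous L.
Proof.
move=> Lk; apply/linear_bounded_continuous/linear_boundedP.
exists `|k|; split; first exact: normr_real.
move=> M kM v; apply: le_trans (Lk v) _.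
by rewrite ler_wpM2r// (le_trans (ler_norm k))// ltW.
Qed.

Lemma reC_continuous : continuous reC.
Proof. by apply: (@norm_le_linear_continuous C R reC 1) => v; rewrite mul1r reC_le. Qed.
Lemma imC_continuous : continuous imC.
Proof. by apply: (@norm_le_linear_continuous C R imC 1) => v; rewrite mul1r imC_le. Qed.
Lemma toC_continuous : continuous (@toC R : R -> C).
Proof. by apply: (@norm_le_linear_continuous R C (@toC R) 1) => v; rewrite mul1r -/(nC _) nC_toC. Qed.
Lemma cj_continuous : continuous cj.
Proof. by apply: (@norm_le_linear_continuous C C cj 1) => v; rewrite mul1r -/(nC _) nC_cj. Qed.
Definition lmulC x : C -> C := fun y => x * y.
Fact lmulC_linear x : linear (lmulC x).
Proof. by move=> a y z; rewrite /lmulC !scaleC; ring. Qed.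
HB.instance Definition _ x := GRing.isLinear.Build R C C _ (lmulC x) (lmulC_linear x).
Lemma lmulC_continuous x : continuous (lmulC x).
Proof.
apply: (@norm_le_linear_continuous C C (lmulC x) (nC x)) => v.
by rewrite -/(nC (lmulC x v)) nCM.
Qed.

Lemma mulCx_continuous : continuous (fun p : C * C => mulCx p.1 p.2).
Proof.
(* The product as real scalings of p.2 and of i p.2; the latter is continuous because multiplication
   by a fixed number is a bounded linear map. *)
have -> : (fun p : C * C => mulCx p.1 p.2) =
   (fun p => reC p.1 *: p.2 + imC p.1 *: (toC (- imC p.2) + iC * toC (reC p.2))).
  by apply/funext => -[x y]; rewrite /mulCx /=; by_reim.
have H p : mulCx iC p = toC (- imC p) + iC * toC (reC p).
  by rewrite /mulCx; by_reim.
have Hi : continuous (mulCx iC) by exact: lmulC_continuous.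
move=> p; apply: cvgD.
  apply: cvgZ; last exact: cvg_snd.
  by apply: continuous_comp; [exact: cvg_fst|exact: reC_continuous].
apply: cvgZ.
  by apply: continuous_comp; [exact: cvg_fst|exact: imC_continuous].
rewrite -H; under eq_fun do rewrite -H.
by apply: continuous_comp; [exact: cvg_snd|exact: Hi].
Qed.

Lemma findimR : findim R.
Proof.
exists unit, (fun=> 1), (fun=> idfun); split=> [_ x|v]; first exact: cvg_id.
by rewrite (big_pred1 tt) /=; [rewrite [RHS]mulr1|case].
Qed.

Lemma findimC : findim C.
Proof.
exists bool, (fun b : bool => if b then 1 else iC),
  (fun b : bool => if b then (reC : {linear C -> R}) else (imC : {linear C -> R})); split.
  by case; [exact: reC_continuous|exact: imC_continuous].
by move=> v; rewrite big_bool /=; by_reim.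
Qed.

Lemma findim_prod (E F : normedModType R) : findim E -> findim F -> findim (E * F)%type.
Proof.
move=> [I [e [l [cl le]]]] [J [f [k [ck kf]]]].
exists (I + J)%type, (fun i => match i with inl i => (e i, 0) | inr j => (0, f j) end),
  (fun i => match i with inl i => (l i \o fst : {linear (E * F)%type -> R}) | inr j => (k j \o snd : {linear (E * F)%type -> R}) end); split.
  case=> j /=.
    by move=> p; apply: continuous_comp; [exact: cvg_fst|exact: cl].
  by move=> p; apply: continuous_comp; [exact: cvg_snd|exact: ck].
move=> [v w]; rewrite big_sumType /=.
apply: injective_projections; rewrite /= ?raddfD !raddf_sum /=.
  rewrite [LHS]le [X in _ + X]big1 ?addr0// => j _; exact: scaler0.
rewrite [LHS]kf [X in X + _]big1 ?add0r// => j _; exact: scaler0.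
Qed.

End ComplexPlane.
#[global] Arguments cj {R} z : simpl never.
#[global] Arguments reC {R} z : simpl never.
#[global] Arguments imC {R} z : simpl never.
#[global] Arguments nC {R} z : simpl never.

(** * Second derivatives *)

Section OneVariable.
Context {R : realType}.
Implicit Types E F : normedModType R.

Lemma line_derive E F (f : E -> F) (y v : E) (t : R) : derivable f (t *: v + y) v ->
  is_derive t 1 (fun t : R => f (t *: v + y)) ('D_v f (t *: v + y)).
Proof.
have e : (fun h : R => h^-1 *: (((fun t : R => f (t *: v + y)) \o shift t) (h *: (1:R)) - f (t *: v + y)))
   = (fun h : R => h^-1 *: ((f \o shift (t *: v + y)) (h *: v) - f (t *: v + y))).
  by apply/funext => h /=; rewrite [h *: 1]mulr1 scalerDl addrA.
by move=> df; apply: DeriveDef; rewrite /derivable /derive e.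
Qed.

Lemma is_derive_eps F (g : R -> F) (t : R) l : is_derive t 1 g l ->
  forall e : R, 0 < e -> \forall h \near (0 : R), `|g (h + t) - g t - h *: l| <= e * `|h|.
Proof.
move=> [d <-] e e0; have D : differentiable g t by exact/derivable1_diffP.
have := is_diff_eps D e0; apply: filterS => h.
suff -> : 'd g t h = h *: 'D_1 g t by [].
by rewrite deriveE// -linearZ /= [h *: 1]mulr1.
Qed.

Lemma MVT_closed (g dg : R -> R) (a b : R) : a < b ->
  (forall t : R, a <= t <= b -> is_derive t 1 g (dg t)) ->
  exists2 t, a < t < b & g b - g a = dg t * (b - a).
Proof.
move=> ab H; have [t||t tab e] := @MVT R g dg a b ab.
- by rewrite in_itv /= => /andP[at_ tb]; apply: H; rewrite !ltW.
- apply: derivable_within_continuous => t; rewrite in_itv /= => /H.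
  by case.
- by exists t => //; move: tab; rewrite in_itv.
Qed.

Lemma MVT_signed (g dg : R -> R) (a : R) :
  (forall t : R, `|t| <= `|a| -> is_derive t 1 g (dg t)) ->
  exists2 t, `|t| <= `|a| & g a - g 0 = dg t * a.
Proof.
move=> H; have [a0|a0|->] := ltgtP a 0; last first.
- by exists 0; rewrite ?lexx// subrr mulr0.
- have H1 (t : R) : 0 <= t <= a -> is_derive t 1 g (dg t).
    by case/andP=> t0 ta; apply: H; rewrite !ger0_norm// ltW.
  have [t /andP[t0 ta] e] := MVT_closed a0 H1.
  by exists t; [rewrite !gtr0_norm// ltW|rewrite e subr0].
- have H1 (t : R) : a <= t <= 0 -> is_derive t 1 g (dg t).
    by case/andP=> ta t0; apply: H; rewrite !ler0_norm ?lerN2// ltW.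
  have [t /andP[ta t0] e] := MVT_closed a0 H1.
  exists t; first by rewrite !ltr0_norm// lerN2 ltW.
  by rewrite -opprB e sub0r mulrN opprK.
Qed.

(** At the minimum [dg 0 = 0]. If l < 0, the expansion of dg with error -l/2 makes dg negative just
    to the right of 0, and the mean value theorem then makes g smaller than g 0. *)
Lemma second_derive_at_min (g dg : R -> R) (r l : R) : 0 < r ->
  (forall t : R, `|t| < r -> is_derive t 1 g (dg t)) -> is_derive (0 : R) 1 dg l ->
  (forall t : R, `|t| < r -> g 0 <= g t) -> 0 <= l.
Proof.
move=> r0 Hg Hdg gmin; rewrite leNgt; apply/negP => l0.
have D0 : is_derive (0 : R) 1 g 0.
  apply: (@derive1_at_min R g (- r) r).
  - by rewrite ge0_cp// ltW.
  - by move=> t; rewrite in_itv /= -ltr_norml => /Hg[].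
  - by rewrite in_itv /= oppr_lt0 r0.
  - by move=> t; rewrite in_itv /= -ltr_norml; exact: gmin.
have dg0 : dg 0 = 0.
  have /Hg[_ <-] : `|0 : R| < r by rewrite normr0.
  by have [_ ->] := D0.
have l20 : 0 < - l / 2 by rewrite divr_gt0// oppr_gt0.
have := is_derive_eps Hdg l20.
move=> /nbhs_ballP[d /= d0 Hd].
pose h := Num.min d r / 2.
have m0 : 0 < Num.min d r by rewrite lt_min d0.
have h0 : 0 < h by rewrite divr_gt0.
have hm : h < Num.min d r by rewrite ltr_pdivrMr// ltr_pMr// ltr1n.
have [hd hr] : h < d /\ h < r.
  by split; apply: lt_le_trans hm _; rewrite ge_min lexx ?orbT.
have H1 (t : R) : 0 <= t <= h -> is_derive t 1 g (dg t).
  by case/andP=> t0 th; apply: Hg; rewrite ger0_norm// (le_lt_trans th).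
have [t /andP[t0 th] e] := MVT_closed h0 H1.
have dgt : dg t < 0.
  have /Hd : ball (0 : R) d t by rewrite /ball /= sub0r normrN gtr0_norm// (lt_trans th).
  rewrite /= addr0 dg0 subr0 (gtr0_norm t0) => /ler_normlP[_].
  rewrite -[t *: l]/(t * l); have : l * t < 0 by rewrite nmulr_rlt0.
  nra.
have := gmin h; rewrite gtr0_norm// => /(_ hr); rewrite -subr_ge0 e subr0.
by rewrite leNgt nmulr_rlt0// h0.
Qed.

End OneVariable.

(** * Differentiability of C^1 maps of the plane *)

Section PlaneCalculus.
Context {R : realType}.
Local Notation C := (Rcomplex R).

(** The increment is split at the corner z + i Im h. The mean value theorem on each leg produces
    partial derivatives at points within 2|h| of z, where they are close to those at z. *)
Lemma C1_differentiable_real (A : set C) (f : C -> R) (z : C) : open A -> A z ->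
  (forall w, A w -> derivable f w 1 /\ derivable f w iC) ->
  {for z, continuous ('D_1 f)} -> {for z, continuous ('D_iC f)} ->
  differentiable f z.
Proof.
move=> oA Az df c1 ci.
pose L0 (h : C) : R := reC h * 'D_1 f z + imC h * 'D_iC f z.
have L0l : linear L0 by move=> a x y; rewrite /L0 !reimE /GRing.scale /=; ring.
pose Lm := GRing.isLinear.Build R C R _ L0 L0l.
pose L : {linear C -> R} := HB.pack L0 Lm.
have Lc : continuous L.
  apply: (norm_le_linear_continuous (k := `|'D_1 f z| + `|'D_iC f z|)) => v.
  apply: le_trans (ler_normD _ _) _; rewrite !normrM mulrDl [`|_ v| * _]mulrC [`|imC v| * _]mulrC.
  by apply: lerD; apply: ler_wpM2l => //; [exact: reC_le|exact: imC_le].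
suff : is_diff z f L by case.
apply: is_diffP => // e e0.
have e20 : 0 < e / 2 by rewrite divr_gt0.
have /cvgrPdist_le/(_ _ e20)/nbhs_ballP[r1 /= r10 H1] : 'D_1 f x @[x --> z] --> 'D_1 f z := c1.
have /cvgrPdist_le/(_ _ e20)/nbhs_ballP[r2 /= r20 H2] : 'D_iC f x @[x --> z] --> 'D_iC f z := ci.
have /nbhs_ballP[r3 /= r30 H3] := open_nbhs_nbhs (conj oA Az).
pose r := Num.min r1 (Num.min r2 r3).
have r0 : 0 < r by rewrite !lt_min r10 r20 r30.
apply/nbhs_ballP; exists (r / 2) => /=; first by rewrite divr_gt0.
move=> h; rewrite -ball_normE /= sub0r normrN -/(nC h) => hr.
have near_z (x : C) : nC x <= 2 * nC h -> ball z r (x + z).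
  move=> xh; rewrite -ball_normE /= opprD addrC subrK normrN -/(nC x).
  by apply: le_lt_trans xh _; rewrite mulrC -ltr_pdivlMr.
have sub (x : C) : nC x <= 2 * nC h -> [/\ `|'D_1 f z - 'D_1 f (x + z)| <= e / 2,
     `|'D_iC f z - 'D_iC f (x + z)| <= e / 2 & A (x + z)].
  move=> /near_z B; split; [apply: H1|apply: H2|apply: H3]; apply: le_ball B;
  by rewrite /r !ge_min lexx ?orbT.
have bd (t : R) : `|t| <= `|reC h| -> nC (toC t + iC * toC (imC h)) <= 2 * nC h.
  move=> th; apply: le_trans (nCD _ _) _; rewrite nCM nC_iC mul1r !nC_toC mulrDl mul1r.
  by apply: lerD; [apply: le_trans th (reC_le h)|exact: imC_le].
have bd' (t : R) : `|t| <= `|imC h| -> nC (iC * toC t) <= 2 * nC h.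
  move=> th; rewrite nCM nC_iC mul1r nC_toC; apply: le_trans th _.
  by apply: le_trans (imC_le h) _; have := nC_ge0 h; lra.
have [t tb et] : exists2 t, `|t| <= `|reC h| &
    f (h + z) - f (iC * toC (imC h) + z) = 'D_1 f (toC t + iC * toC (imC h) + z) * reC h.
  have [t|t tb et] := @MVT_signed R (fun t : R => f (t *: (1 : C) + (iC * toC (imC h) + z)))
    (fun t => 'D_1 f (t *: (1 : C) + (iC * toC (imC h) + z))) (reC h).
    move=> /bd /sub[_ _ At]; apply: line_derive; apply: (df _ _).1.
    by rewrite scaleC mulr1 addrA.
  exists t => //; move: et; rewrite scale0r add0r !scaleC !mulr1 !addrA.
  by rewrite -reim => ->.
have [s sb es] : exists2 s, `|s| <= `|imC h| &
    f (iC * toC (imC h) + z) - f z = 'D_iC f (iC * toC s + z) * imC h.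
  have [s|s sb es] := @MVT_signed R (fun t : R => f (t *: (iC : C) + z))
    (fun t => 'D_iC f (t *: (iC : C) + z)) (imC h).
    move=> /bd' /sub[_ _ At]; apply: line_derive; apply: (df _ _).2.
    by rewrite scaleC mulrC.
  exists s => //; move: es; rewrite scale0r add0r !scaleC.
  by rewrite ![_ * iC]mulrC => ->.
have [B1 _ _] := sub _ (bd t tb); have [_ B2 _] := sub _ (bd' s sb).
have -> : f (h + z) - f z = (f (h + z) - f (iC * toC (imC h) + z))
  + (f (iC * toC (imC h) + z) - f z) by rewrite addrA subrK.
rewrite et es /L /= /L0.
set d1 := 'D_1 f (_ + z) in B1 *; set d2 := 'D_iC f (_ + z) in B2 *.
have -> : d1 * reC h + d2 * imC h - (reC h * 'D_1 f z + imC h * 'D_iC f z)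
  = - (('D_1 f z - d1) * reC h + ('D_iC f z - d2) * imC h) by ring.
rewrite normrN; apply: le_trans (ler_normD _ _) _; rewrite !normrM [leRHS](_ : _ = e / 2 * nC h + e / 2 * nC h); last by rewrite /nC; field.
by apply: lerD; apply: ler_pM => //; [exact: reC_le|exact: imC_le].
Qed.

Lemma is_derive_lin (E F G : normedModType R) (L : {linear F -> G}) (f : E -> F) (x v : E) :
  continuous L -> derivable f x v -> is_derive x v (fun y => L (f y)) (L ('D_v f x)).
Proof.
move=> cL df; have e : (fun h : R => h^-1 *: (((fun y => L (f y)) \o shift x) (h *: v) - L (f x)))
    = (fun h : R => L (h^-1 *: ((f \o shift x) (h *: v) - f x))).
  by apply/funext => h /=; rewrite [RHS]linearZ [in RHS]linearB.
have K : (fun h : R => L (h^-1 *: ((f \o shift x) (h *: v) - f x))) @ 0^' --> L ('D_v f x).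
  by apply: continuous_cvg; [exact: cL|exact: df].
apply: DeriveDef; rewrite /derivable /derive e; first by apply: cvgP K.
exact: cvg_lim K.
Qed.

(** The mean value theorem needs real values, so the real and imaginary parts are treated separately
    and reassembled. *)
Lemma C1_differentiable (A : set C) (f : C -> C) (z : C) : open A -> A z ->
  (forall w v, A w -> derivable f w v) -> (forall v, {for z, continuous ('D_v f)}) ->
  differentiable f z.
Proof.
move=> oA Az df cf.
have H (L : {linear C -> R}) : continuous L -> differentiable (fun y => L (f y)) z.
  move=> cL; have D w v : A w -> is_derive w v (fun y => L (f y)) (L ('D_v f w)).
    by move=> Aw; apply: is_derive_lin => //; exact: df.
  have K v : {for z, continuous ('D_v (fun y => L (f y)))}.
    apply: (continuous_eq_on (f := fun w => L ('D_v f w)) oA Az).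
      by move=> y /D - /(_ v)[].
    by apply: (@continuous_comp _ _ _ ('D_v f) L); [exact: cf|exact: cL].
  apply: (C1_differentiable_real oA Az _ (K 1) (K iC)) => w Aw.
  by split; [have [] := D w 1 Aw|have [] := D w iC Aw].
have -> : f = (@toC R \o (reC \o f)) + (lmulC iC \o (@toC R \o (imC \o f))).
  by apply/funext => w; rewrite [LHS]reim.
apply: differentiableD.
  by apply: differentiable_comp; [exact: (H reC reC_continuous)|exact/linear_differentiable/toC_continuous].
apply: differentiable_comp; last exact/linear_differentiable/lmulC_continuous.
by apply: differentiable_comp; [exact: (H imC imC_continuous)|exact/linear_differentiable/toC_continuous].
Qed.

(** One order is lost in passing from directional to Frechet derivatives, which is harmless for
    smooth maps. *)
Lemma smooth_Fsmooth (A : set C) (f : C -> C) : open A -> smooth A f -> Fsmooth A f.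
Proof.
move=> oA sf n; have {sf} := sf n.+1.
(* Differentiability is carried through the induction: applied to ['D_v g] it gives the continuity
   of partial derivatives that makes g itself differentiable. *)
suff H (g : C -> C) : Cn n.+1 A g -> Fn n A g /\ forall z, A z -> differentiable g z by move=> /H[].
elim: n g => [|n IH] g Hg.
  have D z : A z -> differentiable g z.
    move=> Az; apply: (C1_differentiable oA Az) => [w v|v]; have [a b] := Hg v; first exact: a.
    exact: b.
  by split=> // z /D; exact: differentiable_continuous.
have D z : A z -> differentiable g z.
  move=> Az; apply: (C1_differentiable oA Az) => [w v|v]; have [a b] := Hg v; first exact: a.
  by have [_ /(_ z Az)] := IH _ b; exact: differentiable_continuous.
by split=> //; split=> // v; have [_ /IH[]] := Hg v.
Qed.

(** * Symmetry of second derivatives *)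

Section Schwarz.
Variable E : normedModType R.
Implicit Types (f : E -> R) (x v w : E).

Let second_difference f x v w (t : R) : R :=
  f (t *: v + (t *: w + x)) - f (t *: v + x) - (f (t *: w + x) - f x).

(** The mean value theorem in the direction v turns the second difference into t times a difference
    of values of ['D_v f]; both values are then expanded to first order at x, where ['D_v f] is
    differentiable. *)
Lemma second_difference_approx (A : set E) f x v w (e : R) : open A -> A x -> 0 < e ->
  (forall y, A y -> differentiable f y) -> differentiable ('D_v f) x ->
  \forall t \near (0 : R), `|second_difference f x v w t - t ^+ 2 * 'D_w ('D_v f) x|
     <= e * t ^+ 2 * (2 * `|v| + `|w|).
Proof.
move=> oA Ax e0 df dv.
have /nbhs_ballP[r1 /= r10 H1] := is_diff_eps dv e0.
have /nbhs_ballP[r2 /= r20 H2] := open_nbhs_nbhs (conj oA Ax).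
pose r := Num.min r1 r2; have r0 : 0 < r by rewrite lt_min r10.
pose M := `|v| + `|w| + 1; have M0 : 0 < M by rewrite ltr_wpDl// addr_ge0.
apply/nbhs_ballP; exists (r / M) => /=; first by rewrite divr_gt0.
move=> t; rewrite /ball /= sub0r normrN ltr_pdivlMr// => tr.
have small (s : R) : `|s| <= `|t| -> `|s *: v + t *: w| < r /\ `|s *: v| < r.
  move=> st; have h1 : `|s| * `|v| <= `|t| * `|v| by rewrite ler_wpM2r.
  have h2 : 0 <= `|t| * `|w| by rewrite mulr_ge0.
  have h3 := normr_ge0 t.
  have k : `|t| * `|v| + `|t| * `|w| < r.
    by apply: le_lt_trans tr; rewrite /M; nra.
  split; last by rewrite normrZ; apply: le_lt_trans k; lra.
  by apply: le_lt_trans (ler_normD _ _) _; rewrite !normrZ; apply: le_lt_trans k; lra.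
have near_x (y : E) : `|y| < r -> A (y + x) /\ `|'D_v f (y + x) - 'D_v f x - 'd ('D_v f) x y| <= e * `|y|.
  move=> yr; split.
    apply: H2; rewrite -ball_normE /= opprD addrC subrK normrN.
    by apply: lt_le_trans yr _; rewrite ge_min lexx orbT.
  by apply: H1; rewrite -ball_normE /= sub0r normrN; apply: lt_le_trans yr _; rewrite ge_min lexx.
have [s|s st es] := @MVT_signed R (fun s : R => f (s *: v + (t *: w + x)) - f (s *: v + x))
    (fun s => 'D_v f (s *: v + (t *: w + x)) - 'D_v f (s *: v + x)) t.
  move=> /small[/near_x[A1 _] /near_x[A2 _]].
  rewrite -addrA in A1.
  by apply: is_deriveB; apply: line_derive; apply/diff_derivable/df.
rewrite !scale0r !add0r in es.
have -> : second_difference f x v w t = ('D_v f (s *: v + (t *: w + x)) - 'D_v f (s *: v + x)) * t.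
  by rewrite -es /second_difference; ring.
have [/near_x[_ B1] /near_x[_ B2]] := small s st.
rewrite (deriveE w dv); move: B1 B2; rewrite linearD -(addrA (s *: v)).
have -> : 'd ('D_v f) x (t *: w) = t * 'd ('D_v f) x w by rewrite linearZ.
set a := 'D_v f (_ + _); set b := 'D_v f (_ + _); set c := 'D_v f x.
set l := 'd _ _ (s *: v); set m := 'd _ _ w => B1 B2.
have -> : (a - b) * t - t ^+ 2 * m = t * ((a - c - (l + t * m)) - (b - c - l)) by ring.
rewrite normrM; have -> : e * t ^+ 2 * (2 * `|v| + `|w|) = `|t| * (e * (`|t| * `|v| + `|t| * `|w|) + e * (`|t| * `|v|)).
  by rewrite -(real_normK (num_real t)); ring.
apply: ler_wpM2l => //; apply: le_trans (ler_normB _ _) _; apply: lerD.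
  apply: le_trans B1 _; rewrite ler_pM2l//; apply: le_trans (ler_normD _ _) _.
  by rewrite !normrZ lerD2r ler_wpM2r.
by apply: le_trans B2 _; rewrite ler_pM2l// normrZ ler_wpM2r.
Qed.

(** The second difference is symmetric in v and w, and t^2 times either mixed derivative
    approximates it. *)
Lemma derive_comm_real (A : set E) f x v w : open A -> A x ->
  (forall y, A y -> differentiable f y) -> differentiable ('D_v f) x ->
  differentiable ('D_w f) x -> 'D_w ('D_v f) x = 'D_v ('D_w f) x.
Proof.
move=> oA Ax df dv dw; apply/eqP; rewrite -subr_eq0 -normr_le0.
apply/ler_addgt0Pl => e e0; rewrite addr0.
(* The two error factors 2|v| + |w| and 2|w| + |v| add up to 3(|v| + |w|); the 1 keeps M
   positive. *)
pose M := 3 * (`|v| + `|w|) + 1; have M0 : 0 < M.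
  by rewrite ltr_wpDl// mulr_ge0// addr_ge0.
have eM : 0 < e / M by rewrite divr_gt0.
have := second_difference_approx w oA Ax eM df dv.
have := second_difference_approx v oA Ax eM df dw.
move=> /nbhs_ballP[r1 /= r10 H1] /nbhs_ballP[r2 /= r20 H2].
pose t := Num.min r1 r2 / 2.
have m0 : 0 < Num.min r1 r2 by rewrite lt_min r10.
have t0 : 0 < t by rewrite divr_gt0.
have tm : t < Num.min r1 r2 by rewrite ltr_pdivrMr// ltr_pMr// ltr1n.
have [tr1 tr2] : t < r1 /\ t < r2.
  by split; apply: lt_le_trans tm _; rewrite ge_min lexx ?orbT.
have {H1} := H1 t (ltac:(by rewrite /ball /= sub0r normrN gtr0_norm)).
have {H2} := H2 t (ltac:(by rewrite /ball /= sub0r normrN gtr0_norm)).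
have -> : second_difference f x w v t = second_difference f x v w t.
  by rewrite /second_difference addrCA; ring.
set S := second_difference _ _ _ _ _; set a := 'D_w _ _; set b := 'D_v _ _ => K1 K2.
have t2 : 0 < t ^+ 2 by rewrite exprn_gt0.
rewrite -(ler_pM2l t2) -[X in X * _ <= _](gtr0_norm t2) -normrM.
have -> : t ^+ 2 * (a - b) = (S - t ^+ 2 * b) - (S - t ^+ 2 * a) by ring.
apply: le_trans (ler_normB _ _) _; apply: le_trans (lerD K2 K1) _.
rewrite [leLHS](_ : _ = t ^+ 2 * (e * (3 * (`|v| + `|w|) / M))); last by ring.
by rewrite ler_pM2l// ler_piMr ?ltW// ltr_pdivrMr// mul1r /M ltrDl.
Qed.

End Schwarz.

Lemma derive_comm (A : set C) (f : C -> C) (z v w : C) : open A -> A z -> Fsmooth A f ->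
  'D_w ('D_v f) z = 'D_v ('D_w f) z.
Proof.
move=> oA Az sf.
have H (L : {linear C -> R}) : continuous L -> L ('D_w ('D_v f) z) = L ('D_v ('D_w f) z).
  move=> cL; pose g y := L (f y).
  have sg : Fsmooth A g by move=> n; exact: Fn_lin (sf n).
  have D y v' : A y -> 'D_v' g y = L ('D_v' f y).
    move=> Ay; have [_ ->//] := is_derive_lin (L := L) cL (diff_derivable (v := v') (Fsmooth_diff sf Ay)).
  have DD v1 v2 : 'D_v1 ('D_v2 g) z = L ('D_v1 ('D_v2 f) z).
    rewrite (derive_eq_on v1 oA Az (fun y Ay => D y v2 Ay)).
    have dd := Fsmooth_diff (Fsmooth_derive v2 sf) Az.
    by have [_ ->] := is_derive_lin (L := L) cL (diff_derivable (v := v1) dd).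
  apply: etrans (esym (DD w v)) (etrans _ (DD v w)).
  exact: (@derive_comm_real C A g z v w oA Az (fun y => Fsmooth_diff sg)
    (Fsmooth_diff (Fsmooth_derive v sg) Az) (Fsmooth_diff (Fsmooth_derive w sg) Az)).
by apply: complexP; [exact: (H reC reC_continuous)|exact: (H imC imC_continuous)].
Qed.

End PlaneCalculus.

(** * Wirtinger derivatives *)

Section Wirtinger.
Context {R : realType}.
Local Notation C := (Rcomplex R).
Implicit Types (f g : C -> C) (z a b c d : C).

(** The differential of f at z is a dz + b dzbar. Keeping differentiability and both derivatives in
    one relation lets the product, sum and conjugation rules compose without side conditions. *)
Definition wirtinger f z a b := is_diff z f (fun h => a * h + b * cj h).

Lemma is_diff_ext (E F : normedModType R) (f g df dg : E -> F) x :
  f =1 g -> df =1 dg -> is_diff x f df -> is_diff x g dg.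
Proof. by move=> /funext -> /funext ->. Qed.

Lemma wirtinger_derive f z a b v : wirtinger f z a b -> 'D_v f z = a * v + b * cj v.
Proof. by case=> df e; rewrite (deriveE _ df) e. Qed.

Lemma wirtinger_dz f z a b : wirtinger f z a b -> dz f z = a /\ dzbar f z = b.
Proof.
move=> H; rewrite /dz /dzbar !(wirtinger_derive _ H) cj1 cj_i.
have -> : (toC 2^-1 : C) = 2^-1 by rewrite toCV toC_nat.
have h : iC * iC = -1 :> C := iCM.
split.
  rewrite [RHS](_ : _ = 2^-1 * (a * 1 + b * 1 - (iC * iC) * (a - b))); last by rewrite h; field.
  by ring.
rewrite [RHS](_ : _ = 2^-1 * (a * 1 + b * 1 + (iC * iC) * (a - b))); last by rewrite h; field.
by ring.
Qed.

Lemma wirtinger_diff f z : differentiable f z -> wirtinger f z (dz f z) (dzbar f z).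
Proof.
move=> df; have H : is_diff z f ('d f z) by exact: differentiableP.
have E : ('d f z : C -> C) = (fun h => dz f z * h + dzbar f z * cj h).
  apply/funext => h; apply/esym; rewrite /dz /dzbar !deriveE//.
  rewrite [in RHS](reim h) linearD.
  have -> : toC (reC h) = reC h *: (1 : C) by rewrite scaleC mulr1.
  have -> : iC * toC (imC h) = imC h *: (iC : C) by rewrite scaleC mulrC.
  rewrite !linearZ /= !scaleC; set x := 'd f z 1; set y := 'd f z iC.
  by apply: complexP; rewrite !reimE; field.
by rewrite E in H.
Qed.

Lemma wirtinger_eq f z a b c d : wirtinger f z a b -> a = c -> b = d -> wirtinger f z c d.
Proof. by move=> H <- <-. Qed.

Lemma wirtinger_ext f g z a b : f =1 g -> wirtinger f z a b -> wirtinger g z a b.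
Proof. by move=> /funext ->. Qed.

Lemma wirtingerD f g z a b c d : wirtinger f z a b -> wirtinger g z c d ->
  wirtinger (fun w => f w + g w) z (a + c) (b + d).
Proof.
move=> Hf Hg; have H := @is_diffD _ _ _ _ _ _ _ _ Hf Hg.
apply: is_diff_ext H => // h; rewrite -[LHS]/((a * h + b * cj h) + (c * h + d * cj h)); ring.
Qed.

Lemma wirtingerN f z a b : wirtinger f z a b -> wirtinger (fun w => - f w) z (- a) (- b).
Proof.
move=> Hf; have H := @is_diffN _ _ _ _ _ _ Hf.
by apply: is_diff_ext H => // h; rewrite -[LHS]/(- (a * h + b * cj h)); ring.
Qed.

Lemma wirtingerM f g z a b c d : wirtinger f z a b -> wirtinger g z c d ->
  wirtinger (fun w => f w * g w) z (a * g z + f z * c) (b * g z + f z * d).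
Proof.
move=> Hf Hg; have H := is_diff_bil mulCx_continuous Hf Hg.
by apply: is_diff_ext H => // h; rewrite -[LHS]/(f z * (c * h + d * cj h) + (a * h + b * cj h) * g z); ring.
Qed.

Lemma wirtinger_cst c z : wirtinger (cst c) z 0 0.
Proof.
have H := @is_diff_cst _ C _ c z.
by apply: is_diff_ext H => // h; rewrite !mul0r addr0.
Qed.

Lemma is_diff_lin (E F G : normedModType R) (L : {linear F -> G}) (f df : E -> F) x :
  continuous L -> is_diff x f df -> is_diff x (fun y => L (f y)) (fun h => L (df h)).
Proof.
move=> cL Hf; apply: (is_diff_comp Hf (g := L) (dg := L)).
by apply: DiffDef; [exact: linear_differentiable|exact: diff_lin].
Qed.

Lemma wirtinger_cj f z a b : wirtinger f z a b -> wirtinger (fun w => cj (f w)) z (cj b) (cj a).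
Proof.
move=> Hf; have H := is_diff_lin cj_continuous Hf.
by apply: is_diff_ext H => // h /=; rewrite cjD !cjM cjK addrC.
Qed.

Lemma wirtinger_id z : wirtinger id z 1 0.
Proof.
have H : is_diff z (id : C -> C) id by exact: is_diff_id.
by apply: is_diff_ext H => // h; rewrite mul1r mul0r addr0.
Qed.

Lemma wirtinger_unique f z a b c d :
  wirtinger f z a b -> wirtinger f z c d -> a = c /\ b = d.
Proof. by move=> /wirtinger_dz[<- <-] /wirtinger_dz[]. Qed.

Lemma wirtinger_eq_on (A : set C) f g z a b : open A -> A z -> (forall w, A w -> f w = g w) ->
  wirtinger f z a b -> wirtinger g z a b.
Proof.
move=> oA Az fg H; have [df _] := H.
have dg := differentiable_eq_on oA Az fg df.
have D v : 'D_v g z = a * v + b * cj v by rewrite -(derive_eq_on v oA Az fg) (wirtinger_derive v H).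
have Hg : is_diff z g ('d g z) by exact: differentiableP.
have E : ('d g z : C -> C) = (fun h => a * h + b * cj h) by apply/funext => h; rewrite -deriveE.
by rewrite E in Hg.
Qed.

Section SmoothC.
Variables (E : normedModType R) (A : set E).
Hypothesis oA : open A.
Implicit Types p q : E -> C.

Lemma FnCM n p q : Fn n A p -> Fn n A q -> Fn n A (fun x => p x * q x).
Proof. exact: (@Fn_bil R E C C C n A mulCx p q oA mulCx_continuous). Qed.

Lemma Fn_cj n p : Fn n A p -> Fn n A (fun x => cj (p x)).
Proof. exact: (@Fn_lin R E C C n A cj p oA cj_continuous). Qed.

Lemma Fn_reC n p : Fn n A p -> Fn n A (fun x => reC (p x)).
Proof. exact: (@Fn_lin R E C R n A reC p oA reC_continuous). Qed.

Lemma Fn_imC n p : Fn n A p -> Fn n A (fun x => imC (p x)).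
Proof. exact: (@Fn_lin R E C R n A imC p oA imC_continuous). Qed.

Lemma Fn_toC n (r : E -> R) : Fn n A r -> Fn n A (fun x => toC (r x)).
Proof. exact: (@Fn_lin R E R C n A (@toC R) r oA toC_continuous). Qed.

Lemma FnRM n (r s : E -> R) : Fn n A r -> Fn n A s -> Fn n A (fun x => r x * s x).
Proof. exact: (Fn_scale oA). Qed.

Lemma FnN (F : normedModType R) n (p : E -> F) : Fn n A p -> Fn n A (fun x => - p x).
Proof.
move=> H; apply: (Fn_ext (f := fun x => (-1 : R) *: p x) oA) => [y _|]; first by rewrite scaleN1r.
exact: (Fn_scale oA (Fn_cst _ _ _)).
Qed.

Lemma FnB (F : normedModType R) n (p q : E -> F) : Fn n A p -> Fn n A q -> Fn n A (fun x => p x - q x).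
Proof. by move=> Hp Hq; apply: (FnD oA Hp); exact: FnN. Qed.

Lemma Fn_nC2 n p : Fn n A p -> Fn n A (fun x => nC (p x) ^+ 2).
Proof.
move=> H; apply: (Fn_ext (f := fun x => reC (p x) * reC (p x) + imC (p x) * imC (p x)) oA).
  by move=> y _; rewrite nC2.
by apply: (FnD oA); apply: FnRM; [exact: Fn_reC..|exact: Fn_imC|exact: Fn_imC].
Qed.

(** 1/p = conj p / |p|^2 reduces the complex inverse to the real one. *)
Lemma FnCV n p : (forall x, A x -> p x != 0) -> Fn n A p -> Fn n A (fun x => (p x)^-1).
Proof.
move=> p0 H; apply: (Fn_ext (f := fun x => cj (p x) * toC ((nC (p x) ^+ 2)^-1)) oA).
  move=> y Ay; have py := p0 y Ay; rewrite toCV -mulcj invfM mulrCA divff ?mulr1//.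
  by rewrite cj_eq0.
apply: FnCM; first exact: Fn_cj.
apply: Fn_toC; apply: (Fn_inv oA) => [x Ax|]; last exact: Fn_nC2.
by rewrite expf_neq0// nC_eq0 p0.
Qed.

End SmoothC.

(** The inverse is differentiable by [FnCV], so its derivatives can be solved for from f f^-1 =
    1. *)
Lemma wirtingerV (A : set C) f z a b : open A -> A z -> (forall w, A w -> f w != 0) ->
  Fsmooth A f -> wirtinger f z a b ->
  wirtinger (fun w => (f w)^-1) z (- a / (f z) ^+ 2) (- b / (f z) ^+ 2).
Proof.
move=> oA Az f0 sf H.
have sg : Fsmooth A (fun w => (f w)^-1) by move=> n; apply: FnCV.
have Hg := wirtinger_diff (Fsmooth_diff sg Az).
have P := wirtingerM H Hg.
have Q : wirtinger (fun w => f w * (f w)^-1) z 0 0.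
  apply: (wirtinger_eq_on oA Az _ (wirtinger_cst 1 z)) => w Aw /=.
  by rewrite divff// f0.
have fz := f0 z Az.
have [e1 e2] := wirtinger_unique P Q.
apply: (wirtinger_eq Hg); apply: (mulfI fz).
  by apply/eqP; rewrite -subr_eq0 -e1 -[X in _ == X]addr0; apply/eqP; field.
by apply/eqP; rewrite -subr_eq0 -e2; apply/eqP; field.
Qed.

Lemma open_disc : open (disc : set C).
Proof.
have -> : (disc : set C) = ball (0 : C) 1.
  by apply/seteqP; split => z; rewrite /disc -ball_normE /= sub0r normrN.
exact: ball_open.
Qed.

Lemma dz_smooth (A : set C) f : open A -> Fsmooth A f -> Fsmooth A (dz f).
Proof.
move=> oA sf n; rewrite /dz; apply: (FnCM oA); first exact: Fn_cst.
apply: (FnB oA); first exact: (Fsmooth_derive (1 : C) sf n).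
by apply: (FnCM oA); [exact: Fn_cst|exact: (Fsmooth_derive iC sf n)].
Qed.

Lemma dz_eq_on (A : set C) f g z : open A -> A z -> (forall w, A w -> f w = g w) ->
  dz f z = dz g z.
Proof.
by move=> oA Az fg; rewrite /dz (derive_eq_on (1 : C) oA Az fg) (derive_eq_on iC oA Az fg).
Qed.

Lemma dzbar_eq_on (A : set C) f g z : open A -> A z -> (forall w, A w -> f w = g w) ->
  dzbar f z = dzbar g z.
Proof.
by move=> oA Az fg; rewrite /dzbar (derive_eq_on (1 : C) oA Az fg) (derive_eq_on iC oA Az fg).
Qed.

Lemma derive_comb (f g : C -> C) (c k v z : C) : differentiable f z -> differentiable g z ->
  'D_v (fun w => c * (f w + k * g w)) z = c * ('D_v f z + k * 'D_v g z).
Proof.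
move=> /wirtinger_diff Hf /wirtinger_diff Hg.
have H := wirtingerM (wirtinger_cst c z) (wirtingerD Hf (wirtingerM (wirtinger_cst k z) Hg)).
by rewrite (wirtinger_derive v H) (wirtinger_derive v Hf) (wirtinger_derive v Hg) /=; ring.
Qed.

Lemma dz_dzbar_comm (A : set C) f z : open A -> A z -> Fsmooth A f ->
  dz (dzbar f) z = dzbar (dz f) z.
Proof.
move=> oA Az sf.
have d1 := Fsmooth_diff (Fsmooth_derive (1 : C) sf) Az.
have di := Fsmooth_diff (Fsmooth_derive (iC : C) sf) Az.
have Dzb v : 'D_v (dzbar f) z = toC 2^-1 * ('D_v ('D_(1 : C) f) z + iC * 'D_v ('D_iC f) z).
  exact: derive_comb.
have Dz v : 'D_v (dz f) z = toC 2^-1 * ('D_v ('D_(1 : C) f) z + (- iC) * 'D_v ('D_iC f) z).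
  rewrite -(derive_comb _ _ _ d1 di); congr ('D_v _ z); apply/funext => w.
  by rewrite /dz mulNr.
rewrite -[LHS]/(toC 2^-1 * ('D_(1 : C) (dzbar f) z - iC * 'D_iC (dzbar f) z)).
rewrite -[RHS]/(toC 2^-1 * ('D_(1 : C) (dz f) z + iC * 'D_iC (dz f) z)).
rewrite !Dzb !Dz (derive_comm (1 : C) iC oA Az sf).
move: ('D_(1 : C) ('D_(1 : C) f) z) ('D_(1 : C) ('D_iC f) z) ('D_iC ('D_iC f) z) => a b c.
by move: (toC 2^-1 : C) (iC : C) => k i; ring.
Qed.

End Wirtinger.

(** * The structure equations of the frame *)

Section FrameEquations.
Context {R : realType}.
Local Notation C := (Rcomplex R).
Variables (s : C -> R) (Q : C -> C) (F : C -> 'M[C]_3).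
Hypothesis hF : legendrian_frame s Q F.
Hypothesis s_gt0 : forall z, disc z -> 0 < s z.

(** The z-derivative of log s. *)
Definition frame_l (z : C) : C := (toC (s z))^-1 * dz (fun w => toC (s w)) z.
Definition frame_q (z : C) : C := Q z * toC (s z) ^- 2.

Lemma herm_cj (u v : 'cV[C]_3) :
  herm u v = u 0 0 * cj (v 0 0) + u 1 0 * cj (v 1 0) - u 2 0 * cj (v 2 0).
Proof. by []. Qed.

Lemma frame_smooth i j : Fsmooth disc (fun z => F z i j).
Proof. by have [sF _ _] := hF; apply: smooth_Fsmooth; [exact: open_disc|exact: sF]. Qed.

Lemma frame_unit z : disc z -> F z \in unitmx.
Proof. by have [_ /(_ z) H _] := hF => /H[_ e]; rewrite unitmxE e unitr1. Qed.

Lemma frame_dz z : disc z -> mx_dz F z = F z *m frameA s Q z.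
Proof. by move=> dz0; have [_ _ /(_ z dz0)[<- _]] := hF; rewrite mulKVmx// frame_unit. Qed.

Lemma frame_dzbar z : disc z -> mx_dzbar F z = F z *m frameB s Q z.
Proof. by move=> dz0; have [_ _ /(_ z dz0)[_ <-]] := hF; rewrite mulKVmx// frame_unit. Qed.

Lemma mulmx3 (M N : 'M[C]_3) i j : (M *m N) i j = M i 0 * N 0 j + M i 1 * N 1 j + M i 2 * N 2 j.
Proof.
rewrite !mxE big_ord_recl big_ord_recl big_ord1 addrA.
by congr (_ * _ + _ * _ + _ * _); congr (_ _ _); apply/val_inj.
Qed.

Lemma dzbar_real (r : C -> R) z : differentiable (fun w => toC (r w)) z ->
  dzbar (fun w => toC (r w)) z = cj (dz (fun w => toC (r w)) z).
Proof.
move=> /wirtinger_diff H; have H' := wirtinger_cj H.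
have {}H' : wirtinger (fun w => toC (r w)) z _ _ := wirtinger_ext (fun w => cj_toC (r w)) H'.
by have [_ ->] := wirtinger_unique H H'.
Qed.

(** F z preserves the form, so the entries of F^-1 dF are hermitian products of columns of dF and F.
    The sign comes from the third basis vector, of norm -1. This recovers s and q from F. *)
Lemma frame_herm_col (M : 'M[C]_3) i j z : disc z ->
  herm (col i (F z *m M)) (col j (F z)) = (if j == 2 then - M j i else M j i).
Proof.
move=> dz0; have [_ /(_ z dz0)[hh _] _] := hF.
have -> : col j (F z) = F z *m delta_mx j 0 by rewrite colE.
rewrite colE -mulmxA hh herm_cj -colE !mxE.
have [->|[->|->]] : j = 0 \/ j = 1 \/ j = 2.
  by case: j => [[|[|[|//]]] ?]; [left|right; left|right; right]; apply/val_inj.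
all: by rewrite ?eqxx /= ?cj1 ?cj0; ring.
Qed.

(** Smoothness is inherited from F, because s = <d f_3/dz, f_1>. Likewise q = - <d f_1/dz, f_2> in
    [q_smooth]. *)
Lemma s_smooth : Fsmooth disc (fun z => toC (s z)).
Proof.
move=> n; apply: (Fn_ext (f := fun z => herm (col 2 (mx_dz F z)) (col 0 (F z))) open_disc).
  by move=> z dz0; rewrite frame_dz// frame_herm_col//= !mxE.
have H i j := @frame_smooth i j.
have D i j := dz_smooth open_disc (H i j).
have -> : (fun z => herm (col 2 (mx_dz F z)) (col 0 (F z))) =
  (fun z => dz (fun w => F w 0 2) z * cj (F z 0 0) + dz (fun w => F w 1 2) z * cj (F z 1 0)
    - dz (fun w => F w 2 2) z * cj (F z 2 0)).
  by apply/funext => z; rewrite herm_cj !mxE.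
have P (f g : C -> C) : Fsmooth disc f -> Fsmooth disc g -> Fn n disc (fun z => f z * cj (g z)).
  by move=> Hf Hg; apply: (FnCM open_disc); [exact: Hf|exact: (Fn_cj open_disc)].
by apply: (FnB open_disc); [apply: (FnD open_disc)|]; apply: P => //; exact: D.
Qed.

Lemma q_smooth : Fsmooth disc frame_q.
Proof.
move=> n; apply: (Fn_ext (f := fun z => - herm (col 0 (mx_dz F z)) (col 1 (F z))) open_disc).
  move=> z dz0; rewrite frame_dz// frame_herm_col//= !mxE /=.
  by rewrite /frame_q mulNr opprK.
have H i j := @frame_smooth i j.
have D i j := dz_smooth open_disc (H i j).
have -> : (fun z => - herm (col 0 (mx_dz F z)) (col 1 (F z))) =
  (fun z => - (dz (fun w => F w 0 0) z * cj (F z 0 1) + dz (fun w => F w 1 0) z * cj (F z 1 1)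
    - dz (fun w => F w 2 0) z * cj (F z 2 1))).
  by apply/funext => z; rewrite herm_cj !mxE.
have P (f g : C -> C) : Fsmooth disc f -> Fsmooth disc g -> Fn n disc (fun z => f z * cj (g z)).
  by move=> Hf Hg; apply: (FnCM open_disc); [exact: Hf|exact: (Fn_cj open_disc)].
by apply: (FnN open_disc); apply: (FnB open_disc); [apply: (FnD open_disc)|]; apply: P => //; exact: D.
Qed.

Lemma sC_neq0 z : disc z -> toC (s z) != 0 :> C.
Proof. by move=> /s_gt0 s0; rewrite toC_eq0 gt_eqF. Qed.

Lemma l_smooth : Fsmooth disc frame_l.
Proof.
move=> n; apply: (FnCM open_disc); last exact: (dz_smooth open_disc s_smooth).
by apply: (FnCV open_disc) => [z|]; [exact: sC_neq0|exact: s_smooth].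
Qed.

Lemma cj_frame_l z : cj (frame_l z) = (toC (s z))^-1 * cj (dz (fun w => toC (s w)) z).
Proof. by rewrite /frame_l (cjM (toC (s z))^-1) cjV cj_toC. Qed.

Lemma wirtinger_s z : disc z ->
  wirtinger (fun w => toC (s w)) z (toC (s z) * frame_l z) (toC (s z) * cj (frame_l z)).
Proof.
move=> dz0; have ds := Fsmooth_diff s_smooth dz0.
apply: (wirtinger_eq (wirtinger_diff ds)).
  by rewrite mulrA divff ?sC_neq0// mul1r.
by rewrite dzbar_real// cj_frame_l mulrA divff ?sC_neq0// mul1r.
Qed.

Lemma wirtinger_f1 z i : disc z -> wirtinger (fun w => F w i 0) z
  (frame_l z * F z i 0 - frame_q z * F z i 1)
  (- cj (frame_l z) * F z i 0 + toC (s z) * F z i 2).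
Proof.
move=> dz0; apply: (wirtinger_eq (wirtinger_diff (Fsmooth_diff (@frame_smooth i 0) dz0))).
  have := congr1 (fun M : 'M[C]_3 => M i 0) (frame_dz dz0); rewrite mulmx3 !mxE /= => ->.
  by rewrite /frame_q /frame_l; ring.
have := congr1 (fun M : 'M[C]_3 => M i 0) (frame_dzbar dz0); rewrite mulmx3 !mxE /= => ->.
by rewrite (dzbar_real (Fsmooth_diff s_smooth dz0)) cj_frame_l; ring.
Qed.

Lemma wirtinger_f2 z i : disc z -> wirtinger (fun w => F w i 1) z
  (- frame_l z * F z i 1 + toC (s z) * F z i 2)
  (cj (frame_q z) * F z i 0 + cj (frame_l z) * F z i 1).
Proof.
move=> dz0; apply: (wirtinger_eq (wirtinger_diff (Fsmooth_diff (@frame_smooth i 1) dz0))).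
  have := congr1 (fun M : 'M[C]_3 => M i 1) (frame_dz dz0); rewrite mulmx3 !mxE /= => ->.
  by rewrite /frame_l; ring.
have := congr1 (fun M : 'M[C]_3 => M i 1) (frame_dzbar dz0); rewrite mulmx3 !mxE /= => ->.
by rewrite (dzbar_real (Fsmooth_diff s_smooth dz0)) cj_frame_l /frame_q cjM cjV cjX cj_toC -/(cj _); ring.
Qed.

Lemma wirtinger_f3 z i : disc z -> wirtinger (fun w => F w i 2) z
  (toC (s z) * F z i 0) (toC (s z) * F z i 1).
Proof.
move=> dz0; apply: (wirtinger_eq (wirtinger_diff (Fsmooth_diff (@frame_smooth i 2) dz0))).
  have := congr1 (fun M : 'M[C]_3 => M i 2) (frame_dz dz0); rewrite mulmx3 !mxE /= => ->.
  by ring.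
have := congr1 (fun M : 'M[C]_3 => M i 2) (frame_dzbar dz0); rewrite mulmx3 !mxE /= => ->.
by ring.
Qed.

(* The f_1-component of d^2 f_1 = 0. *)
Lemma frame_integrability z : disc z ->
  toC (2 * reC (dzbar frame_l z)) = toC (nC (frame_q z) ^+ 2 + s z ^+ 2).
Proof.
move=> dz0.
pose lz := dz frame_l z; pose lb := dzbar frame_l z; pose qb := dzbar frame_q z.
have Wl : wirtinger frame_l z lz lb := wirtinger_diff (Fsmooth_diff l_smooth dz0).
have Wq := wirtinger_diff (Fsmooth_diff q_smooth dz0); rewrite -/qb in Wq.
set qz := dz frame_q z in Wq.
(* The coordinates, in the frame, of the difference of the two mixed derivatives of f_1. F is
   invertible, so all of them vanish; the first one is the claim. *)
pose v : 'cV[C]_3 := \col_k nth 0 [:: lb + cj lb - frame_q z * cj (frame_q z) - toC (s z) * toC (s z);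
  - qb - 2 * frame_q z * cj (frame_l z); 0] k.
suff v0 : v = 0.
  have := congr1 (fun M : 'cV[C]_3 => M 0 0) v0; rewrite !mxE /= addcj mulcj -expr2 -toCX -toCB -toCB.
  by move/eqP; rewrite toC_eq0 -addrA -opprD subr_eq0 => /eqP ->.
suff : F z *m v = 0 by move=> /(congr1 (mulmx (invmx (F z)))); rewrite mulKmx ?frame_unit// mulmx0.
apply/matrixP => i j; rewrite !mxE big_ord_recl big_ord_recl big_ord1 !mxE /= mulr0 addr0.
have A1 : dzbar (dz (fun w => F w i 0)) z = dzbar (fun w => frame_l w * F w i 0 - frame_q w * F w i 1) z.
  apply: (dzbar_eq_on open_disc dz0) => w dw; by have [->] := wirtinger_dz (wirtinger_f1 i dw).
have A2 : dz (dzbar (fun w => F w i 0)) z = dz (fun w => - cj (frame_l w) * F w i 0 + toC (s w) * F w i 2) z.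
  apply: (dz_eq_on open_disc dz0) => w dw; by have [_ ->] := wirtinger_dz (wirtinger_f1 i dw).
have := dz_dzbar_comm open_disc dz0 (@frame_smooth i 0).
rewrite A1 A2.
have [_ ->] := wirtinger_dz (wirtingerD (wirtingerM Wl (wirtinger_f1 i dz0))
   (wirtingerN (wirtingerM Wq (wirtinger_f2 i dz0)))).
have [-> _] := wirtinger_dz (wirtingerD (wirtingerM (wirtingerN (wirtinger_cj Wl)) (wirtinger_f1 i dz0))
   (wirtingerM (wirtinger_s dz0) (wirtinger_f3 i dz0))).
rewrite (_ : lift ord0 ord0 = 1); last exact/val_inj.
move/eqP; rewrite -subr_eq0 => /eqP E; rewrite -[RHS]oppr0 -E; ring.
Qed.

End FrameEquations.

(** * Gradient estimate on a square *)

Section GradientEstimate.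
Context {R : realType}.

Lemma is_derive_translate (g : R -> R) (a t l : R) : is_derive (t + a) 1 g l ->
  is_derive t 1 (fun t => g (t + a)) l.
Proof.
move=> H; have e : (fun h : R => h^-1 *: (((fun t => g (t + a)) \o shift t) (h *: (1:R)) - g (t + a)))
   = (fun h : R => h^-1 *: ((g \o shift (t + a)) (h *: (1 : R)) - g (t + a))).
  by apply/funext => h /=; rewrite addrA.
by case: H => d <-; apply: DeriveDef; rewrite /derivable /derive e.
Qed.

Lemma second_derive_at_local_min (g dg : R -> R) (a r l : R) : 0 < r ->
  (forall t : R, `|t - a| < r -> is_derive t 1 g (dg t)) -> is_derive a 1 dg l ->
  (forall t : R, `|t - a| < r -> g a <= g t) -> 0 <= l.
Proof.
move=> r0 H1 H2 H3.
apply: (@second_derive_at_min R (fun t => g (t + a)) (fun t => dg (t + a)) r l r0).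
- by move=> t tr; apply/is_derive_translate/H1; rewrite addrK.
- by apply: is_derive_translate; rewrite add0r.
- by move=> t tr; rewrite add0r; apply: H3; rewrite addrK.
Qed.

Lemma derive_ge0_right (g : R -> R) (r l : R) : 0 < r -> is_derive (0 : R) 1 g l ->
  (forall t : R, 0 <= t < r -> g 0 <= g t) -> 0 <= l.
Proof.
move=> r0 Hg gmin; rewrite leNgt; apply/negP => l0.
have l20 : 0 < - l / 2 by rewrite divr_gt0// oppr_gt0.
have := is_derive_eps Hg l20.
move=> /nbhs_ballP[d /= d0 Hd].
pose h := Num.min d r / 2.
have m0 : 0 < Num.min d r by rewrite lt_min d0.
have h0 : 0 < h by rewrite divr_gt0.
have hm : h < Num.min d r by rewrite ltr_pdivrMr// ltr_pMr// ltr1n.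
have [hd hr] : h < d /\ h < r.
  by split; apply: lt_le_trans hm _; rewrite ge_min lexx ?orbT.
have /Hd : ball (0 : R) d h by rewrite /ball /= sub0r normrN gtr0_norm.
rewrite /= addr0 (gtr0_norm h0) => /ler_normlP[_].
have := gmin h; rewrite hr ltW// => /(_ isT).
rewrite -[h *: l]/(h * l); have : l * h < 0 by rewrite nmulr_rlt0.
nra.
Qed.

Variables (d M N : R) (V Vx Vy Vxx Vyy : R -> R -> R).
Hypothesis d0 : 0 < d.
Let sq (x y : R) := `|x| <= d /\ `|y| <= d.
Hypothesis HVx : forall x y : R, sq x y -> is_derive x 1 (V ^~ y) (Vx x y).
Hypothesis HVy : forall x y : R, sq x y -> is_derive y 1 (V x) (Vy x y).
Hypothesis HVxx : forall x y : R, sq x y -> is_derive x 1 (Vx ^~ y) (Vxx x y).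
Hypothesis HVyy : forall x y : R, sq x y -> is_derive y 1 (Vy x) (Vyy x y).
Hypothesis Vc : forall p : R * R, sq p.1 p.2 -> {for p, continuous (fun p => V p.1 p.2)}.
Hypothesis VM : forall x y : R, sq x y -> `|V x y| <= M.
Hypothesis VN : forall x y : R, sq x y -> `|Vxx x y + Vyy x y| < N.

(* The barrier B dominates the odd part of V in y on the boundary of the upper
   half square and its Laplacian is -N, so W has no interior minimum; comparing
   the slopes at y = 0, where W vanishes, bounds V_y(0,0). *)
Let B (x y : R) := M / d ^+ 2 * (x ^+ 2 + y * (2 * d - y)) + N / 2 * (y * (d - y)).
Let W (x y : R) := B x y - (V x y - V x (- y)) / 2.

Let sq00 : sq 0 0. Proof. by rewrite /sq normr0 ltW. Qed.
Let M0 : 0 <= M. Proof. exact: le_trans (VM sq00). Qed.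
Let N0 : 0 < N. Proof. exact: le_lt_trans (VN sq00). Qed.
Let Md0 : 0 <= M / d ^+ 2. Proof. by rewrite divr_ge0// sqr_ge0. Qed.
Let sqN x y : sq x y -> sq x (- y). Proof. by rewrite /sq normrN. Qed.

(** The odd part of V is at most M. On the lateral sides x^2 = d^2 and on the top y(2d - y) = d^2,
    so the first term of B is at least M there; on y = 0 the odd part vanishes. *)
Let W_boundary x y : `|x| <= d -> 0 <= y <= d -> `|x| = d \/ y = 0 \/ y = d -> 0 <= W x y.
Proof.
move=> xd /andP[y0 yd] bd.
have sxy : sq x y by rewrite /sq (ger0_norm y0).
have [b1 b2] : (V x y <= M /\ - M <= V x y) /\ (V x (- y) <= M /\ - M <= V x (- y)).
  by have /ler_normlP[? ?] := VM sxy; have /ler_normlP[? ?] := VM (sqN sxy); split; split; lra.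
have x2 : x ^+ 2 = `|x| ^+ 2 by rewrite real_normK ?num_real.
have Md : M / d ^+ 2 * d ^+ 2 = M by rewrite divfK// expf_neq0// gt_eqF.
have k2 : 0 <= N / 2 * (y * (d - y)) by rewrite !mulr_ge0 ?subr_ge0// ltW.
have k1 : y = 0 \/ M <= M / d ^+ 2 * (x ^+ 2 + y * (2 * d - y)).
  case: bd => [xe|[->|->]]; [right|by left|right]; rewrite -{1}Md ler_wpM2l//.
    by rewrite x2 xe lerDl mulr_ge0//; lra.
  by rewrite -[leLHS]add0r lerD ?sqr_ge0//; nra.
case: k1 => [ye|k1]; last by rewrite /W /B; lra.
by rewrite /W /B ye oppr0 subrr mul0r !mul0r !mulr0 !addr0 subr0 mulr_ge0// sqr_ge0.
Qed.

Let W_ge0 x y : `|x| <= d -> 0 <= y <= d -> 0 <= W x y.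
Proof.
move=> xd yd.
pose K : set (R * R) := `[- d, d]%classic `*` `[0, d]%classic.
have KP p : K p <-> `|p.1| <= d /\ 0 <= p.2 <= d.
  by rewrite /K /= !in_itv /= ler_norml.
have cK : compact K by apply: compact_setX; exact: segment_compact.
have K0 : K !=set0 by exists (x, y); apply/KP.
have cW : {within K, continuous (fun p => W p.1 p.2)}.
  apply: continuous_in_subspaceT => p; rewrite inE => /KP[p1 /andP[p20 p2d]].
  have sp : sq p.1 p.2 by rewrite /sq (ger0_norm p20).
  have c1 : p.1 @[p --> p] --> p.1 by exact: cvg_fst.
  have c2 : p.2 @[p --> p] --> p.2 by exact: cvg_snd.
  have cN : (p.1, - p.2) @[p --> p] --> (p.1, - p.2).
    exact: (cvg_pair c1 (cvgN c2)).
  rewrite /prop_for /continuous_at /W /B.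
  apply: cvgB.
    apply: cvgD; apply: cvgM; try exact: cvg_cst.
      apply: cvgD; first by rewrite expr2; under eq_fun do rewrite expr2; exact: cvgM.
      by apply: cvgM => //; apply: cvgB => //; exact: cvg_cst.
    by apply: cvgM => //; apply: cvgB => //; exact: cvg_cst.
  apply: cvgM; last exact: cvg_cst.
  apply: cvgB; first exact: Vc.
  apply: (@continuous_cvg _ _ _ _ _ (fun p => (p.1, - p.2)) (fun p => V p.1 p.2) (p.1, - p.2)) => //.
  by apply: Vc; exact: sqN.
have [[x0 y0]] := compact_EVT_min K0 cK cW.
rewrite inE => /KP[/= x0d y0d] mn.
have {}mn (x' y' : R) : `|x'| <= d -> 0 <= y' <= d -> W x0 y0 <= W x' y'.
  by move=> h1 h2; apply: (mn (x', y')); rewrite inE; apply/KP.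
suff : 0 <= W x0 y0 by move=> /le_trans; apply; exact: mn.
rewrite leNgt; apply/negP => Wlt.
have [x0d' [y00 y0d']] : `|x0| < d /\ 0 < y0 /\ y0 < d.
  have /andP[y1 y2] := y0d; rewrite !lt_neqAle x0d y1 y2 !andbT.
  split; [|split]; apply/eqP => e; have := W_boundary x0d y0d; rewrite leNgt Wlt.
  - by move=> /(_ (or_introl e)).
  - by move=> /(_ (or_intror (or_introl (esym e)))).
  - by move=> /(_ (or_intror (or_intror e))).
have sq0 : sq x0 y0 by rewrite /sq ltW// gtr0_norm// ltW.
(* At an interior minimum of W both pure second derivatives are nonnegative. Their sum is -N minus
   half the difference of two Laplacians of V, each of modulus less than N, hence negative: a
   contradiction. *)
have l1 : 0 <= M / d ^+ 2 * 2 - (Vxx x0 y0 - Vxx x0 (- y0)) / 2.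
  pose dg (x : R) := M / d ^+ 2 * (2 * x) - (Vx x y0 - Vx x (- y0)) / 2.
  have H1 (t : R) : `|t - x0| < d - `|x0| -> is_derive t 1 (W ^~ y0) (dg t).
    move=> td; have st : sq t y0.
      split; last exact: sq0.2.
      have := ler_normD (t - x0) x0; rewrite subrK; lra.
    have D1 := HVx st; have D2 := HVx (sqN st).
    rewrite /W /B; apply: is_derive_eq.
    by rewrite /dg /GRing.scale /=; ring.
  have H2 : is_derive x0 1 dg (M / d ^+ 2 * 2 - (Vxx x0 y0 - Vxx x0 (- y0)) / 2).
    have D1 := HVxx sq0; have D2 := HVxx (sqN sq0).
    by rewrite /dg; apply: is_derive_eq; rewrite /GRing.scale /=; ring.
  have H3 (t : R) : `|t - x0| < d - `|x0| -> W x0 y0 <= W t y0.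
    move=> td; apply: mn => //; have := ler_normD (t - x0) x0; rewrite subrK; lra.
  have r0 : 0 < d - `|x0| by rewrite subr_gt0.
  exact: (second_derive_at_local_min r0 H1 H2 H3).
have l2 : 0 <= - (M / d ^+ 2) * 2 - N - (Vyy x0 y0 - Vyy x0 (- y0)) / 2.
  have r0 : 0 < Num.min y0 (d - y0) by rewrite lt_min y00 subr_gt0.
  have near_y0 (t : R) : `|t - y0| < Num.min y0 (d - y0) -> 0 <= t <= d.
    rewrite lt_min => /andP[/ltr_normlP[h1 h2] /ltr_normlP[h3 h4]]; apply/andP; split; lra.
  pose dg (y : R) := M / d ^+ 2 * (2 * d - 2 * y) + N / 2 * (d - 2 * y) - (Vy x0 y + Vy x0 (- y)) / 2.
  have H1 (t : R) : `|t - y0| < Num.min y0 (d - y0) -> is_derive t 1 (W x0) (dg t).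
    move=> /near_y0 /andP[t0 td]; have st : sq x0 t by split; [exact: sq0.1|rewrite ger0_norm].
    have D1 := HVy st; have D2 := HVy (sqN st).
    have D3 : is_derive t 1 (fun y => V x0 (- y)) (Vy x0 (- t) * -1) by exact: (is_derive1_comp (g := -%R)).
    rewrite /W /B; apply: is_derive_eq.
    by rewrite /dg /GRing.scale /=; ring.
  have H2 : is_derive y0 1 dg (- (M / d ^+ 2) * 2 - N - (Vyy x0 y0 - Vyy x0 (- y0)) / 2).
    have D1 := HVyy sq0; have D2 := HVyy (sqN sq0).
    have D3 : is_derive y0 1 (fun y => Vy x0 (- y)) (Vyy x0 (- y0) * -1) by exact: (is_derive1_comp (g := -%R)).
    rewrite /dg; apply: is_derive_eq; rewrite /GRing.scale /=. by field; rewrite gt_eqF.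
  have H3 (t : R) : `|t - y0| < Num.min y0 (d - y0) -> W x0 y0 <= W x0 t.
    by move=> /near_y0 ht; exact: mn.
  exact: (second_derive_at_local_min r0 H1 H2 H3).
have /ltr_normlP[n1 _] := VN sq0; have /ltr_normlP[_ n2] := VN (sqN sq0).
by move: l1 l2 n1 n2; set m := M / d ^+ 2; lra.
Qed.

(** On the axis x = 0 the function k below is W plus the nonnegative quadratic terms dropped from B.
    It vanishes at y = 0 and is nonnegative to the right, so its slope at 0 is nonnegative. *)
Lemma gradient_bound_square : Vy 0 0 <= 2 * M / d + d * N / 2.
Proof.
rewrite -subr_ge0.
pose k (y : R) := y * (2 * M / d + d * N / 2) - (V 0 y - V 0 (- y)) / 2.
have H1 : is_derive (0 : R) 1 k (2 * M / d + d * N / 2 - Vy 0 0).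
  have D1 := HVy sq00; have D2 : is_derive (0 : R) 1 (fun y => V 0 (- y)) (Vy 0 0 * -1).
    by apply: (is_derive1_comp (g := -%R)); rewrite oppr0.
  by rewrite /k; apply: is_derive_eq; rewrite /GRing.scale /=; field; rewrite gt_eqF.
apply: (derive_ge0_right d0 H1); rewrite /k.
move=> y /andP[y0 yd]; rewrite oppr0 subrr mul0r mul0r subr0.
have d0' : `|0 : R| <= d by rewrite normr0 ltW.
have y0' : 0 <= y <= d by rewrite y0 ltW.
have := W_ge0 d0' y0'; rewrite /W /B.
have -> : M / d ^+ 2 * (0 ^+ 2 + y * (2 * d - y)) = y * (2 * M / d) - M / d ^+ 2 * y ^+ 2.
  by rewrite [0 ^+ 2]mul0r; field; rewrite gt_eqF.
have : 0 <= M / d ^+ 2 * y ^+ 2 by rewrite mulr_ge0// sqr_ge0.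
have : 0 <= N * y ^+ 2 by rewrite mulr_ge0 ?sqr_ge0 ?ltW.
move: (M / d ^+ 2 * y ^+ 2) (2 * M / d) => m a; lra.
Qed.

End GradientEstimate.

Lemma is_derive_comp_diff (R : realType) (E F : normedModType R) (f : E -> F) (L : E -> F)
    (c : R -> E) (t : R) (tau : E) :
  is_diff (c t) f L -> is_derive t 1 c tau -> is_derive t 1 (fun t => f (c t)) (L tau).
Proof.
move=> Hf [dc <-].
have Dc : differentiable c t by exact/derivable1_diffP.
have [df e] := is_diff_comp (differentiableP Dc) Hf.
apply: DeriveDef; first exact/derivable1_diffP.
by rewrite [LHS](deriveE (1 : R) df) e /= -deriveE.
Qed.

Lemma Fn_id (R : realType) (E : normedModType R) n (A : set E) : Fn n A (id : E -> E).
Proof.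
case: n => [|n] /=; first by move=> x _; exact: cvg_id.
split=> [x _|v]; first by have [] := @is_diff_id _ _ x.
have -> : 'D_v (id : E -> E) = cst v by apply/funext => x; exact: derive_id.
exact: Fn_cst.
Qed.

(** * The gradient of the conformal factor *)

Section GradientOfConformalFactor.
Context {R : realType}.
Local Notation C := (Rcomplex R).
Variables (s : C -> R) (Q : C -> C) (F : C -> 'M[C]_3).
Hypothesis hF : legendrian_frame s Q F.
Hypothesis s_gt0 : forall z, disc z -> 0 < s z.

(* [conformal_ratio] is e^u, read off from e^u h = 2 s^2 |dz|^2, and [frame_G]
   is du/dz. *)
Definition conformal_ratio (z : C) : R := s z ^+ 2 * (1 - nC z ^+ 2) ^+ 2 / 2.
(** The z-derivative of log(4 / (1 - |z|^2)^2), that is, the Christoffel symbol of the Poincare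
    metric. *)
Definition hyp_gamma (z : C) : C := toC (2 / (1 - nC z ^+ 2)) * cj z.
Definition frame_G (z : C) : C := 2 * frame_l s z - hyp_gamma z.

Local Notation E := conformal_ratio.
Local Notation G := frame_G.
Implicit Types z w : C.

Lemma disc_nC z : disc z -> nC z < 1. Proof. by []. Qed.

Lemma disc_1N z : disc z -> 0 < 1 - nC z ^+ 2.
Proof. by move=> /disc_nC z1; rewrite subr_gt0 expr_lt1// nC_ge0. Qed.

Lemma conformal_ratio_gt0 z : disc z -> 0 < E z.
Proof.
move=> zd; apply: divr_gt0 => //; apply: mulr_gt0; apply: exprn_gt0; first exact: s_gt0.
exact: disc_1N.
Qed.

Lemma wirtinger_1N z : wirtinger (fun w => toC (1 - nC w ^+ 2)) z (- cj z) (- z).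
Proof.
have W := wirtingerD (wirtinger_cst 1 z)
  (wirtingerN (wirtingerM (wirtinger_id z) (wirtinger_cj (wirtinger_id z)))).
have {}W := wirtinger_ext (g := fun w => toC (1 - nC w ^+ 2)) _ W.
apply: (wirtinger_eq (W _)); last 2 first.
- by rewrite cj0 /=; ring.
- by rewrite cj1 /=; ring.
by move=> w /=; rewrite toCB toC1 mulcj.
Qed.

Lemma is_diff_ratio z : disc z ->
  is_diff z E (fun h => 2 * reC (toC (E z) * G z * h)).
Proof.
move=> zd.
have W0 := wirtingerM (wirtingerM (wirtinger_s hF s_gt0 zd) (wirtinger_s hF s_gt0 zd))
  (wirtingerM (wirtingerM (wirtinger_1N z) (wirtinger_1N z)) (wirtinger_cst (toC (2^-1)) z)).
have toCE w : toC (E w) = toC (s w) * toC (s w) * (toC (1 - nC w ^+ 2) * toC (1 - nC w ^+ 2) * toC 2^-1).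
  by rewrite /E -!toCM; congr toC; ring.
have K2 : toC (1 - nC z ^+ 2) * toC (2 / (1 - nC z ^+ 2)) * toC 2^-1 = 1 :> C.
  by rewrite -!toCM -toC1; congr toC; field; rewrite gt_eqF// disc_1N.
have H2 : 2 * toC 2^-1 = 1 :> C by rewrite -(toC_nat 2) -toCM -toC1; congr toC; field.
have A : toC (s z) * frame_l s z * toC (s z) * (toC (1 - nC z ^+ 2) * toC (1 - nC z ^+ 2) * toC 2^-1)
   + toC (s z) * (toC (s z) * frame_l s z) * (toC (1 - nC z ^+ 2) * toC (1 - nC z ^+ 2) * toC 2^-1)
   + toC (s z) * toC (s z) * ((- cj z * toC (1 - nC z ^+ 2) + toC (1 - nC z ^+ 2) * - cj z) * toC 2^-1)
   = toC (E z) * G z.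
  rewrite toCE /G /hyp_gamma.
  move: (toC (1 - nC z ^+ 2)) (toC (2 / (1 - nC z ^+ 2))) (toC 2^-1 : C) K2 H2 (toC (s z)) (frame_l s z) (cj z).
  move=> N K H K2 H2 S l zb.
  have -> : S * S * (N * N * H) * (2 * l - K * zb) = 2 * (S * S * (N * N * H) * l) - S * S * N * (N * K * H) * zb by ring.
  rewrite K2 -[X in _ - X * zb]mulr1; have -> : S * S * N * 1 = S * S * N * (2 * H) by rewrite H2.
  ring.
have W1 : wirtinger (fun w => toC (E w)) z (toC (E z) * G z) (cj (toC (E z) * G z)).
  apply: (wirtinger_eq (wirtinger_ext (fun w => esym (toCE w)) W0)).
    by rewrite -A /=; ring.
  rewrite -A /=; move: (frame_l s z) => l.
  by rewrite !(cjD, cjM, cjN, cj_toC, cjK); ring.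
have D := is_diff_lin reC_continuous W1.
apply: is_diff_ext D => // h; rewrite -[(_ : {linear C -> R}) _]/(reC _).
by move: (toC (E z) * G z) => k; rewrite !reimE; ring.
Qed.

Definition conformal_log (z : C) : R := ln (E z).
Local Notation v := conformal_log.

Lemma is_diff_log z : disc z -> is_diff z v (fun h => 2 * reC (G z * h)).
Proof.
move=> zd; have D := is_diff_ratio zd; have E0 := conformal_ratio_gt0 zd.
have [Dl el] := is_derive1_ln E0.
have Hl : is_diff (E z) (@ln R) (fun h => h * (E z)^-1).
  have dl : differentiable (@ln R) (E z) by exact/derivable1_diffP.
  have H := differentiableP dl.
  apply: is_diff_ext H => // h; rewrite -[h in LHS]mulr1 -[h * 1]/(h *: (1 : R)) linearZ.
  by rewrite -deriveE// el.
have H := is_diff_comp D Hl.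
apply: is_diff_ext H => // h /=.
have -> : toC (E z) * G z * h = toC (E z) * (G z * h) by rewrite mulrA.
rewrite (reCM (toC _)) reC_toC imC_toC.
by field; rewrite gt_eqF.
Qed.

Lemma wirtinger_hyp_gamma z : disc z -> exists a,
  wirtinger hyp_gamma z a (toC (2 / (1 - nC z ^+ 2) ^+ 2)).
Proof.
move=> zd; pose f w : C := toC (1 - nC w ^+ 2).
have f0 w : disc w -> f w != 0 by move=> /disc_1N h; rewrite toC_eq0 gt_eqF.
have sf : Fsmooth disc f.
  move=> n; apply: (Fn_toC open_disc); apply: (FnB open_disc); first exact: Fn_cst.
  apply: (Fn_nC2 open_disc (p := id)); exact: Fn_id.
have W := wirtingerM (wirtingerM (wirtinger_cst (toC 2) z)
  (wirtingerV open_disc zd f0 sf (wirtinger_1N z))) (wirtinger_cj (wirtinger_id z)).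
have e w : toC 2 * (f w)^-1 * cj w = hyp_gamma w by rewrite /hyp_gamma toCM toCV.
eexists; apply: (wirtinger_eq (wirtinger_ext e W)); first by [].
rewrite -[(f z ^+ 2)^-1]exprVn.
have -> : (f z)^-1 = toC (1 - nC z ^+ 2)^-1 by rewrite toCV.
set K : C := toC (1 - nC z ^+ 2)^-1.
rewrite cj1 /=.
have -> : (0 * K + toC 2 * (- - z * K ^+ 2)) * cj z + toC 2 * K * 1 = toC 2 * (K ^+ 2 * (z * cj z) + K) by ring.
rewrite mulcj /K -toCX -toCM -toCD -toCM; congr toC.
by field; rewrite gt_eqF// disc_1N.
Qed.

(** Since G = u_z, the real quantity 4 Re G_zbar is the flat Laplacian of u. This is the equation
    for u, read off from the integrability of the frame. *)
Lemma wirtinger_G z : disc z -> exists a b,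
  wirtinger G z a b /\
  4 * reC b = 4 * (nC (frame_q s Q z) ^+ 2 + s z ^+ 2) - 8 / (1 - nC z ^+ 2) ^+ 2.
Proof.
move=> zd; have [a Wg] := wirtinger_hyp_gamma zd.
have Wl := wirtinger_diff (Fsmooth_diff (l_smooth hF s_gt0) zd).
have W := wirtingerD (wirtingerM (wirtinger_cst 2 z) Wl) (wirtingerN Wg).
have := frame_integrability hF s_gt0 zd => /toC_inj I.
eexists; eexists; split; first exact: W.
move: (dzbar (frame_l s) z) I => lb I; rewrite mul0r add0r /= -(toC_nat 2) !reimE mul0r subr0 -I.
by field; rewrite gt_eqF// disc_1N.
Qed.

Hypothesis E_bounds : forall z, disc z -> 499 / 500 <= E z <= 1.
Hypothesis q_bound : forall z, disc z -> nC (frame_q s Q z) ^+ 2 <= s z ^+ 2 / 1000.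

Lemma log_bound z : disc z -> `|v z| <= 1 / 400.
Proof.
move=> /[dup] zd /E_bounds/andP[E1 E2]; have E0 := conformal_ratio_gt0 zd.
rewrite ler_norml; apply/andP; split; last first.
  have h : v z <= 0 by exact: ln_le0.
  by apply: (le_trans h); apply: divr_ge0; [exact: ler01|exact: ler0n].
rewrite lerNl /v -lnV ?posrE//.
(* From E >= 499/500 one gets 1/E - 1 <= 1/499. *)
apply: le_trans (_ : (E z)^-1 - 1 <= _).
  by have := @le_ln1Dx R ((E z)^-1 - 1); rewrite [1 + _]addrC subrK; apply; rewrite ltrBrDl subrr invr_gt0.
by rewrite lerBlDr -div1r ler_pdivrMr//; lra.
Qed.

(** With g the Poincare density, s^2 = E g / 2 and the Laplacian equals 4|q|^2 - 2(1 - E) g. The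
    first term is at most g/500, the second between -g/250 and 0, and 1/250 < 7/1600. Finally g <=
    16 / r^2, because 1 - |z|^2 >= 1 - |z| >= r/2. *)
Lemma laplacian_bound z r : disc z -> 0 < r -> r / 2 <= 1 - nC z -> forall a b, wirtinger G z a b ->
  `|4 * reC b| < (7 / 100) / r ^+ 2.
Proof.
move=> zd r0 rz a b W; have [a' [b' [W' e]]] := wirtinger_G zd.
have [_ ->] := wirtinger_unique W W'; rewrite e.
have /andP[E1 E2] := E_bounds zd; have q0 := q_bound zd.
have n0 := disc_1N zd.
have z1 := disc_nC zd.
pose g := 4 / (1 - nC z ^+ 2) ^+ 2.
have es : s z ^+ 2 = E z * g / 2.
  by rewrite /E /g; field; rewrite gt_eqF.
have -> : 8 / (1 - nC z ^+ 2) ^+ 2 = 2 * g by rewrite /g; field; rewrite gt_eqF.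
have g0 : 0 < g by rewrite /g divr_gt0// exprn_gt0.
have gr : g <= 16 / r ^+ 2.
  rewrite /g ler_pdivrMr ?exprn_gt0// mulrAC ler_pdivlMr ?exprn_gt0//.
  have : r ^+ 2 <= (2 * (1 - nC z ^+ 2)) ^+ 2; last by rewrite exprMn; lra.
  have h : r <= 2 * (1 - nC z ^+ 2) by have := nC_ge0 z; nra.
  by apply: lerXn2r; rewrite ?nnegrE ?(ltW r0) ?(le_trans (ltW r0) h).
have q1 : 0 <= nC (frame_q s Q z) ^+ 2 by exact: sqr_ge0.
have k : 7 / 100 / r ^+ 2 = 7 / 1600 * (16 / r ^+ 2) by field; rewrite gt_eqF.
rewrite k; rewrite es in q0 *; move: (nC (frame_q s Q z) ^+ 2) (16 / r ^+ 2) g0 gr q0 q1 E1 E2 => n m g0 gm q0 q1 E1 E2.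
have E3 : E z * g <= g by rewrite ler_piMl// ltW.
have E4 : 499 / 500 * g <= E z * g by rewrite ler_wpM2r// ltW.
by apply/ltr_normlP; split; lra.
Qed.

Let pos (z e1 e2 : C) (x y : R) : C := toC x * e1 + (toC y * e2 + z).

Lemma is_derive_affine (a b : C) (t : R) : is_derive t 1 (fun t : R => toC t * a + b) a.
Proof.
have := @line_derive R C C id b a t; rewrite derive_id.
have -> : (fun t : R => id (t *: a + b)) = (fun t : R => toC t * a + b).
  by apply/funext => x; rewrite scaleC.
by apply; exact: derivable_id.
Qed.

(** For unit vectors, e1^2 + e2^2 = 0 means orthogonality. It cancels the contribution of G_z to
    V_xx + V_yy, which leaves the Laplacian of sg u and puts [gradient_bound_square] in force. *)
Lemma directional_bound z (e1 e2 : C) (sg : R) : disc z -> nC e1 = 1 -> nC e2 = 1 ->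
  e1 * e1 + e2 * e2 = 0 -> `|sg| = 1 ->
  sg * (2 * reC (G z * e2)) <= (3 / 100) / (1 - nC z).
Proof.
move=> zd n1 n2 e0 sg1; pose r := 1 - nC z.
have r0 : 0 < r by rewrite subr_gt0 disc_nC.
(* Every point of the square of half-side r/4 about z is within r/2 of z, so it keeps distance at
   least r/2 from the unit circle. *)
pose d := r / 4; have d0 : 0 < d by rewrite divr_gt0.
have inD x y : `|x| <= d /\ `|y| <= d -> disc (pos z e1 e2 x y) /\ r / 2 <= 1 - nC (pos z e1 e2 x y).
  move=> [xd yd]; suff H : nC (pos z e1 e2 x y) <= nC z + r / 2.
    split; last by rewrite /r in H *; lra.
    by rewrite /disc /= -/(nC _); apply: le_lt_trans H _; rewrite /r in r0 *; lra.
  apply: le_trans (nCD _ _) _; rewrite nCM n1 mulr1 nC_toC.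
  have h := nCD (toC y * e2) z; rewrite nCM n2 mulr1 nC_toC in h.
  by rewrite /d in xd yd; lra.
have [gz [gzb H]] : exists gz gzb : C -> C, forall w, disc w -> wirtinger G w (gz w) (gzb w).
  exists (dz G), (dzbar G) => w wd; have [a [b [[dG _] _]]] := wirtinger_G wd.
  exact: wirtinger_diff.
pose p (x y : R) := pos z e1 e2 x y.
have px (x y : R) : is_derive x 1 (p ^~ y) e1 by exact: is_derive_affine.
have py (x y : R) : is_derive y 1 (p x) e2.
  have -> : p x = (fun y => toC y * e2 + (toC x * e1 + z)).
    by apply/funext => y'; rewrite /p /pos addrCA.
  exact: is_derive_affine.
pose k e : C := toC (sg * 2) * e.
have DG e w : disc w -> is_diff w (fun w => reC (G w * k e))
    (fun h => reC ((gz w * h + gzb w * cj h) * k e)).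
  move=> wd; have W := wirtingerM (H w wd) (wirtinger_cst (k e) w).
  have D := is_diff_lin reC_continuous W.
  apply: is_diff_ext D => // h; congr reC; rewrite /=; ring.
have Dv w : disc w -> is_diff w (fun w => sg * v w) (fun h => reC (G w * (toC (sg * 2) * h))).
  move=> wd; have D := is_diffZ sg (is_diff_log wd).
  apply: is_diff_ext D => // h; rewrite -[LHS]/(sg * (2 * reC (G w * h))).
  by move: (G w) => g; rewrite !reimE; ring.
have sgV x : `|sg * x| = `|x| by rewrite normrM sg1 mul1r.
pose V (x y : R) := sg * v (p x y).
pose Vx (x y : R) := reC (G (p x y) * k e1).
pose Vy (x y : R) := reC (G (p x y) * k e2).
pose Vxx (x y : R) := reC ((gz (p x y) * e1 + gzb (p x y) * cj e1) * k e1).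
pose Vyy (x y : R) := reC ((gz (p x y) * e2 + gzb (p x y) * cj e2) * k e2).
have B1 (x y : R) : `|x| <= d /\ `|y| <= d -> is_derive x 1 (V ^~ y) (Vx x y).
  by move=> /inD[wd _]; exact: (is_derive_comp_diff (c := p ^~ y) (Dv _ wd) (px x y)).
have B2 (x y : R) : `|x| <= d /\ `|y| <= d -> is_derive y 1 (V x) (Vy x y).
  by move=> /inD[wd _]; exact: (is_derive_comp_diff (c := p x) (Dv _ wd) (py x y)).
have B3 (x y : R) : `|x| <= d /\ `|y| <= d -> is_derive x 1 (Vx ^~ y) (Vxx x y).
  by move=> /inD[wd _]; exact: (is_derive_comp_diff (c := p ^~ y) (DG e1 _ wd) (px x y)).
have B4 (x y : R) : `|x| <= d /\ `|y| <= d -> is_derive y 1 (Vy x) (Vyy x y).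
  by move=> /inD[wd _]; exact: (is_derive_comp_diff (c := p x) (DG e2 _ wd) (py x y)).
have B5 (a : R * R) : `|a.1| <= d /\ `|a.2| <= d -> {for a, continuous (fun a => V a.1 a.2)}.
  move=> /inD[wd _]; apply: (@continuous_comp _ _ _ (fun a : R * R => p a.1 a.2) (fun w => sg * v w)).
    apply: cvgD; last apply: cvgD; last exact: cvg_cst.
      rewrite (_ : (fun _ => _) = (fun a : R * R => a.1 *: e1)); last first.
        by apply/funext => ?; rewrite scaleC.
      by rewrite -scaleC; apply: cvgZr_tmp; exact: cvg_fst.
    rewrite (_ : (fun _ => _) = (fun a : R * R => a.2 *: e2)); last first.
      by apply/funext => ?; rewrite scaleC.
    by rewrite -scaleC; apply: cvgZr_tmp; exact: cvg_snd.
  by apply: differentiable_continuous; have [] := Dv _ wd.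
have B6 (x y : R) : `|x| <= d /\ `|y| <= d -> `|V x y| <= 1 / 400.
  by move=> /inD[wd _]; rewrite /V sgV; exact: log_bound.
have B7 (x y : R) : `|x| <= d /\ `|y| <= d -> `|Vxx x y + Vyy x y| < 7 / 100 / r ^+ 2.
  move=> /inD[wd wr]; have L := laplacian_bound wd r0 wr (H _ wd).
  suff -> : Vxx x y + Vyy x y = sg * (4 * reC (gzb (p x y))) by rewrite sgV.
  rewrite /Vxx /Vyy /k -reCD; move: (gz (p x y)) (gzb (p x y)) => a b.
  have -> : (a * e1 + b * cj e1) * (toC (sg * 2) * e1) + (a * e2 + b * cj e2) * (toC (sg * 2) * e2)
    = toC (sg * 2) * (a * (e1 * e1 + e2 * e2) + b * (e1 * cj e1 + e2 * cj e2)) by ring.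
  by rewrite e0 !mulcj n1 n2 !reimE; ring.
have K := @gradient_bound_square R d (1/400) ((7 / 100) / r ^+ 2) V Vx Vy Vxx Vyy d0 B1 B2 B3 B4 B5 B6 B7.
have -> : sg * (2 * reC (G z * e2)) = Vy 0 0.
  rewrite /Vy /k /p /pos toC0 !mul0r !add0r; move: (G z) => g.
  by rewrite !reimE; ring.
apply: le_trans K _.
(* The two terms are (16/800)/r, from the bound on u, and (7/800)/r, from the bound on its
   Laplacian; 23/800 is below 3/100. *)
have -> : 2 * (1 / 400) / d + d * (7 / 100 / r ^+ 2) / 2 = (23 / 800) / r.
  by rewrite /d; field; rewrite gt_eqF.
by rewrite ler_pM2r ?invr_gt0//; lra.
Qed.

Lemma frame_G_bound z : disc z -> nC (G z) <= s z / 20.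
Proof.
move=> zd.
have r0 : 0 < 1 - nC z by rewrite subr_gt0 disc_nC.
have i2 : iC * iC = -1 :> C := iCM.
have e1i : 1 * 1 + iC * iC = 0 :> C by rewrite i2 mulr1 subrr.
have ei1 : iC * iC + 1 * 1 = 0 :> C by rewrite i2 mulr1 addNr.
have N1 : `|-1 : R| = 1 by rewrite normrN normr1.
have b1 := directional_bound zd nC_iC nC1 ei1 (normr1 R).
have b2 := directional_bound zd nC_iC nC1 ei1 N1.
have b3 := directional_bound zd nC1 nC_iC e1i (normr1 R).
have b4 := directional_bound zd nC1 nC_iC e1i N1.
have H : nC (G z) <= (3 / 100) / (1 - nC z).
  move: (G z) (3 / 100 / (1 - nC z)) b1 b2 b3 b4 => g m; rewrite !reimE => b1 b2 b3 b4.
  apply: le_trans (nC_le _) _.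
  have h1 : `|reC g| <= m / 2 by apply/ler_normlP; split; lra.
  have h2 : `|imC g| <= m / 2 by apply/ler_normlP; split; lra.
  lra.
apply: le_trans H _.
rewrite ler_pdivrMr// mulrAC ler_pdivlMr//.
have /andP[E1 E2] := E_bounds zd; have s0 := s_gt0 zd.
have z0 := nC_ge0 z; have z1 := disc_nC zd.
(* E = (s(1 - |z|)(1 + |z|))^2 / 2 <= 2 (s(1 - |z|))^2, so s(1 - |z|) < 6/10 would force E <=
   72/100. *)
suff : 6 / 10 <= s z * (1 - nC z) by lra.
rewrite leNgt; apply/negP => lt.
have : E z <= (s z * (1 - nC z)) ^+ 2 * 2.
  rewrite /E ler_pdivrMr// -!exprMn -mulrA -(exprMn _ _ 2) [leRHS](_ : _ = (s z * (1 - nC z) * 2) ^+ 2); last by ring.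
  apply: lerXn2r; rewrite ?nnegrE.
  - by rewrite mulr_ge0 ?ltW// disc_1N.
  - by rewrite !mulr_ge0 ?ltW.
  - by rewrite -mulrA ler_pM2l//; nra.
have : (s z * (1 - nC z)) ^+ 2 <= (6 / 10) ^+ 2.
  apply: lerXn2r; rewrite ?nnegrE ?mulr_ge0 ?(ltW s0) ?(ltW r0)//; exact: ltW.
lra.
Qed.

Lemma frame_q_bound z : disc z -> nC (frame_q s Q z) <= s z / 20.
Proof.
move=> zd; have s0 := s_gt0 zd.
have k : 0 <= s z / 20 by apply: divr_ge0; [exact: ltW|exact: ler0n].
rewrite -(@ler_pXn2r _ 2) ?nnegrE ?nC_ge0//.
apply: le_trans (q_bound zd) _; rewrite expr_div_n.
have : 0 <= s z ^+ 2 by exact: sqr_ge0.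
lra.
Qed.

End GradientOfConformalFactor.

(** * Hyperbolic geodesics *)

Section Geodesic.
Context {R : realType}.
Local Notation C := (Rcomplex R).

Lemma is_derive_mulC (f g : R -> C) (t : R) (a b : C) :
  is_derive t 1 f a -> is_derive t 1 g b ->
  is_derive t 1 (fun t => f t * g t) (a * g t + f t * b).
Proof.
move=> [df <-] [dg <-].
have Df : is_diff t f ('d f t) by apply: differentiableP; exact/derivable1_diffP.
have Dg : is_diff t g ('d g t) by apply: differentiableP; exact/derivable1_diffP.
have [dd e] := is_diff_bil mulCx_continuous Df Dg.
apply: DeriveDef; first exact/derivable1_diffP.
rewrite [LHS](deriveE (1 : R) dd) e -!deriveE; [|exact/derivable1_diffP..].
by rewrite addrC.
Qed.

Lemma is_derive_linC (F G : normedModType R) (L : {linear F -> G}) (f : R -> F) (t : R) (a : F) :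
  continuous L -> is_derive t 1 f a -> is_derive t 1 (fun t => L (f t)) (L a).
Proof. by move=> cL [df <-]; exact: is_derive_lin. Qed.

Lemma is_derive_cj (f : R -> C) (t : R) (a : C) :
  is_derive t 1 f a -> is_derive t 1 (fun t => cj (f t)) (cj a).
Proof. exact: (@is_derive_linC C C cj f t a cj_continuous). Qed.

Lemma is_derive_toC (f : R -> R) (t : R) (a : R) :
  is_derive t 1 f a -> is_derive t 1 (fun t => toC (f t)) (toC a).
Proof. exact: (@is_derive_linC R C (@toC R) f t a toC_continuous). Qed.

Lemma is_derive_reC (f : R -> C) (t : R) (a : C) :
  is_derive t 1 f a -> is_derive t 1 (fun t => reC (f t)) (reC a).
Proof. exact: (@is_derive_linC C R reC f t a reC_continuous). Qed.

Lemma is_derive_invC (f : R -> C) (t : R) (a : C) : f t != 0 ->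
  is_derive t 1 f a -> is_derive t 1 (fun t => (f t)^-1) (- a * (f t)^-1 * (f t)^-1).
Proof.
move=> f0 H; pose A : set C := [set w | w != 0].
have oA : open A.
  have -> : A = ~` [set 0] by apply/seteqP; split => w /= /eqP.
  by rewrite openC; exact: accessible_closed_set1 (hausdorff_accessible (@norm_hausdorff _ C)) _.
have W := wirtingerV oA f0 (fun w (Aw : A w) => Aw) (fun n => Fn_id n A) (wirtinger_id (f t)).
have D := is_derive_comp_diff W H; apply: is_derive_eq.
by rewrite oppr0 mul0r mul0r addr0 -[(f t ^+ 2)^-1]exprVn; ring.
Qed.

(* tanh (t / 2) *)
Definition geo_T (t : R) : R := 1 - 2 / (1 + expR t).

Lemma geo_T0 : geo_T 0 = 0.
Proof. by rewrite /geo_T expR0; field. Qed.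

Lemma geo_T_lt1 t : -1 < geo_T t < 1.
Proof.
have e0 := expR_gt0 t; rewrite /geo_T; apply/andP; split.
  by rewrite ltrBrDl -ltrBrDr opprK ltr_pdivrMr; lra.
by rewrite ltrBlDr ltrDl divr_gt0//; lra.
Qed.

Lemma is_derive_geo_T (t : R) : is_derive t 1 geo_T ((1 - geo_T t ^+ 2) / 2).
Proof.
have e0 : 1 + expR t != 0 by rewrite gt_eqF// addr_gt0// expR_gt0.
rewrite /geo_T; apply: is_derive_eq.
by rewrite /GRing.scale /=; field.
Qed.

Lemma geo_T_surj r : 0 <= r < 1 -> geo_T (ln ((1 + r) / (1 - r))) = r.
Proof.
move=> /andP[r0 r1]; have h : 0 < (1 + r) / (1 - r) by rewrite divr_gt0//; lra.
rewrite /geo_T lnK ?posrE//; field; rewrite gt_eqF/=; last by lra.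
by rewrite gt_eqF//; lra.
Qed.

Variables (a e : C).
Hypothesis ad : disc a.
Hypothesis e1 : e * cj e = 1.

Let n : R := 1 - nC a ^+ 2.
Let m (t : R) : R := (1 - geo_T t ^+ 2) / 2.
(* [geo] is the image of the unit speed geodesic t |-> tanh (t / 2) e by the
   Moebius map z |-> (z + a) / (1 + conj a z), and [geo_tau] is its velocity. *)
Definition geo_D (t : R) : C := 1 + cj a * e * toC (geo_T t).
Definition geo_N (t : R) : C := toC (geo_T t) * e + a.
Definition geo (t : R) : C := geo_N t * (geo_D t)^-1.
Definition geo_tau (t : R) : C := toC n * toC (m t) * e * ((geo_D t)^-1 * (geo_D t)^-1).

Let n0 : 0 < n. Proof. exact: disc_1N. Qed.
Let m0 t : 0 < m t.
Proof.
by rewrite /m divr_gt0//; have /andP[h1 h2] := geo_T_lt1 t; rewrite subr_gt0 expr2; nra.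
Qed.

Let nm0 t : 0 < n * (2 * m t).
Proof. by apply: mulr_gt0 => //; apply: mulr_gt0 => //; exact: m0. Qed.

Let enC : toC n = 1 - a * cj a.
Proof. by rewrite /n toCB toC1 mulcj. Qed.

(** The right side is (1 - |a|^2)(1 - T^2). The identity gives at once that the denominator does not
    vanish, that the curve stays in the disc, and its speed. *)
Lemma geo_DN t : nC (geo_D t) ^+ 2 - nC (geo_N t) ^+ 2 = n * (2 * m t).
Proof.
apply: toC_inj; rewrite toCB -!mulcj /geo_D /geo_N !(cjD, cjM, cj_toC, cjK, cj1).
rewrite (toCM n) (toCM 2).
rewrite enC.
have -> : toC 2 * toC (m t) = 1 - toC (geo_T t) * toC (geo_T t) :> C.
  by rewrite -!toCM -toC1 -toCB /m; congr toC; field.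
move: (toC (geo_T t)) (cj a) (cj e) e1 => T ab eb E1.
have -> : (1 + ab * e * T) * (1 + a * eb * T) - (T * e + a) * (T * eb + ab)
  = 1 + (e * eb) * (a * ab) * T * T - T * T * (e * eb) - a * ab by ring.
by rewrite E1; ring.
Qed.

Lemma geo_D_neq0 t : geo_D t != 0.
Proof.
apply/eqP => D0; have := geo_DN t; rewrite D0 nC0 expr0n sub0r => h.
have := nm0 t.
by rewrite -h oppr_gt0 ltNge sqr_ge0.
Qed.

Lemma geo_1N t : 1 - nC (geo t) ^+ 2 = n * (2 * m t) * nC (geo_D t)^-1 ^+ 2.
Proof.
have D0 := geo_D_neq0 t; rewrite -nC_eq0 in D0.
by rewrite -geo_DN /geo nCM nCV; field.
Qed.

Lemma geo_disc t : disc (geo t).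
Proof.
rewrite /disc /= -/(nC _) ltNge; apply/negP => h.
have : 0 < 1 - nC (geo t) ^+ 2.
  rewrite geo_1N; apply: mulr_gt0; first exact: nm0.
  by rewrite exprn_gt0// nC_gt0 invr_eq0 geo_D_neq0.
by rewrite subr_gt0 ltNge exprn_ege1.
Qed.

Lemma geo_tau_norm t : nC (geo_tau t) = (1 - nC (geo t) ^+ 2) / 2.
Proof.
have ne : nC e = 1.
  apply/eqP; rewrite -(@eqrXn2 _ 2) ?nC_ge0// expr1n; apply/eqP/toC_inj.
  by rewrite -mulcj toC1.
by rewrite geo_1N /geo_tau !nCM ne !nC_toC (gtr0_norm n0) (gtr0_norm (m0 t)); field.
Qed.

Lemma geo0 : geo 0 = a.
Proof. by rewrite /geo /geo_N /geo_D geo_T0 toC0 mulr0 mul0r add0r addr0 invr1 mulr1. Qed.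

Let D_deriv (t : R) : is_derive t 1 geo_D (cj a * e * toC (m t)).
Proof.
have H := is_derive_toC (is_derive_geo_T t).
have K := is_derive_mulC (is_derive_cst (cj a * e) t (1 : R)) H.
have K2 := @is_deriveD _ _ _ _ _ _ _ _ _ (is_derive_cst (1 : C) t (1 : R)) K.
by apply: is_derive_eq; rewrite mul0r !add0r.
Qed.

Lemma is_derive_geo (t : R) : is_derive t 1 geo (geo_tau t).
Proof.
have H := is_derive_toC (is_derive_geo_T t).
have K := is_derive_mulC H (is_derive_cst e t (1 : R)).
have K2 := @is_deriveD _ _ _ _ _ _ _ _ _ K (is_derive_cst a t (1 : R)).
have K3 := is_derive_invC (geo_D_neq0 t) (D_deriv t).
have K4 := is_derive_mulC K2 K3.
apply: is_derive_eq.
have D0 : geo_D t * (geo_D t)^-1 = 1 by rewrite divff// geo_D_neq0.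
rewrite mulr0 !addr0 -[(_ + _ : R -> C) t]/(toC (geo_T t) * e + a) /geo_tau enC -/(m t).
rewrite -[X in toC (m t) * e * X]mul1r -[X in toC (m t) * e * (X * _)]D0.
rewrite {1}/geo_D; move: (geo_D t)^-1 (cj a) => k ab; ring.
Qed.

(** The geodesic equation of the Poincare metric, whose Christoffel symbol is [hyp_gamma]. *)
Lemma is_derive_geo_tau (t : R) :
  is_derive t 1 geo_tau (- hyp_gamma (geo t) * (geo_tau t * geo_tau t)).
Proof.
have D0 : geo_D t * (geo_D t)^-1 = 1 by rewrite divff// geo_D_neq0.
have M1 : is_derive t 1 m (- geo_T t * m t).
  have H := is_derive_geo_T t; rewrite /m; apply: is_derive_eq.
  by rewrite /GRing.scale /= /m; field.
have H := is_derive_toC M1.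
have K3 := is_derive_invC (geo_D_neq0 t) (D_deriv t).
have K := is_derive_mulC (is_derive_mulC (is_derive_mulC (is_derive_cst (toC n : C) t (1 : R)) H)
  (is_derive_cst e t (1 : R))) (is_derive_mulC K3 K3).
apply: is_derive_eq.
have n2 : 1 - nC (geo t) ^+ 2 != 0 by rewrite gt_eqF// disc_1N//; exact: geo_disc.
(* The unit speed normalisation 2 |geo_tau| = 1 - |geo|^2 written out. *)
have key : toC (2 / (1 - nC (geo t) ^+ 2)) * toC n * toC (m t) * ((geo_D t)^-1 * cj (geo_D t)^-1) = 1 :> C.
  rewrite mulcj -!toCM -toC1; congr toC.
  have h := geo_1N t.
  have -> : 2 / (1 - nC (geo t) ^+ 2) * n * m t * nC (geo_D t)^-1 ^+ 2 =
     (n * (2 * m t) * nC (geo_D t)^-1 ^+ 2) / (1 - nC (geo t) ^+ 2) by ring.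
  by rewrite -h divff.
have tg : hyp_gamma (geo t) * geo_tau t = (toC (geo_T t) + cj a * e) * (geo_D t)^-1.
  rewrite /hyp_gamma /geo_tau /geo cjM /geo_N cjD cjM cj_toC.
  move: (toC (2 / (1 - nC (geo t) ^+ 2))) (cj (geo_D t)^-1) key e1 => r kb key E1.
  move: (toC n) (toC (m t)) (toC (geo_T t)) ((geo_D t)^-1) (cj e) (cj a) key E1 => N M T k eb ab key E1.
  have -> : r * ((T * eb + ab) * kb) * (N * M * e * (k * k)) = (r * N * M * (k * kb)) * (T * (e * eb) + ab * e) * k by ring.
  by rewrite key E1 mul1r mulr1.
have -> : - hyp_gamma (geo t) * (geo_tau t * geo_tau t) = - ((hyp_gamma (geo t) * geo_tau t) * geo_tau t) by ring.
rewrite tg /= mul0r add0r mulr0 addr0 toCM toCN /geo_tau.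
have T2 : toC (m t) * 2 = 1 - toC (geo_T t) * toC (geo_T t) :> C.
  by rewrite -(toC_nat 2) -!toCM -toC1 -toCB; congr toC; rewrite /m; field.
have e2 : (geo_D t)^-1 + cj a * e * toC (geo_T t) * (geo_D t)^-1 = 1.
  by rewrite -{1}[(geo_D t)^-1]mul1r -mulrDl.
move: (toC n) (toC (m t)) (toC (geo_T t)) ((geo_D t)^-1) (cj a) T2 e2 => N M T k ab T2 e2.
have -> : N * (- T * M) * e * (k * k) + N * M * e * (- (ab * e * M) * k * k * k + k * (- (ab * e * M) * k * k))
 = - (N * M * e * (k * k)) * (T * (k + ab * e * T * k - (k + ab * e * T * k - 1)) + ab * e * (M * 2) * k) by ring.
rewrite T2 e2; have -> : T * (1 - (1 - 1)) = T * (k + ab * e * T * k) by rewrite e2; ring.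
ring.
Qed.

End Geodesic.

Lemma geodesic_connect (R : realType) (a b : Rcomplex R) : disc a -> disc b -> a != b ->
  exists e t, [/\ e * cj e = 1, 0 < t & geo a e t = b].
Proof.
move=> ad bd ab.
have Dab : 1 - cj a * b != 0.
  apply/eqP => /eqP; rewrite subr_eq0 => /eqP h.
  have : nC (cj a * b) < 1 by rewrite nCM nC_cj mulr_ilt1 ?nC_ge0//; exact: disc_nC.
  by rewrite -h nC1 ltxx.
(* The Moebius map taking a to 0 takes b to w. The geodesic leaves a in the direction w / |w|, and
   tanh(t/2) = |w| fixes the time. *)
pose k := (1 - cj a * b)^-1; have kD : k * (1 - cj a * b) = 1 by rewrite mulVf.
pose w := (b - a) * k; pose r := nC w.
have r0 : 0 < r by rewrite nC_gt0 mulf_neq0 ?invr_eq0// subr_eq0 eq_sym.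
have r1 : r < 1.
  have h : nC (1 - cj a * b) ^+ 2 - nC (b - a) ^+ 2 = (1 - nC a ^+ 2) * (1 - nC b ^+ 2).
    apply: toC_inj; rewrite toCM !toCB -!mulcj !(cjB, cjM, cjK, cj1) toC1.
    by move: (cj a) (cj b) => A B; ring.
  have hp : 0 < (1 - nC a ^+ 2) * (1 - nC b ^+ 2) by rewrite mulr_gt0// disc_1N.
  have lt : nC (b - a) < nC (1 - cj a * b).
    by rewrite -(@ltr_pXn2r _ 2) ?nnegrE ?nC_ge0// -subr_gt0 h.
  by rewrite /r /w nCM nCV ltr_pdivrMr ?mul1r// nC_gt0.
pose e := w * toC r^-1.
exists e, (ln ((1 + r) / (1 - r))); split.
- rewrite /e cjM cj_toC mulrACA mulcj -/r -!toCM -toC1; congr toC.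
  by field; rewrite gt_eqF.
- by rewrite ln_gt0// ltr_pdivlMr ?subr_gt0//; lra.
rewrite /geo /geo_N /geo_D geo_T_surj ?r1 ?ltW//.
have we : toC r * e = w by rewrite /e mulrCA -toCM divff ?gt_eqF// toC1 mulr1.
rewrite we -mulrA [e * _]mulrC we.
have n0 : toC (1 - nC a ^+ 2) != 0 :> Rcomplex R by rewrite toC_eq0 gt_eqF// disc_1N.
have h1 : w + a = b * toC (1 - nC a ^+ 2) * k.
  have -> : w + a = (b - a) * k + a * (k * (1 - cj a * b)) by rewrite kD mulr1.
  by rewrite toCB toC1 -mulcj; move: (cj a) => A; ring.
have h2 : 1 + cj a * w = toC (1 - nC a ^+ 2) * k.
  have -> : 1 + cj a * w = k * (1 - cj a * b) + cj a * ((b - a) * k) by rewrite kD.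
  by rewrite toCB toC1 -mulcj; move: (cj a) => A; ring.
have k0 : k != 0 by rewrite invr_eq0.
by rewrite h1 h2 -[b * _ * _]mulrA mulfK// mulf_neq0.
Qed.

(** * Convexity of |<f, w>|^2 *)

Section DistanceFunction.
Context {R : realType}.
Local Notation C := (Rcomplex R).
Variables (s : C -> R) (Q : C -> C) (F : C -> 'M[C]_3).
Hypothesis hF : legendrian_frame s Q F.
Hypothesis s_gt0 : forall z, disc z -> 0 < s z.

Definition frame_coef (w : 'cV[C]_3) (j : 'I_3) (z : C) : C := herm (col j (F z)) w.

(* Up to the factor s, the z-derivative of |<f, w>|^2. *)
Definition crit (w : 'cV[C]_3) (z : C) : C :=
  frame_coef w 0 z * cj (frame_coef w 2 z) + frame_coef w 2 z * cj (frame_coef w 1 z).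

Lemma frame_coefE w j z : frame_coef w j z =
  F z 0 j * cj (w 0 0) + F z 1 j * cj (w 1 0) - F z 2 j * cj (w 2 0).
Proof. by rewrite /frame_coef herm_cj !mxE. Qed.

Lemma frame_coef_mulmx (v : 'cV[C]_3) j z : disc z ->
  frame_coef (F z *m v) j z = if j == 2 then - cj (v 2 0) else cj (v j 0).
Proof.
move=> zd; rewrite /frame_coef colE; have [_ /(_ z zd)[-> _] _] := hF.
rewrite herm_cj !mxE.
have [->|[->|->]] : j = 0 \/ j = 1 \/ j = 2.
  by case: j => [[|[|[|//]]] ?]; [left|right; left|right; right]; apply/val_inj.
all: by rewrite /=; ring.
Qed.

Lemma herm_frame_coef w z : disc z -> herm w w =
  toC (nC (frame_coef w 0 z) ^+ 2 + nC (frame_coef w 1 z) ^+ 2 - nC (frame_coef w 2 z) ^+ 2).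
Proof.
move=> zd; pose v := invmx (F z) *m w.
have -> : w = F z *m v by rewrite /v (mulKVmx (frame_unit hF zd)).
rewrite !frame_coef_mulmx//=; have [_ /(_ z zd)[-> _] _] := hF.
by rewrite herm_cj !mulcj nCN !nC_cj -!toCD -toCB.
Qed.

Lemma frame_coef0 w z : disc z -> (forall j, frame_coef w j z = 0) -> w = 0.
Proof.
move=> zd; pose v := invmx (F z) *m w.
have ew : w = F z *m v by rewrite /v (mulKVmx (frame_unit hF zd)).
rewrite ew => H; suff -> : v = 0 by rewrite mulmx0.
apply/matrixP => i j; rewrite ord1 [RHS]mxE; have := H i; rewrite frame_coef_mulmx//.
case: eqP => [->|_] /eqP; first by rewrite oppr_eq0 cj_eq0 => /eqP.
by rewrite cj_eq0 => /eqP.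
Qed.

Lemma wirtinger_coef w j z (a b : 'I_3 -> C) :
  (forall i, wirtinger (fun z => F z i j) z (a i) (b i)) ->
  wirtinger (frame_coef w j) z (a 0 * cj (w 0 0) + a 1 * cj (w 1 0) - a 2 * cj (w 2 0))
    (b 0 * cj (w 0 0) + b 1 * cj (w 1 0) - b 2 * cj (w 2 0)).
Proof.
move=> W; have K i := wirtingerM (W i) (wirtinger_cst (cj (w i 0)) z).
have H := wirtingerD (wirtingerD (K 0) (K 1)) (wirtingerN (K 2)).
apply: (wirtinger_eq (wirtinger_ext (fun x => esym (frame_coefE w j x)) H)) => /=; ring.
Qed.

Local Notation l := (frame_l s).
Local Notation q := (frame_q s Q).

Lemma wirtinger_coef0 w z : disc z -> wirtinger (frame_coef w 0) z
  (l z * frame_coef w 0 z - q z * frame_coef w 1 z)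
  (- cj (l z) * frame_coef w 0 z + toC (s z) * frame_coef w 2 z).
Proof.
move=> zd; have H := wirtinger_coef w (fun i => wirtinger_f1 hF i zd).
by apply: (wirtinger_eq H); rewrite !frame_coefE; move: (l z) (q z) (F z) => lz qz M; ring.
Qed.

Lemma wirtinger_coef1 w z : disc z -> wirtinger (frame_coef w 1) z
  (- l z * frame_coef w 1 z + toC (s z) * frame_coef w 2 z)
  (cj (q z) * frame_coef w 0 z + cj (l z) * frame_coef w 1 z).
Proof.
move=> zd; have H := wirtinger_coef w (fun i => wirtinger_f2 hF i zd).
by apply: (wirtinger_eq H); rewrite !frame_coefE; move: (l z) (q z) (F z) => lz qz M; ring.
Qed.

Lemma wirtinger_coef2 w z : disc z -> wirtinger (frame_coef w 2) z
  (toC (s z) * frame_coef w 0 z) (toC (s z) * frame_coef w 1 z).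
Proof.
move=> zd; have H := wirtinger_coef w (fun i => wirtinger_f3 hF i zd).
by apply: (wirtinger_eq H); rewrite !frame_coefE; move: (F z) => M; ring.
Qed.

Definition psi (w : 'cV[C]_3) (z : C) : R := nC (frame_coef w 2 z) ^+ 2.

Lemma is_diff_psi w z : disc z ->
  is_diff z (psi w) (fun h => 2 * reC (toC (s z) * crit w z * h)).
Proof.
move=> zd; have W := wirtinger_coef2 w zd.
have D := is_diff_lin reC_continuous (wirtingerM W (wirtinger_cj W)).
have e y : reC (frame_coef w 2 y * cj (frame_coef w 2 y)) = psi w y by rewrite mulcj.
apply: (is_diff_ext e _ D) => h; rewrite -[LHS]/(reC _) /crit.
move: (frame_coef w 0 z) (frame_coef w 1 z) (frame_coef w 2 z) (toC (s z)) (cj_toC (s z)) => a b c S Sb.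
rewrite !cjM Sb.
have -> : (S * a * cj c + c * (S * cj b)) * h = S * (a * cj c + c * cj b) * h by ring.
have -> : (S * b * cj c + c * (S * cj a)) * cj h = cj (S * (a * cj c + c * cj b) * h).
  by rewrite !(cjD, cjM, cjK) Sb; ring.
by rewrite addcj.
Qed.

(** On the line through z in the direction conj (crit w z) the derivative of psi at z is 2 s |crit w
    z|^2, and it must vanish at a minimum. *)
Lemma local_min_crit w z r : disc z -> 0 < r ->
  (forall y, disc y -> nC (y - z) < r -> psi w z <= psi w y) -> crit w z = 0.
Proof.
move=> zd r0 mn.
have /nbhs_ballP[d /= d0 Hd] := open_nbhs_nbhs (conj (@open_disc R) zd).
have dr0 : 0 < Num.min d r by rewrite lt_min d0.
pose v := cj (crit w z); have [v0|v0] := eqVneq v 0.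
  by apply/eqP; rewrite -cj_eq0 -/v v0.
have vn : 0 < nC v by rewrite nC_gt0.
pose k := Num.min d r / nC v; have k0 : 0 < k by rewrite divr_gt0.
pose c (t : R) := toC t * v + z.
have inb (t : R) : `|t| < k -> disc (c t) /\ nC (c t - z) < r.
  move=> tk; have e : nC (c t - z) = `|t| * nC v by rewrite /c addrK nCM nC_toC.
  have : nC (c t - z) < Num.min d r by rewrite e -ltr_pdivlMr.
  rewrite lt_min => /andP[h1 h2]; split=> //; apply: Hd.
  by rewrite -ball_normE /= distrC -/(nC _).
have D (t : R) : `|t| < k -> is_derive t 1 (fun t => psi w (c t)) (2 * reC (toC (s (c t)) * crit w (c t) * v)).
  move=> /inb[cd _].
  exact: (is_derive_comp_diff (c := c) (is_diff_psi w cd) (is_derive_affine v z t)).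
have k00 : `|0 : R| < k by rewrite normr0.
have M : is_derive (0 : R) 1 (fun t => psi w (c t)) 0.
  apply: (@derive1_at_min R _ (- k) k).
  - by rewrite ge0_cp// ltW.
  - by move=> t; rewrite in_itv /= -ltr_norml => /D[].
  - by rewrite in_itv /= oppr_lt0 k0.
  - move=> t; rewrite in_itv /= -ltr_norml => /inb[cd cr].
    have -> : c 0 = z by rewrite /c toC0 mul0r add0r.
    exact: mn.
have [_] := M; have [_ ->] := D 0 k00.
have -> : c 0 = z by rewrite /c toC0 mul0r add0r.
have aux (a b : R) : 0 < a -> 2 * (a * b) = 0 -> b = 0.
  by move=> a0 /eqP; rewrite !mulf_eq0 pnatr_eq0 (gt_eqF a0) => /eqP.
rewrite -mulrA mulcj -toCM reC_toC => /(aux _ _ (s_gt0 zd))/eqP.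
by rewrite sqrf_eq0 nC_eq0 => /eqP.
Qed.

Hypothesis G_bound : forall z, disc z -> nC (frame_G s z) <= s z / 20.
Hypothesis q_bound : forall z, disc z -> nC (q z) <= s z / 20.

(** * Second derivative of psi along a geodesic *)

Section AlongGeodesic.
Variables (w : 'cV[C]_3) (c tau : R -> C).
Hypothesis w_le0 : forall z, disc z ->
  nC (frame_coef w 0 z) ^+ 2 + nC (frame_coef w 1 z) ^+ 2 <= nC (frame_coef w 2 z) ^+ 2.
Hypothesis c_disc : forall t, disc (c t).
Hypothesis dc : forall t : R, is_derive t 1 c (tau t).
Hypothesis dtau : forall t : R, is_derive t 1 tau (- hyp_gamma (c t) * (tau t * tau t)).

Let S t : C := toC (s (c t)).
Let p t := frame_coef w 0 (c t).
Let p' t := frame_coef w 1 (c t).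
Let phi t := frame_coef w 2 (c t).

Lemma is_derive_wirtinger (f : C -> C) (t : R) (a b : C) : wirtinger f (c t) a b ->
  is_derive t 1 (fun t => f (c t)) (a * tau t + b * cj (tau t)).
Proof. by move=> W; exact: (is_derive_comp_diff (c := c) W (dc t)). Qed.

Let dphi t : C := S t * tau t * p t + S t * cj (tau t) * p' t.
(** The frame equations contribute 2 l and the geodesic equation -[hyp_gamma]; they combine into G =
    u_z, and the conj l terms cancel. Besides the leading multiple of phi, only u_z and q
    survive. *)
Let ddphi t : C := 2 * (S t * tau t) * cj (S t * tau t) * phi t
  + S t * (tau t * tau t) * (frame_G s (c t) * p t - q (c t) * p' t)
  + S t * cj (tau t * tau t) * (cj (frame_G s (c t)) * p' t + cj (q (c t)) * p t).

Let D_phi (t : R) : is_derive t 1 phi (dphi t).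
Proof.
have H := is_derive_wirtinger (wirtinger_coef2 w (c_disc t)).
apply: is_derive_eq; rewrite /dphi /S /p /p'; ring.
Qed.

Let D_dphi (t : R) : is_derive t 1 dphi (ddphi t).
Proof.
have HS := is_derive_wirtinger (wirtinger_s hF s_gt0 (c_disc t)).
have H0 := is_derive_wirtinger (wirtinger_coef0 w (c_disc t)).
have H1 := is_derive_wirtinger (wirtinger_coef1 w (c_disc t)).
have X := is_derive_mulC (is_derive_mulC HS (dtau t)) H0.
have Y := is_derive_mulC (is_derive_mulC HS (is_derive_cj (dtau t))) H1.
have K := @is_deriveD _ _ _ _ _ _ _ _ _ X Y.
apply: is_derive_eq.
rewrite /ddphi /frame_G /S /p /p' /phi.
move: (hyp_gamma (c t)) (l (c t)) (q (c t)) (tau t) (frame_coef w 0 (c t)) (frame_coef w 1 (c t)) (frame_coef w 2 (c t)).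
move=> g L Qq T a b f.
have -> : cj (2 * L - g) = 2 * cj L - cj g.
  by rewrite -(toC_nat 2) cjB (cjM (toC 2)) cj_toC.
rewrite !(cjM, cjN, cj_toC).
move: (toC (s (c t))) (cj g) (cj L) (cj Qq) (cj T) => SS gb Lb Qb Tb; ring.
Qed.

Definition dpsi t : R := 2 * reC (dphi t * cj (phi t)).
Definition ddpsi t : R := 2 * reC (ddphi t * cj (phi t) + dphi t * cj (dphi t)).

Lemma is_derive_psi (t : R) : is_derive t 1 (fun t => psi w (c t)) (dpsi t).
Proof.
have K := is_derive_reC (is_derive_mulC (D_phi t) (is_derive_cj (D_phi t))).
have e : (fun t => psi w (c t)) = (fun t => reC (phi t * cj (phi t))).
  by apply/funext => t'; rewrite mulcj.
rewrite e; apply: is_derive_eq; rewrite /dpsi; move: (dphi t) (phi t) => a b; rewrite !reimE; ring.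
Qed.

Lemma is_derive_dpsi (t : R) : is_derive t 1 dpsi (ddpsi t).
Proof.
have K := is_derive_reC (is_derive_mulC (D_dphi t) (is_derive_cj (D_phi t))).
by rewrite /dpsi /ddpsi; apply: is_derive_eq; rewrite /GRing.scale.
Qed.

Lemma dpsi_crit t : dpsi t = 2 * s (c t) * reC (tau t * crit w (c t)).
Proof.
rewrite /dpsi /dphi /crit -/(p t) -/(p' t) -/(phi t) /S.
move: (tau t) (p t) (p' t) (phi t) => T a b f; rewrite !reimE; ring.
Qed.

(** psi'' is 4 (s|tau|)^2 psi + 2|phi'|^2 + 2 Re(err conj phi). By [w_le0], |p| and |p'| are at most
    |phi|, so the error costs at most (2/5)(s|tau|)^2 psi, and 4 - 2/5 >= 3. *)
Lemma ddpsi_ge t : 3 * (s (c t) * nC (tau t)) ^+ 2 * psi w (c t) <= ddpsi t.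
Proof.
have cd := c_disc t; have s0 := s_gt0 cd; have HG := G_bound cd; have Hq := q_bound cd.
have Hw := w_le0 cd; rewrite /ddpsi /psi -/(p t) -/(p' t) -/(phi t) in Hw *.
rewrite reCD mulcj reC_toC.
pose err := S t * (tau t * tau t) * (frame_G s (c t) * p t - q (c t) * p' t)
  + S t * cj (tau t * tau t) * (cj (frame_G s (c t)) * p' t + cj (q (c t)) * p t).
have e0 : ddphi t * cj (phi t) = toC (2 * (s (c t) * nC (tau t)) ^+ 2 * nC (phi t) ^+ 2) + err * cj (phi t).
  have h : S t * tau t * cj (S t * tau t) = toC ((s (c t) * nC (tau t)) ^+ 2).
    by rewrite mulcj nCM nC_toC (gtr0_norm s0).
  rewrite /ddphi -/err; have -> : 2 * (S t * tau t) * cj (S t * tau t) * phi t + S t * (tau t * tau t) * (frame_G s (c t) * p t - q (c t) * p' t)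
  + S t * cj (tau t * tau t) * (cj (frame_G s (c t)) * p' t + cj (q (c t)) * p t) =
    2 * (S t * tau t * cj (S t * tau t)) * phi t + err.
    by rewrite /err; move: (S t * tau t) => k; ring.
  rewrite h mulrDl -mulrA mulcj !toCM toC_nat; ring.
have eb : nC err <= (s (c t) * nC (tau t)) ^+ 2 / 10 * (nC (p t) + nC (p' t)).
  have n1 : nC (frame_G s (c t) * p t - q (c t) * p' t) <= s (c t) / 20 * (nC (p t) + nC (p' t)).
    move: (frame_G s (c t)) (q (c t)) HG Hq => g qq HG Hq.
    apply: le_trans (nCD _ _) _; rewrite nCN !nCM mulrDr.
    by apply: lerD; apply: ler_wpM2r; rewrite ?nC_ge0.
  have n2 : nC (cj (frame_G s (c t)) * p' t + cj (q (c t)) * p t) <= s (c t) / 20 * (nC (p t) + nC (p' t)).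
    move: (frame_G s (c t)) (q (c t)) HG Hq => g qq HG Hq.
    apply: le_trans (nCD _ _) _; rewrite !nCM !nC_cj mulrDr addrC.
    by apply: lerD; apply: ler_wpM2r; rewrite ?nC_ge0.
  apply: le_trans (nCD _ _) _.
  rewrite (nCM (S t * _)) (nCM (S t * cj _)) !(nCM (S t)) nC_cj nCM nC_toC (gtr0_norm s0).
  have k0 : 0 <= s (c t) * (nC (tau t) * nC (tau t)) by apply: mulr_ge0; [exact: ltW|apply: mulr_ge0; exact: nC_ge0].
  apply: le_trans (lerD (ler_wpM2l k0 n1) (ler_wpM2l k0 n2)) _.
  rewrite le_eqVlt; apply/orP; left; apply/eqP; by field.
have pp : nC (p t) + nC (p' t) <= 2 * nC (phi t).
  have := nC_ge0 (p t); have := nC_ge0 (p' t); have := nC_ge0 (phi t).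
  move: (nC (p t)) (nC (p' t)) (nC (phi t)) Hw => a b f Hw f0 b0 a0.
  have af : a <= f by rewrite -(@ler_pXn2r _ 2) ?nnegrE//; have := sqr_ge0 b; lra.
  have bf : b <= f by rewrite -(@ler_pXn2r _ 2) ?nnegrE//; have := sqr_ge0 a; lra.
  lra.
have re : - (nC err * nC (phi t)) <= reC (err * cj (phi t)).
  by have /ler_normlP[] := reC_le (err * cj (phi t)); rewrite nCM nC_cj lerNl.
rewrite e0 reCD reC_toC.
have := sqr_ge0 (nC (dphi t)).
have f0 := nC_ge0 (phi t); have p0 : 0 <= nC (p t) + nC (p' t) by rewrite addr_ge0 ?nC_ge0.
have k0 : 0 <= (s (c t) * nC (tau t)) ^+ 2 by exact: sqr_ge0.
have bound : nC err * nC (phi t) <= (s (c t) * nC (tau t)) ^+ 2 / 5 * nC (phi t) ^+ 2.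
  have h1 : nC err <= (s (c t) * nC (tau t)) ^+ 2 / 10 * (2 * nC (phi t)).
    apply: le_trans eb _; apply: ler_wpM2l => //; exact: divr_ge0.
  apply: le_trans (ler_wpM2r f0 h1) _.
  by rewrite le_eqVlt; apply/orP; left; apply/eqP; by field.
have : 0 <= (s (c t) * nC (tau t)) ^+ 2 * nC (phi t) ^+ 2 by rewrite mulr_ge0// sqr_ge0.
move: bound re; move: ((s (c t) * nC (tau t)) ^+ 2) (nC (phi t) ^+ 2) (nC err * nC (phi t)) (reC (err * cj (phi t))) => K f e r.
set d2 := nC (dphi t) ^+ 2; lra.
Qed.

End AlongGeodesic.

End DistanceFunction.

(** * Critical points *)

Section CriticalPoints.
Context {R : realType}.
Local Notation C := (Rcomplex R).

Lemma nC_continuous : continuous (@nC R).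
Proof. move=> z; exact: norm_continuous. Qed.

(** The ball is a closed subset of the image of a square under (x, y) |-> x + iy + z0. *)
Lemma compact_closed_ballC (z0 : C) (r : R) : compact [set z : C | nC (z - z0) <= r].
Proof.
pose f (p : R * R) : C := p.1 *: (1 : C) + (p.2 *: (iC : C) + z0).
have cf : continuous f.
  move=> p; apply: cvgD; first by apply: cvgZr_tmp; exact: cvg_fst.
  by apply: cvgD; [apply: cvgZr_tmp; exact: cvg_snd|exact: cvg_cst].
pose K : set (R * R) := `[- r, r]%classic `*` `[- r, r]%classic.
have cK : compact (f @` K).
  apply: continuous_compact; first exact: continuous_subspaceT.
  by apply: compact_setX; exact: segment_compact.
have cl : closed [set z : C | nC (z - z0) <= r].
  have -> : [set z : C | nC (z - z0) <= r] = (fun z => nC (z - z0)) @^-1` [set x | x <= r] by [].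
  apply: closed_comp; last exact: closed_le.
  move=> z _; apply: (@continuous_comp _ _ _ (fun z : C => z - z0) (@nC R)).
    by have [d _] := wirtingerD (wirtinger_id z) (wirtinger_cst (- z0) z); exact: (differentiable_continuous d).
  exact: nC_continuous.
apply: (subclosed_compact cl cK) => z /= zr.
exists (reC (z - z0), imC (z - z0)).
  rewrite /K /= !in_itv /= -!ler_norml; split.
    exact: le_trans (reC_le _) zr.
  exact: le_trans (imC_le _) zr.
by rewrite /f /= !scaleC mulr1 addrA [toC (imC _) * _]mulrC -reim subrK.
Qed.

Variables (s : C -> R) (Q : C -> C) (F : C -> 'M[C]_3).
Hypothesis hF : legendrian_frame s Q F.
Hypothesis s_gt0 : forall z, disc z -> 0 < s z.
Hypothesis G_bound : forall z, disc z -> nC (frame_G s z) <= s z / 20.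
Hypothesis q_bound : forall z, disc z -> nC (frame_q s Q z) <= s z / 20.
Hypothesis E_bound : forall z, disc z -> 499 / 500 <= conformal_ratio s z.

Variable w : 'cV[C]_3.
Hypothesis w0 : w != 0.
Hypothesis w_le0 : reC (herm w w) <= 0.

Lemma coef_le z : disc z ->
  nC (frame_coef F w 0 z) ^+ 2 + nC (frame_coef F w 1 z) ^+ 2 <= nC (frame_coef F w 2 z) ^+ 2.
Proof. by move=> zd; move: w_le0; rewrite (herm_frame_coef hF w zd) reC_toC subr_le0. Qed.

Lemma psi_gt0 z : disc z -> 0 < psi F w z.
Proof.
move=> zd; have H := coef_le zd.
have := sqr_ge0 (nC (frame_coef F w 2 z)); rewrite le_eqVlt => /orP[/eqP e|//].
have h0 := sqr_ge0 (nC (frame_coef F w 0 z)); have h1 := sqr_ge0 (nC (frame_coef F w 1 z)).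
rewrite -e in H; suff : w = 0 by move/eqP; rewrite (negbTE w0).
apply: (frame_coef0 hF zd) => j.
have a0 : nC (frame_coef F w 0 z) ^+ 2 = 0 by apply/eqP; rewrite eq_le h0 andbT; lra.
have a1 : nC (frame_coef F w 1 z) ^+ 2 = 0 by apply/eqP; rewrite eq_le h1 andbT; lra.
have [->|[->|->]] : j = 0 \/ j = 1 \/ j = 2.
  by case: j => [[|[|[|//]]] ?]; [left|right; left|right; right]; apply/val_inj.
all: apply/eqP; rewrite -nC_eq0 -sqrf_eq0; apply/eqP => //.
Qed.

(** At unit hyperbolic speed (s|tau|)^2 = E/2 >= 499/1000, and three times this exceeds 1. *)
Lemma ddpsi_geo_ge a e t : disc a -> e * cj e = 1 ->
  psi F w (geo a e t) <= ddpsi s Q F w (geo a e) (geo_tau a e) t.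
Proof.
move=> ad e1; have cd := geo_disc ad e1.
have := ddpsi_ge s_gt0 G_bound q_bound (geo_tau a e) coef_le cd t.
apply: le_trans; have p0 := psi_gt0 (cd t).
rewrite ler_peMl ?(ltW p0)//.
have := E_bound (cd t); rewrite (geo_tau_norm ad e1) /conformal_ratio exprMn expr_div_n.
move: (s (geo a e t) ^+ 2) ((1 - nC (geo a e t) ^+ 2) ^+ 2) => x y.
have -> : (2 : R) ^+ 2 = 4 by rewrite expr2; ring.
lra.
Qed.

Lemma crit_unique z1 z2 : disc z1 -> disc z2 -> crit F w z1 = 0 -> crit F w z2 = 0 -> z1 = z2.
Proof.
move=> d1 d2 c1 c2; apply/eqP; apply/negPn/negP => ne.
have [e [t [e1 t0 et]]] := geodesic_connect d1 d2 ne.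
have cd := geo_disc d1 e1.
have D (u : R) : 0 <= u <= t -> is_derive u 1 (dpsi s F w (geo z1 e) (geo_tau z1 e))
    (ddpsi s Q F w (geo z1 e) (geo_tau z1 e) u).
  by move=> _; exact: (is_derive_dpsi hF s_gt0 w cd (is_derive_geo d1 e1) (is_derive_geo_tau d1 e1)).
have [u _] := MVT_closed t0 D.
rewrite !dpsi_crit geo0 et c1 c2 !mulr0 subrr subr0 => /esym/eqP.
rewrite mulf_eq0 (gt_eqF t0) orbF gt_eqF//.
exact: lt_le_trans (psi_gt0 (cd u)) (ddpsi_geo_ge u d1 e1).
Qed.

Lemma psi_continuous z : disc z -> {for z, continuous (psi F w)}.
Proof. by move=> zd; have [d _] := is_diff_psi hF w zd; exact: differentiable_continuous. Qed.

Lemma psi_min_closed_ball z0 r : 0 <= r -> [set z : C | nC (z - z0) <= r] `<=` disc ->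
  exists2 z, nC (z - z0) <= r & forall y, nC (y - z0) <= r -> psi F w z <= psi F w y.
Proof.
move=> r0 sub.
have [||z] := @compact_EVT_min _ R (psi F w) _ _ (@compact_closed_ballC z0 r).
- by exists z0; rewrite /= subrr nC0.
- by apply: continuous_in_subspaceT => z; rewrite inE => /sub zd; exact: psi_continuous.
by rewrite inE /= => zr mn; exists z => // y yr; apply: mn; rewrite inE.
Qed.

Hypothesis w_lt0 : reC (herm w w) < 0.

(** With c = - <w,w>, [herm_frame_coef] gives psi >= c, hence psi'' >= c along rays from 0, while
    the initial slope is at least -K. So psi(t) >= psi(0) - K t + c t^2 / 2, which exceeds psi(0)
    beyond t = 2K/c, and the minimum over the remaining closed ball is global. *)
Lemma crit_exists : exists2 z, disc z & forall y, disc y -> psi F w z <= psi F w y.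
Proof.
have d0 : disc (0 : C) by rewrite /disc /= normr0.
pose c := - reC (herm w w); have c0 : 0 < c by rewrite oppr_gt0.
pose K := s 0 * nC (crit F w 0).
have K0 : 0 <= K by rewrite mulr_ge0 ?nC_ge0// ltW// s_gt0.
have psi_c z : disc z -> c <= psi F w z.
  move=> zd; rewrite /c (herm_frame_coef hF w zd) reC_toC /psi.
  have h0 := sqr_ge0 (nC (frame_coef F w 0 z)); have h1 := sqr_ge0 (nC (frame_coef F w 1 z)).
  lra.
have growth e t : e * cj e = 1 -> 2 * K / c < t -> psi F w 0 < psi F w (geo 0 e t).
  move=> e1 tK; have t0 : 0 < t by apply: le_lt_trans tK; apply: divr_ge0; [exact: mulr_ge0|exact: ltW].
  have cd := geo_disc d0 e1.
  pose dp := dpsi s F w (geo 0 e) (geo_tau 0 e).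
  have D2 (u : R) : is_derive u 1 dp (ddpsi s Q F w (geo 0 e) (geo_tau 0 e) u).
    exact: (is_derive_dpsi hF s_gt0 w cd (is_derive_geo d0 e1) (is_derive_geo_tau d0 e1)).
  have D1 (u : R) : is_derive u 1 (fun t => psi F w (geo 0 e t)) (dp u).
    exact: (is_derive_psi hF w cd (is_derive_geo d0 e1)).
  have dp0 : - K <= dp 0.
    rewrite /dp dpsi_crit geo0.
    have n1 : nC (geo_tau 0 e 0) = 1 / 2.
      by rewrite (geo_tau_norm d0 e1) geo0 nC0 expr0n subr0.
    have h := reC_le (geo_tau 0 e 0 * crit F w 0); rewrite nCM n1 in h.
    have /ler_normlP[h1 _] := h.
    rewrite /K; have s0 := s_gt0 d0.
    have := ler_wpM2l (ltW s0) h1.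
    move: (reC _) (nC _) (s 0) => x y S; lra.
  have dpu u : 0 < u -> - K + c * u <= dp u.
    move=> u0; have [v _ e2] := MVT_closed u0 (fun v _ => D2 v).
    have : c * u <= dp u - dp 0.
      rewrite e2 subr0 ler_pM2r//; apply: le_trans (psi_c _ (cd v)) _.
      exact: ddpsi_geo_ge.
    lra.
  pose k (u : R) := psi F w (geo 0 e u) + K * u - c / 2 * (u * u).
  have Dk (u : R) : 0 <= u <= t -> is_derive u 1 k (dp u + K - c * u).
    move=> _; have H := D1 u; rewrite /k; apply: is_derive_eq.
    by rewrite /GRing.scale /=; field.
  have [u /andP[u0 _] e2] := MVT_closed t0 Dk.
  have : 0 <= k t - k 0.
    by rewrite e2 subr0 mulr_ge0 ?(ltW t0)//; have := dpu u u0; lra.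
  rewrite /k geo0 !mulr0 addr0 subr0 => h.
  have : 0 < c / 2 * (t * t) - K * t.
    have -> : c / 2 * (t * t) - K * t = (c * t / 2 - K) * t by field.
    rewrite mulr_gt0// subr_gt0; move: tK; rewrite ltr_pdivrMr//.
    by rewrite mulrC; lra.
  lra.
pose t0 := 2 * K / c; have t00 : 0 <= t0 by apply: divr_ge0; [exact: mulr_ge0|exact: ltW].
pose r0 := geo_T t0.
have r01 : r0 < 1 by have /andP[] := geo_T_lt1 t0.
have T_incr (u v : R) : u <= v -> geo_T u <= geo_T v.
  move=> uv; rewrite /geo_T lerD2l lerN2 ler_pM2l// lef_pV2 ?posrE ?addr_gt0 ?expR_gt0//.
  by rewrite lerD2l ler_expR.
have r00 : 0 <= r0 by rewrite -geo_T0; exact: T_incr.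
have far z : disc z -> r0 < nC z -> psi F w 0 < psi F w z.
  move=> zd zr; pose r := nC z; have rp : 0 < r by exact: le_lt_trans zr.
  pose e := z * toC r^-1; pose t := ln ((1 + r) / (1 - r)).
  have e1 : e * cj e = 1.
    rewrite /e cjM cj_toC mulrACA mulcj -/r -!toCM -toC1; congr toC.
    by field; rewrite gt_eqF.
  have Tt : geo_T t = r by apply: geo_T_surj; rewrite ltW//; exact: disc_nC.
  have -> : z = geo 0 e t.
    rewrite /geo /geo_N /geo_D Tt cj0 !mul0r !addr0 invr1 mulr1 /e mulrCA -toCM divff ?gt_eqF//.
    by rewrite toC1 mulr1.
  apply: growth => //; rewrite ltNge; apply/negP => /T_incr; rewrite Tt leNgt.
  by rewrite zr.
have sub : [set z : C | nC (z - 0) <= r0] `<=` disc.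
  by move=> z /=; rewrite subr0 /disc /= => h; apply: le_lt_trans h r01.
have [z zr mn] := psi_min_closed_ball r00 sub.
exists z; first exact: sub.
move=> y yd; have [yr|yr] := leP (nC (y - 0)) r0; first exact: mn.
apply: le_trans (mn 0 _) _; first by rewrite subr0 nC0.
by apply/ltW/far; rewrite // -[y]subr0.
Qed.

(** The minimum is strict, because any other minimiser would be a second critical point.
    [zeta_continuous] uses this strictness on a circle. *)
Lemma crit_global_min z : disc z -> crit F w z = 0 ->
  forall y, disc y -> psi F w z <= psi F w y /\ (psi F w y <= psi F w z -> y = z).
Proof.
move=> zd cz; have [z' zd' mn] := crit_exists.
have cz' : crit F w z' = 0.
  by apply: (local_min_crit hF s_gt0 zd' ltr01) => y yd _; exact: mn.
have -> : z = z' by exact: crit_unique.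
move=> y yd; split; first exact: mn.
move=> yz; apply: crit_unique => //.
by apply: (local_min_crit hF s_gt0 yd ltr01) => x xd _; apply: le_trans yz _; exact: mn.
Qed.

End CriticalPoints.

(** * Implicit differentiation *)

Section Implicit.
Context {R : realType}.

(* The last hypothesis says that [M] is a left inverse of the partial derivative
   of [H] in [F] and that [T] is what the chain rule forces. *)
Lemma implicit_is_diff (E F G : normedModType R) (H : F * E -> G) (zeta : E -> F) (y0 : E)
    (M : {linear G -> F}) (T : {linear E -> F}) :
  differentiable H (zeta y0, y0) -> {for y0, continuous zeta} ->
  (\forall y \near y0, H (zeta y, y) = 0) -> continuous M -> continuous T ->
  (forall xi v, M ('d H (zeta y0, y0) (xi, v)) = xi - T v) ->
  is_diff y0 zeta T.
Proof.
move=> dH cz H0 cM cT MT.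
have [k k0 Mk] := linear_lipschitz cM; have [K K0 TK] := linear_lipschitz cT.
have HH := nbhs_singleton H0.
apply: is_diffP => // e e0.
(* k e1 <= 1/2 lets |D| be absorbed into the left side, which gives |D| <= (2K + 1)|h|; then k e1
   (2K + 2) <= e yields the required estimate. *)
pose e1 := Num.min (1 / 2) (e / (2 * K + 2)) / k.
have K2 : 0 < 2 * K + 2 by rewrite addr_gt0// mulr_gt0.
have m0 : 0 < Num.min (1 / 2) (e / (2 * K + 2)) by rewrite lt_min !divr_gt0.
have e10 : 0 < e1 by rewrite divr_gt0.
have ke1 : k * e1 = Num.min (1 / 2) (e / (2 * K + 2)) by rewrite /e1 mulrCA divff ?mulr1// gt_eqF.
have ke2 : k * e1 <= 1 / 2 by rewrite ke1 ge_min lexx.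
have ke3 : k * e1 * (2 * K + 2) <= e.
  by rewrite -ler_pdivlMr// ke1 ge_min lexx orbT.
have A1 := is_diff_eps dH e10.
have A2 : \forall h \near (0 : E), `|H (zeta (h + y0), h + y0) - H (zeta y0, y0) -
   'd H (zeta y0, y0) (zeta (h + y0) - zeta y0, h)| <= e1 * `|(zeta (h + y0) - zeta y0, h)|.
  have c : (fun h : E => (zeta (h + y0) - zeta y0, h)) @ (0 : E) --> (0 : F * E).
    have cB : (fun h : E => h) @ (0 : E) --> (0 : E) by exact: cvg_id.
    have cA : (fun h : E => zeta (h + y0) - zeta y0) @ (0 : E) --> (0 : F).
      rewrite -(subrr (zeta y0)); apply: cvgB; last exact: cvg_cst.
      have : (fun h : E => h + y0) @ (0 : E) --> y0.
        by rewrite -[X in _ --> X]add0r; apply: cvgD; [exact: cB|exact: cvg_cst].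
      move=> c1; have cz' : zeta x @[x --> y0] --> zeta y0 := cz.
      exact: (cvg_comp _ _ c1 cz').
    exact: (cvg_pair cA cB).
  pose P (x : F * E) := `|H (x + (zeta y0, y0)) - H (zeta y0, y0) - 'd H (zeta y0, y0) x| <= e1 * `|x|.
  have A1' : \forall h \near (0 : E), P (zeta (h + y0) - zeta y0, h) := c _ A1.
  move: A1'; apply: filterS => h; rewrite /P.
  by rewrite -[(_, h) + (_, y0)]/(zeta (h + y0) - zeta y0 + zeta y0, h + y0) subrK.
have A3 : \forall h \near (0 : E), H (zeta (h + y0), h + y0) = 0.
  by have := H0; rewrite (near_shift 0) /=; apply: filterS => h; rewrite /= subr0.
near=> h.
have b1 : `|H (zeta (h + y0), h + y0) - H (zeta y0, y0) -
   'd H (zeta y0, y0) (zeta (h + y0) - zeta y0, h)| <= e1 * `|(zeta (h + y0) - zeta y0, h)| by near: h.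
have b2 : H (zeta (h + y0), h + y0) = 0 by near: h.
rewrite b2 HH subrr sub0r normrN in b1.
set D := zeta (h + y0) - zeta y0 in b1 *.
have b3 : `|D - T h| <= k * e1 * (`|D| + `|h|).
  rewrite -MT; apply: le_trans (Mk _) _; rewrite -mulrA ler_pM2l//.
  apply: le_trans b1 _; rewrite ler_pM2l// prod_normE /= ge_max.
  by rewrite lerDl lerDr !normr_ge0.
have b4 : `|D| <= (2 * K + 1) * `|h|.
  have t1 : `|D| <= `|D - T h| + `|T h| by rewrite -{1}(subrK (T h) D); exact: ler_normD.
  have t2 := TK h; have D0 := normr_ge0 D; have h0 := normr_ge0 h.
  have t3 : k * e1 * (`|D| + `|h|) <= 1 / 2 * (`|D| + `|h|) by rewrite ler_wpM2r// addr_ge0.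
  have t4 := le_trans b3 t3.
  move: t1 t2 t4 D0 h0; move: (`|D - T h|) (`|T h|) (`|D|) (`|h|) => x y u v t1 t2 t4 D0 h0.
  have -> : (2 * K + 1) * v = 2 * (K * v) + v by ring.
  by move: (K * v) t2 => Kv t2; lra.
apply: le_trans b3 _; apply: le_trans (_ : k * e1 * ((2 * K + 2) * `|h|) <= _).
  apply: ler_wpM2l; first exact: ltW (mulr_gt0 k0 e10).
  have -> : (2 * K + 2) * `|h| = (2 * K + 1) * `|h| + `|h| by ring.
  by rewrite lerD2r.
by rewrite mulrA ler_wpM2r.
Unshelve. all: by end_near. Qed.

End Implicit.

(** * Smooth dependence of the critical point *)

Section CriticalPointMap.
Context {R : realType}.
Local Notation C := (Rcomplex R).
Variables (s : C -> R) (Q : C -> C) (F : C -> 'M[C]_3).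
Hypothesis hF : legendrian_frame s Q F.
Hypothesis s_gt0 : forall z, disc z -> 0 < s z.
Hypothesis G_bound : forall z, disc z -> nC (frame_G s z) <= s z / 20.
Hypothesis q_bound : forall z, disc z -> nC (frame_q s Q z) <= s z / 20.
Hypothesis E_bound : forall z, disc z -> 499 / 500 <= conformal_ratio s z.

Definition affine_vec (y : C * C) : 'cV[C]_3 := \col_i nth 0 [:: y.1; y.2; 1] i.

Definition unit_ball2 : set (C * C) := [set y | nC y.1 ^+ 2 + nC y.2 ^+ 2 < 1].

Local Notation B := unit_ball2.
Local Notation vec := affine_vec.

Lemma affine_vecE y : (vec y 0 0 = y.1) * (vec y 1 0 = y.2) * (vec y 2 0 = 1).
Proof. by rewrite !mxE. Qed.

Lemma affine_vec_neq0 y : vec y != 0.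
Proof.
apply/eqP => /matrixP/(_ 2 0); rewrite affine_vecE mxE => /eqP.
by rewrite oner_eq0.
Qed.

Lemma herm_affine_vec y : herm (vec y) (vec y) = toC (nC y.1 ^+ 2 + nC y.2 ^+ 2 - 1).
Proof. by rewrite herm_cj !affine_vecE !mulcj nC1 expr1n -!toCD -toCB. Qed.

Lemma affine_vec_lt0 y : B y -> reC (herm (vec y) (vec y)) < 0.
Proof. by move=> By; rewrite herm_affine_vec reC_toC subr_lt0. Qed.

Lemma affine_vec_le0 y : B y -> reC (herm (vec y) (vec y)) <= 0.
Proof. by move=> By; exact/ltW/affine_vec_lt0. Qed.

Lemma nC2_continuous_fst : continuous (fun y : C * C => nC y.1 ^+ 2 + nC y.2 ^+ 2).
Proof.
have c (f : C * C -> C) : continuous f -> continuous (fun y => nC (f y) ^+ 2).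
  move=> cf y; have H : nC (f x) @[x --> y] --> nC (f y).
    by apply: (@continuous_comp _ _ _ f (@nC R)); [exact: cf|exact: nC_continuous].
  by rewrite /continuous_at expr2; under eq_fun do rewrite expr2; exact: cvgM.
by move=> y; apply: cvgD; [apply: (c fst)|apply: (c snd)] => x; [exact: cvg_fst|exact: cvg_snd].
Qed.

Lemma open_unit_ball2 : open B.
Proof.
have -> : B = (fun y : C * C => nC y.1 ^+ 2 + nC y.2 ^+ 2) @^-1` [set x | x < 1] by [].
by apply: open_comp; [move=> y _; exact: nC2_continuous_fst|exact: open_lt].
Qed.

(** A choice made point by point, which uniqueness makes canonical on the ball. The default 0 is
    taken only where no critical point exists. *)
Definition zeta (y : C * C) : C := xget 0 [set z | disc z /\ crit F (vec y) z = 0].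

Lemma zetaP y : B y -> disc (zeta y) /\ crit F (vec y) (zeta y) = 0.
Proof.
move=> By; have [z zd mn] := crit_exists hF s_gt0 G_bound q_bound E_bound
   (affine_vec_neq0 y) (affine_vec_le0 By) (affine_vec_lt0 By).
rewrite /zeta; case: xgetP => [z' -> //|/(_ z)]; case; split => //.
by apply: (local_min_crit hF s_gt0 zd ltr01) => x xd _; exact: mn.
Qed.

Lemma zeta_unique y z : B y -> disc z -> crit F (vec y) z = 0 -> zeta y = z.
Proof.
move=> By zd cz; have [d c] := zetaP By.
exact: (crit_unique hF s_gt0 G_bound q_bound E_bound (affine_vec_neq0 y) (affine_vec_le0 By)).
Qed.

Definition joint_dom : set (C * (C * C)) := [set p | disc p.1].
Definition joint_coef (j : 'I_3) (p : C * (C * C)) : C := frame_coef F (vec p.2) j p.1.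
Definition joint_crit (p : C * (C * C)) : C := crit F (vec p.2) p.1.

Lemma open_joint_dom : open joint_dom.
Proof.
have -> : joint_dom = (fun p : C * (C * C) => p.1) @^-1` disc by [].
by apply: open_comp; [move=> p _; exact: cvg_fst|exact: open_disc].
Qed.

Lemma Fn_fst (E1 E2 : normedModType R) n (A : set (E1 * E2)) : Fn n A (fst : E1 * E2 -> E1).
Proof. by apply: (@Fn_linear R (E1 * E2)%type E1 n A fst) => p; exact: cvg_fst. Qed.

Lemma Fn_snd (E1 E2 : normedModType R) n (A : set (E1 * E2)) : Fn n A (snd : E1 * E2 -> E2).
Proof. by apply: (@Fn_linear R (E1 * E2)%type E2 n A snd) => p; exact: cvg_snd. Qed.

Lemma joint_coef_smooth j : Fsmooth joint_dom (joint_coef j).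
Proof.
move=> n; have oU := open_joint_dom.
have HF i k : Fn n joint_dom (fun p : C * (C * C) => F p.1 i k).
  apply: (Fn_comp (findimC (R := R)) oU (B := disc) (f := fst) (g := fun z => F z i k)) => //.
    exact: Fn_fst.
  exact: (frame_smooth hF).
have HS : Fn n joint_dom (fun p : C * (C * C) => p.2) by exact: Fn_snd.
have fd : findim (C * C)%type by apply: findim_prod; exact: findimC.
have H1 : Fn n joint_dom (fun p : C * (C * C) => p.2.1).
  apply: (Fn_comp fd oU (B := setT) (f := snd) (g := fst)) => //; exact: Fn_fst.
have H2 : Fn n joint_dom (fun p : C * (C * C) => p.2.2).
  apply: (Fn_comp fd oU (B := setT) (f := snd) (g := snd)) => //; exact: Fn_snd.
apply: (Fn_ext (f := fun p => F p.1 0 j * cj p.2.1 + F p.1 1 j * cj p.2.2 - F p.1 2 j) oU).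
  by move=> p _; rewrite /joint_coef frame_coefE !affine_vecE cj1 mulr1.
exact: (FnB oU (FnD oU (FnCM oU (HF 0 j) (Fn_cj oU H1)) (FnCM oU (HF 1 j) (Fn_cj oU H2))) (HF 2 j)).
Qed.

Lemma joint_crit_smooth : Fsmooth joint_dom joint_crit.
Proof.
move=> n; have oU := open_joint_dom; have H j := @joint_coef_smooth j n.
exact: (FnD oU (FnCM oU (H 0) (Fn_cj oU (H 2))) (FnCM oU (H 2) (Fn_cj oU (H 1)))).
Qed.

Lemma joint_psi_continuous z y : disc z ->
  {for (z, y), continuous (fun p : C * (C * C) => psi F (vec p.2) p.1)}.
Proof.
move=> zd; have H := Fn_nC2 open_joint_dom (joint_coef_smooth 2 0).
exact: H.
Qed.

(** On a small circle about zeta y, psi is above its value at the centre by a definite gap. By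
    compactness the gap persists for y' near y, so the minimum of psi for y' over the closed ball is
    interior, hence critical, hence equal to zeta y'. *)
Lemma zeta_continuous y : B y -> {for y, continuous zeta}.
Proof.
move=> By; have [zd cz] := zetaP By; set z0 := zeta y in zd cz *.
apply/cvgrPdist_lt => e e0.
have /nbhs_ballP[d /= d0 Hd] := open_nbhs_nbhs (conj (@open_disc R) zd).
pose r := Num.min d e / 2.
have m0 : 0 < Num.min d e by rewrite lt_min d0.
have r0 : 0 < r by rewrite divr_gt0.
have rm : r < Num.min d e by rewrite ltr_pdivrMr// ltr_pMr// ltr1n.
have [rd re] : r < d /\ r < e by move: rm; rewrite lt_min => /andP[].
have sub : [set z : C | nC (z - z0) <= r] `<=` disc.
  by move=> z /= h; apply: Hd; rewrite -ball_normE /= distrC; exact: le_lt_trans h rd.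
pose Sph : set C := [set z : C | nC (z - z0) = r].
have cS : compact Sph.
  have cl : closed Sph.
    have -> : Sph = (fun z => nC (z - z0)) @^-1` [set r] by [].
    apply: preimage_closed; last exact: closed_eq.
    move=> z _; apply: (@continuous_comp _ _ _ (fun z : C => z - z0) (@nC R)).
      by have [d' _] := wirtingerD (wirtinger_id z) (wirtinger_cst (- z0) z); exact: (differentiable_continuous d').
    exact: nC_continuous.
  by apply: (subclosed_compact cl (@compact_closed_ballC R z0 r)) => z /= ->.
have Snonempty : Sph !=set0.
  by exists (z0 + toC r); rewrite /Sph /= addrC addKr nC_toC gtr0_norm.
have gm := crit_global_min hF s_gt0 G_bound q_bound E_bound (affine_vec_neq0 y) (affine_vec_le0 By) (affine_vec_lt0 By) zd cz.
have [z1] := @compact_EVT_min _ R (psi F (vec y)) Sph Snonempty cS (ltac:(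
  by apply: continuous_in_subspaceT => z; rewrite inE => h; apply: (psi_continuous hF); apply: sub; rewrite /= h)).
rewrite inE => z1S mn.
have z1d : disc z1 by apply: sub; rewrite /= z1S.
have lt : psi F (vec y) z0 < psi F (vec y) z1.
  have [a b] := gm z1 z1d; rewrite lt_neqAle a andbT; apply/eqP => eq.
  have := z1S; rewrite (b _) ?eq// /Sph /= subrr nC0 => /eqP.
  by rewrite lt_eqF.
pose mid := (psi F (vec y) z0 + psi F (vec y) z1) / 2.
have [mid1 mid2] : psi F (vec y) z0 < mid /\ mid < psi F (vec y) z1 by rewrite /mid; split; lra.
have N1 : \forall y' \near y, psi F (vec y') z0 < mid.
  have c : (fun y' => psi F (vec y') z0) @ y --> psi F (vec y) z0.
    have cp : (fun y' : C * C => (z0, y')) @ y --> (z0, y).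
      have ci : (fun y' : C * C => y') @ y --> y by exact: cvg_id.
      have cc : (fun _ : C * C => z0) @ y --> z0 by exact: cvg_cst.
      exact: (cvg_pair cc ci).
    have jc : (fun p : C * (C * C) => psi F (vec p.2) p.1) @ (z0, y) --> psi F (vec y) z0 := @joint_psi_continuous z0 y zd.
    exact: (cvg_comp _ _ cp jc).
  exact: (cvgr_lt _ c _ mid1).
have N2 : \forall y' \near y, forall z, Sph z -> mid < psi F (vec y') z.
  have := compact_near_coveringP Sph => -[/(_ cS) nc _].
  have := nc _ (nbhs y) (fun y' z => mid < psi F (vec y') z) _ _; apply.
  move=> z zS; have zd' : disc z by apply: sub; rewrite /= zS.
  have jc : (fun p : C * (C * C) => psi F (vec p.2) p.1) @ (z, y) --> psi F (vec y) z := @joint_psi_continuous z y zd'.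
  have lz : mid < psi F (vec y) z by apply: lt_le_trans mid2 _; apply: mn; rewrite inE.
  exact: (cvgr_gt _ jc _ lz).
have N3 : \forall y' \near y, B y' by exact: (open_nbhs_nbhs (conj open_unit_ball2 By)).
near=> y'.
have By' : B y' by near: y'.
have k1 : psi F (vec y') z0 < mid by near: y'.
have k2 : forall z, Sph z -> mid < psi F (vec y') z by near: y'.
have [z zr zmn] := psi_min_closed_ball hF (vec y') (ltW r0) sub.
have zlt : nC (z - z0) < r.
  rewrite lt_neqAle zr andbT; apply/eqP => h.
  have := k2 z h; rewrite ltNge; apply/negP; rewrite negbK.
  by apply: le_trans (ltW k1); apply: zmn; rewrite subrr nC0 ltW.
have zdisc : disc z by exact: sub.
have cz' : crit F (vec y') z = 0.
  apply: (local_min_crit hF s_gt0 zdisc (r := r - nC (z - z0))); first by rewrite subr_gt0.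
  move=> x xd xz; apply: zmn; have := nCD (x - z) (z - z0); rewrite addrA subrK.
  by move: (nC (x - z)) xz => u; lra.
by rewrite (zeta_unique By' zdisc cz') distrC; apply: lt_trans zlt re.
Unshelve. all: by end_near. Qed.

Let oU := open_joint_dom.

(** The Wirtinger derivatives of [joint_crit] in its first variable, written with directional
    derivatives on the product so that they are visibly smooth in both variables. *)
Definition crit_A (p : C * (C * C)) : C :=
  2^-1 *: ('D_(1, 0) joint_crit p - iC * 'D_(iC, 0) joint_crit p).
Definition crit_B (p : C * (C * C)) : C :=
  2^-1 *: ('D_(1, 0) joint_crit p + iC * 'D_(iC, 0) joint_crit p).

Lemma crit_A_smooth : Fsmooth joint_dom crit_A.
Proof.
move=> n; have H v := Fsmooth_derive v joint_crit_smooth.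
apply: (Fn_scale oU); first exact: Fn_cst.
apply: (FnB oU); first exact: H.
by apply: (FnCM oU); [exact: Fn_cst|exact: H].
Qed.

Lemma crit_B_smooth : Fsmooth joint_dom crit_B.
Proof.
move=> n; have H v := Fsmooth_derive v joint_crit_smooth.
apply: (Fn_scale oU); first exact: Fn_cst.
apply: (FnD oU); first exact: H.
by apply: (FnCM oU); [exact: Fn_cst|exact: H].
Qed.

Lemma derive_joint_crit z y (a b xi : C) : disc z -> wirtinger (crit F (vec y)) z a b ->
  'D_(xi, 0) joint_crit (z, y) = a * xi + b * cj xi.
Proof.
move=> zd W; have dH : differentiable joint_crit (z, y) by exact: (Fsmooth_diff (x := (z, y)) joint_crit_smooth zd).
have D1 : is_diff z (fun x : C => (x, y)) (fun h => (h, 0)).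
  exact: (is_diff_pair (is_diff_id z) (is_diff_cst y z)).
have D2 := is_diff_comp D1 (differentiableP dH).
have [d e] := D2; rewrite (deriveE _ dH).
have := wirtinger_derive xi W; rewrite -[crit F (vec y)]/(joint_crit \o (fun x => (x, y))).
by rewrite (deriveE _ d) e.
Qed.

Lemma crit_AB z y a b : disc z -> wirtinger (crit F (vec y)) z a b ->
  crit_A (z, y) = a /\ crit_B (z, y) = b.
Proof.
move=> zd W; rewrite /crit_A /crit_B !(derive_joint_crit _ zd W) cj1 cj_i.
move: a b {W} => a b; split.
  by apply: complexP; rewrite !reimE; field.
by apply: complexP; rewrite !reimE; field.
Qed.

(** The strict inequality makes xi |-> A xi + B conj xi invertible. At a critical point |p| = |p'|
    <= |f|, so that |B| = 2S(|f|^2 + |p|^2), while |A| <= 2S|p|^2 + S|p||f|/10. *)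
Lemma crit_nondegenerate y : B y -> nC (crit_A (zeta y, y)) < nC (crit_B (zeta y, y)).
Proof.
move=> By; have [zd cz] := zetaP By; set z := zeta y in zd cz *.
have W0 := wirtinger_coef0 hF (vec y) zd.
have W1 := wirtinger_coef1 hF (vec y) zd.
have W2 := wirtinger_coef2 hF (vec y) zd.
have W := wirtingerD (wirtingerM W0 (wirtinger_cj W2)) (wirtingerM W2 (wirtinger_cj W1)).
have [-> ->] := crit_AB zd W.
have cl := coef_le hF (affine_vec_le0 By) zd; have cp := psi_gt0 hF (affine_vec_neq0 y) (affine_vec_le0 By) zd.
have s0 := s_gt0 zd; have hq := q_bound zd.
move: cz cl cp; rewrite /crit /psi.
move: (frame_coef F (vec y) 0 z) (frame_coef F (vec y) 1 z) (frame_coef F (vec y) 2 z) => p p' f.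
move: (frame_l s z) (frame_q s Q z) (s z) hq s0 => l q S hq s0 cz cl f0.
set A := (X in nC X < _); set b := (X in _ < nC X).
(* The terms in l collect into a multiple of [crit], which is zero here; the same happens in b. *)
have -> : A = l * (p * cj f + f * cj p') + (q * (f * cj p - p' * cj f) + toC S * (p * cj p') * 2).
  rewrite /A !(cjD, cjM, cj_toC, cjK); ring.
have -> : b = - cj l * (p * cj f + f * cj p') + toC S * (2 * (f * cj f) + p * cj p + p' * cj p').
  rewrite /b !(cjD, cjM, cjN, cj_toC, cjK); ring.
rewrite cz !mulr0 !add0r !mulcj -(toC_nat 2) -toCM -!toCD -toCM nC_toC.
have fp : 0 < nC f by rewrite -(@ltr_pXn2r _ 2) ?nnegrE ?nC_ge0// expr0n.
have np : nC p = nC p'.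
  have : nC (p * cj f) = nC (f * cj p').
    by move/eqP: cz; rewrite addr_eq0 => /eqP ->; rewrite nCN.
  rewrite !nCM !nC_cj [RHS]mulrC => /mulIf; apply.
  by rewrite gt_eqF.
rewrite -np in cl *.
apply: le_lt_trans (nCD _ _) _; rewrite !nCM !nC_toC nC_cj -np (gtr0_norm s0) (ger0_norm (ler0n _ 2)).
have h1 : nC q * nC (f * cj p - p' * cj f) <= S / 20 * (2 * (nC p * nC f)).
  apply: ler_pM => //; rewrite ?nC_ge0//.
  apply: le_trans (nCD _ _) _; rewrite nCN !nCM !nC_cj -np mulrC; lra.
apply: le_lt_trans (lerD h1 (lexx _)) _.
have q0 : 0 <= 2 * nC f ^+ 2 + nC p ^+ 2 + nC p ^+ 2.
  by have := sqr_ge0 (nC f); have := sqr_ge0 (nC p); lra.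
rewrite ger0_norm; last by apply: mulr_ge0 => //; exact: ltW.
have p0 := nC_ge0 p; move: (nC p) (nC f) p0 fp cl {q0 h1 np} => P f' P0 f'0 cl.
have -> : S / 20 * (2 * (P * f')) + S * (P * P) * 2 = S * (P * f' / 10 + 2 * P ^+ 2) by field.
rewrite ltr_pM2l//; have Pf : P <= f'.
  by rewrite -(@ler_pXn2r _ 2) ?nnegrE ?(ltW f'0)//; have := sqr_ge0 P; lra.
have : P * f' <= f' ^+ 2 by rewrite expr2 ler_pM2r.
have : 0 < f' ^+ 2 by rewrite exprn_gt0.
lra.
Qed.

(** Minus the real Jacobian determinant of [crit] in its first variable. *)
Let Dt (y : C * C) : R := nC (crit_B (zeta y, y)) ^+ 2 - nC (crit_A (zeta y, y)) ^+ 2.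

Let Dt_neq0 y : B y -> Dt y != 0.
Proof.
move=> By; rewrite gt_eqF// subr_gt0 ltrXn2r ?nC_ge0//.
exact: crit_nondegenerate.
Qed.

(** The solution xi of A xi + B conj xi + e = 0, where e is the derivative of [joint_crit] in the
    direction (0, v). *)
Let dzeta (v : C * C) (y : C * C) : C :=
  (Dt y)^-1 *: (cj (crit_A (zeta y, y)) * 'D_(0, v) joint_crit (zeta y, y)
   - crit_B (zeta y, y) * cj ('D_(0, v) joint_crit (zeta y, y))).

Lemma zeta_derive y : B y -> is_diff y zeta (dzeta ^~ y).
Proof.
move=> By; have [zd cz] := zetaP By.
set z := zeta y in zd cz *.
have dH : differentiable joint_crit (z, y) by exact: (Fsmooth_diff (x := (z, y)) joint_crit_smooth zd).
pose a := crit_A (z, y); pose b := crit_B (z, y).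
(* The inverse of xi |-> a xi + b conj xi, which has determinant |a|^2 - |b|^2. *)
pose M0 (e : C) : C := (Dt y)^-1 *: (b * cj e - cj a * e).
have M0l : linear M0.
  move=> k x x'; rewrite /M0; move: (a) (b) ((Dt y)^-1) => a0 b0 k0.
  by apply: complexP; rewrite !reimE; ring.
pose Mm := GRing.isLinear.Build R C C _ M0 M0l.
pose M : {linear C -> C} := HB.pack M0 Mm.
have cM : continuous M.
  apply: (norm_le_linear_continuous (k := `|(Dt y)^-1| * (nC b + nC a))) => e.
  rewrite -/(nC _) /M /= /M0 nC_Z -mulrA ler_wpM2l//.
  apply: le_trans (nCD _ _) _; rewrite nCN !nCM !nC_cj -/(nC e); lra.
pose T0 (v : C * C) : C := - M ('D_(0, v) joint_crit (z, y)).
have T0l : linear T0.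
  move=> k x x'; rewrite /T0 !(deriveE _ dH).
  have -> : (0 : C, k *: x + x') = k *: (0, x) + (0, x') :> C * (C * C).
    by rewrite -[RHS]/(k *: (0 : C) + 0, k *: x + x') scaler0 addr0.
  by rewrite linearP linearP opprD -scalerN.
pose Tm := GRing.isLinear.Build R (C * C)%type C _ T0 T0l.
pose T : {linear (C * C)%type -> C} := HB.pack T0 Tm.
have cT : continuous T.
  move=> v; apply: cvgN; apply: (@continuous_comp _ _ _ (fun v => 'D_(0, v) joint_crit (z, y)) M); last exact: cM.
  have -> : (fun v => 'D_(0, v) joint_crit (z, y)) = (fun v => 'd joint_crit (z, y) (0, v)).
    by apply/funext => u; rewrite deriveE.
  apply: (@continuous_comp _ _ _ (fun v : C * C => (0 : C, v)) ('d joint_crit (z, y))); last exact: diff_continuous.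
  have ci : (fun v : C * C => v) @ v --> v by exact: cvg_id.
  have cc : (fun _ : C * C => 0 : C) @ v --> (0 : C) by exact: cvg_cst.
  exact: (cvg_pair cc ci).
have key : is_diff y zeta T.
  apply: (implicit_is_diff (H := joint_crit) (M := M)) => //.
  - exact: zeta_continuous.
  - apply: filterS (open_nbhs_nbhs (conj open_unit_ball2 By)) => y' /zetaP[_].
    exact.
  - move=> xi v; rewrite -/z.
    have -> : (xi, v) = (xi, 0) + (0, v) :> C * (C * C).
      by rewrite -[RHS]/(xi + 0, 0 + v) addr0 add0r.
    rewrite linearD linearD /T /= /T0 opprK -!deriveE//; congr (_ + _).
    have W0 := wirtinger_coef0 hF (vec y) zd.
    have W1 := wirtinger_coef1 hF (vec y) zd.
    have W2 := wirtinger_coef2 hF (vec y) zd.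
    have W := wirtingerD (wirtingerM W0 (wirtinger_cj W2)) (wirtingerM W2 (wirtinger_cj W1)).
    have [ea eb] := crit_AB zd W.
    rewrite -ea -eb -/a -/b in W; rewrite (derive_joint_crit xi zd W).
    rewrite /M /= /M0 scaleC.
    have -> : b * cj (a * xi + b * cj xi) - cj a * (a * xi + b * cj xi) = (b * cj b - a * cj a) * xi.
      by rewrite !(cjD, cjM, cjK); ring.
    rewrite !mulcj -toCB mulrA -toCM mulVf ?toC1 ?mul1r//.
    exact: Dt_neq0.
apply: is_diff_ext key => // v; rewrite -[LHS]/(- M0 ('D_(0, v) joint_crit (z, y))) /M0 /dzeta -/z -/a -/b.
by rewrite -scalerN opprB.
Qed.

(** Bootstrapping: [dzeta] is a smooth expression in (zeta y, y), so if zeta is of order n, so are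
    its derivatives, and zeta has order n + 1. *)
Lemma zeta_smooth : Fsmooth B zeta.
Proof.
have oB := open_unit_ball2.
have fd : findim (C * (C * C))%type by do ?[apply: findim_prod]; exact: findimC.
elim=> [|n IH]; first by move=> y; exact: zeta_continuous.
have IP : Fn n B (fun y => (zeta y, y)) by apply: (Fn_pair oB) => //; exact: Fn_id.
have comp (E : normedModType R) (K : C * (C * C) -> E) : Fsmooth joint_dom K -> Fn n B (fun y => K (zeta y, y)).
  move=> sK; apply: (Fn_comp fd oB (B := joint_dom) (f := fun y => (zeta y, y)) (g := K)) => //.
  by move=> y /zetaP[].
split=> [y By|v]; first by have [] := zeta_derive By.
apply: (Fn_ext (f := dzeta v) oB).
  by move=> y By; have [d e] := zeta_derive By; rewrite (deriveE _ d) e.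
have HA := comp _ _ crit_A_smooth; have HB := comp _ _ crit_B_smooth.
have HD := comp _ _ (Fsmooth_derive (0, v) joint_crit_smooth).
apply: (Fn_scale oB).
  apply: (Fn_inv oB) => [y|]; first exact: Dt_neq0.
  by apply: (FnB oB); apply: (Fn_nC2 oB).
exact: (FnB oB (FnCM oB (Fn_cj oB HA) HD) (FnCM oB HB (Fn_cj oB HD))).
Qed.

End CriticalPointMap.

(** * The projective plane *)

Section ProjectivePlane.
Context {R : realType}.
Local Notation C := (Rcomplex R).
Implicit Types v w : 'cV[C]_3.

Let e3 : @nonzero3 R := Sub (delta_mx 2 0) (e3_neq0 R).

Lemma insubd_nonzero3 v : v != 0 -> \val (insubd e3 v) = v.
Proof. by move=> v0; rewrite insubdK// inE. Qed.

Lemma toCP2_eq v w : v != 0 -> w != 0 ->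
  toCP2 v = toCP2 w <-> exists c : C, c != 0 /\ v = c *: w.
Proof.
move=> v0 w0; split.
  move=> /(eqmodP (same_line_equiv R)) /asboolP[c [c0 e]]; exists c; split=> //.
  by move: e; rewrite !insubd_nonzero3.
move=> [c [c0 e]]; apply/(eqmodP (same_line_equiv R))/asboolP; exists c; split=> //.
by rewrite !insubd_nonzero3.
Qed.

Lemma affine_toCP2 v : v != 0 -> affine (toCP2 v) = (v 0 0 / v 2 0, v 1 0 / v 2 0).
Proof.
move=> v0; rewrite /affine.
have : same_line (repr (toCP2 v) : @nonzero3 R) (insubd e3 v).
  by apply/(eqmodP (same_line_equiv R)); rewrite reprK.
move=> /asboolP[c [c0 ->]]; rewrite insubd_nonzero3// !mxE.
have h (x y : C) : c * x / (c * y) = x / y.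
  have [->|y0] := eqVneq y 0; first by rewrite mulr0 !invr0 !mulr0.
  by rewrite -mulf_div divff// mul1r.
by rewrite !h.
Qed.

Lemma herm_real v : herm v v = toC (nC (v 0 0) ^+ 2 + nC (v 1 0) ^+ 2 - nC (v 2 0) ^+ 2).
Proof. by rewrite herm_cj !mulcj -toCD -toCB. Qed.

Lemma WnegP v : Wneg v <-> nC (v 0 0) ^+ 2 + nC (v 1 0) ^+ 2 < nC (v 2 0) ^+ 2.
Proof.
rewrite /Wneg /= herm_real; set a := _ - _.
have -> : ((toC a : R[i]) < 0) = (a < 0) by rewrite ltcE /= eqxx.
by rewrite /a subr_lt0.
Qed.

Lemma Wneg_neq0 v : Wneg v -> v 2 0 != 0.
Proof.
move=> /WnegP h; apply/eqP => e; move: h; rewrite e nC0 expr0n /= ltNge.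
by rewrite addr_ge0 ?sqr_ge0.
Qed.

Lemma Wneg_vec_neq0 v : Wneg v -> v != 0.
Proof. by move=> /Wneg_neq0; apply: contra => /eqP ->; rewrite mxE. Qed.

Lemma affine_CH2 : @affine R @` CH2 = unit_ball2.
Proof.
apply/seteqP; split=> [_ [_ [v vW <-] <-]|y yB].
  have v2 := Wneg_neq0 vW; rewrite affine_toCP2 ?Wneg_vec_neq0//.
  rewrite /unit_ball2 /= !nCM !nCV !exprMn -mulrDl.
  by rewrite exprVn ltr_pdivrMr ?exprn_gt0 ?nC_gt0// mul1r; exact/WnegP.
have yW : Wneg (affine_vec y).
  by apply/WnegP; rewrite !affine_vecE nC1 expr1n.
exists (toCP2 (affine_vec y)); first by exists (affine_vec y).
by rewrite affine_toCP2 ?affine_vec_neq0// !affine_vecE !divr1 -surjective_pairing.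
Qed.

Lemma matrix_cvg (T : Type) (F : set_system T) {FF : Filter F} m n (f : T -> 'M[C]_(m, n)) (M : 'M[C]_(m, n)) :
  (forall i j, f x i j @[x --> F] --> M i j) -> f @ F --> M.
Proof.
move=> H A [P HP sub]; rewrite /fmap /=; apply: (@filterS _ F FF (fun x => forall i j, P i j (f x i j))).
  by move=> x Px; apply: sub.
apply: filter_forall => i; apply: filter_forall => j.
exact: (H i j _ (HP i j)).
Qed.

(** A nonzero entry of f x stays nonzero nearby, so the default value of [insubd] is avoided; an
    open set of the quotient then pulls back to the trace of an open W on the nonzero vectors. *)
Lemma toCP2_continuous (T : topologicalType) (f : T -> 'cV[C]_3) (x : T) : f x != 0 ->
  (forall i, f y i 0 @[y --> x] --> f x i 0) -> {for x, continuous (fun y => toCP2 (f y))}.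
Proof.
move=> fx0 cf.
have cfm : f @ x --> f x by apply: matrix_cvg => i j; rewrite ord1; exact: cf.
have near0 : \forall y \near x, f y != 0.
  have [i fi] : exists i, f x i 0 != 0.
    apply/existsP; apply: contraNT fx0; rewrite negb_exists => /forallP h.
    by apply/eqP/matrixP => i j; rewrite ord1 mxE; apply/eqP; have := h i; rewrite negbK.
  have op : nbhs (f x i 0) [set z : C | z != 0].
    apply: open_nbhs_nbhs; split=> //.
    have -> : [set z : C | z != 0] = ~` [set 0] by apply/seteqP; split => w /= /eqP.
    by rewrite openC; exact: accessible_closed_set1 (hausdorff_accessible (@norm_hausdorff _ C)) _.
  have N : \forall y \near x, f y i 0 != 0 := cf i _ op.
  move: N; apply: filterS => y h.
  by apply: contra h => /eqP ->; rewrite mxE.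
move=> U; rewrite nbhsE => -[V [oV Vx] VU].
have [W oW eW] := oV.
have Wx : W (f x).
  suff : (set_val @^-1` W) (insubd e3 (f x)).
    by rewrite /= /set_val /=; rewrite insubd_nonzero3.
  by rewrite eW.
have N := cfm _ (open_nbhs_nbhs (conj oW Wx)).
have N' : \forall y \near x, W (f y) by exact: N.
suff : \forall y \near x, U (toCP2 (f y)) by [].
near=> y; apply: VU.
suff : (set_val @^-1` W) (insubd e3 (f y)) by rewrite eW.
have y0 : f y != 0 by near: y.
by rewrite /= /set_val /= insubd_nonzero3//; near: y.
Unshelve. all: by end_near. Qed.

End ProjectivePlane.

(** * The map Phi *)

Section NormalBundleMap.
Context {R : realType}.
Local Notation C := (Rcomplex R).
Variables (s : C -> R) (Q : C -> C) (F : C -> 'M[C]_3).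
Hypothesis hF : legendrian_frame s Q F.
Hypothesis s_gt0 : forall z, disc z -> 0 < s z.
Hypothesis G_bound : forall z, disc z -> nC (frame_G s z) <= s z / 20.
Hypothesis q_bound : forall z, disc z -> nC (frame_q s Q z) <= s z / 20.
Hypothesis E_bound : forall z, disc z -> 499 / 500 <= conformal_ratio s z.

Definition normal_vec (ab : R * R) : 'cV[C]_3 :=
  \col_i nth 0 [:: iC * toC ab.1 - toC ab.2; iC * toC ab.1 + toC ab.2; 1] i.

Lemma normal_vecE ab : (normal_vec ab 0 0 = iC * toC ab.1 - toC ab.2) *
  (normal_vec ab 1 0 = iC * toC ab.1 + toC ab.2) * (normal_vec ab 2 0 = 1).
Proof. by rewrite !mxE. Qed.

Lemma Phi_vec_entry x i : Phi_vec F x i 0 =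
  (iC * toC x.2.1 - toC x.2.2) * F x.1 i 0 + (iC * toC x.2.1 + toC x.2.2) * F x.1 i 1 + F x.1 i 2.
Proof. by case: x => z [a b]; rewrite /Phi_vec !mxE. Qed.

Lemma Phi_vecE z ab : Phi_vec F (z, ab) = F z *m normal_vec ab.
Proof.
apply/matrixP => i j; rewrite ord1 Phi_vec_entry !mxE big_ord_recl big_ord_recl big_ord1 !mxE /=.
have -> : lift ord0 ord0 = 1 :> 'I_3 by exact/val_inj.
have -> : lift ord0 (lift ord0 ord0) = 2 :> 'I_3 by exact/val_inj.
by rewrite mulr1 addrA [_ * F z i 0]mulrC [_ * F z i 1]mulrC.
Qed.

Lemma herm_Phi_vec z ab : disc z ->
  herm (Phi_vec F (z, ab)) (Phi_vec F (z, ab)) = toC (2 * (ab.1 ^+ 2 + ab.2 ^+ 2) - 1).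
Proof.
move=> zd; have [_ /(_ z zd)[hh _] _] := hF.
rewrite Phi_vecE hh herm_cj !normal_vecE !mulcj -toCD -toCB; congr toC.
by rewrite !nC2 !reimE; ring.
Qed.

Lemma Phi_vec_neq0 z ab : disc z -> Phi_vec F (z, ab) != 0.
Proof.
move=> zd; rewrite Phi_vecE; apply/eqP => h.
have : normal_vec ab = 0 by rewrite -(mulKmx (frame_unit hF zd) (normal_vec ab)) h mulmx0.
by move=> /matrixP/(_ 2 0); rewrite normal_vecE mxE => /eqP; rewrite oner_eq0.
Qed.

Lemma Phi_vec_le0 z ab : disc z -> closed_D ab ->
  reC (herm (Phi_vec F (z, ab)) (Phi_vec F (z, ab))) <= 0.
Proof.
move=> zd h; rewrite herm_Phi_vec// reC_toC; move: h; rewrite /closed_D /=.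
by move: (_ + _) => x; lra.
Qed.

Lemma Phi_vec_Wneg z ab : disc z -> open_D ab -> Wneg (Phi_vec F (z, ab)).
Proof.
move=> zd h; rewrite /Wneg /= herm_Phi_vec//.
have -> x : ((toC x : R[i]) < 0) = (x < 0) by rewrite ltcE /= eqxx.
by move: h; rewrite /open_D /=; move: (_ + _) => x; lra.
Qed.

(** If v is the coordinate vector of w in the frame and v_2 is not zero, criticality says v_1 / v_2
    = - conj (v_0 / v_2). The pairs (ia - b, ia + b) are exactly the solutions of this relation. *)
Lemma Phi_vec_crit z ab : disc z -> crit F (Phi_vec F (z, ab)) z = 0.
Proof.
move=> zd; rewrite Phi_vecE /crit !(frame_coef_mulmx hF)//= !normal_vecE.
by rewrite !cjN !cjK !cj1 cjB cjM cj_i !cj_toC; ring.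
Qed.

Lemma crit_scale (c : C) w z : crit F (c *: w) z = c * cj c * crit F w z.
Proof.
have h j : frame_coef F (c *: w) j z = cj c * frame_coef F w j z.
  by rewrite !frame_coefE !mxE !cjM; ring.
by rewrite /crit !h !cjM !cjK; ring.
Qed.

Lemma Phi_inj : set_inj (disc `*` closed_D) (Phi F).
Proof.
move=> [z ab] [z' ab']; rewrite !inE => -[/= zd abD] [/= zd' abD'] e.
have [c [c0 ec]] := (toCP2_eq (Phi_vec_neq0 ab zd) (Phi_vec_neq0 ab' zd')).1 e.
have ez : z = z'.
  apply: (crit_unique hF s_gt0 G_bound q_bound E_bound (Phi_vec_neq0 ab zd) (Phi_vec_le0 zd abD)) => //.
    exact: Phi_vec_crit.
  by rewrite ec crit_scale Phi_vec_crit// mulr0.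
rewrite -ez in ec *; congr (_, _); rewrite !Phi_vecE scalemxAr in ec.
have {}ec : normal_vec ab = c *: normal_vec ab'.
  by rewrite -(mulKmx (frame_unit hF zd) (normal_vec ab)) ec mulKmx// (frame_unit hF).
have c1 : c = 1.
  by have := congr1 (fun M : 'cV[C]_3 => M 2 0) ec; rewrite !mxE /= mulr1 => ->.
rewrite c1 scale1r in ec.
have e0 := congr1 (fun M : 'cV[C]_3 => M 0 0) ec; rewrite !normal_vecE in e0.
case: ab ab' e0 {abD abD' e ec} => [a b] [a' b'] /= e0.
have i0 := congr1 imC e0; have r0 := congr1 reC e0; rewrite !reimE in i0 r0.
by congr (_, _); lra.
Qed.

(** In frame coordinates v of the vector, rho = - conj (v_0 / v_2), which at a critical point is v_1
    / v_2 = ia + b; hence a is its imaginary part and b its real part. *)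
Definition Phi_inv (y : C * C) : C * (R * R) :=
  let rho := frame_coef F (affine_vec y) 0 (zeta F y) / frame_coef F (affine_vec y) 2 (zeta F y) in
  (zeta F y, (imC rho, reC rho)).

Lemma coef2_neq0 y : unit_ball2 y -> frame_coef F (affine_vec y) 2 (zeta F y) != 0.
Proof.
move=> yB; have [zd _] := zetaP hF s_gt0 G_bound q_bound E_bound yB.
have := psi_gt0 hF (affine_vec_neq0 y) (affine_vec_le0 yB) zd.
by rewrite /psi; apply: contraTneq => ->; rewrite nC0 expr0n /= ltxx.
Qed.

Lemma Phi_invP y : unit_ball2 y ->
  (disc `*` open_D) (Phi_inv y) /\ Phi F (Phi_inv y) = toCP2 (affine_vec y).
Proof.
move=> yB; have [zd cz] := zetaP hF s_gt0 G_bound q_bound E_bound yB.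
have f0 := coef2_neq0 yB.
have hn := herm_frame_coef hF (affine_vec y) zd; rewrite herm_affine_vec in hn.
have {hn} hn := toC_inj hn.
pose v := invmx (F (zeta F y)) *m affine_vec y.
have ev : affine_vec y = F (zeta F y) *m v by rewrite /v mulKVmx// (frame_unit hF).
have c0 : frame_coef F (affine_vec y) 0 (zeta F y) = cj (v 0 0) by rewrite ev (frame_coef_mulmx hF).
have c1 : frame_coef F (affine_vec y) 1 (zeta F y) = cj (v 1 0) by rewrite ev (frame_coef_mulmx hF).
have c2 : frame_coef F (affine_vec y) 2 (zeta F y) = - cj (v 2 0) by rewrite ev (frame_coef_mulmx hF).
rewrite /crit c0 c1 c2 in cz; rewrite /Phi_inv c0 c2.
rewrite c2 oppr_eq0 cj_eq0 in f0; rewrite c0 c1 c2 nCN !nC_cj in hn.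
rewrite cjN !cjK in cz.
set rho := cj (v 0 0) / - cj (v 2 0).
have er : iC * toC (imC rho) + toC (reC rho) = rho by rewrite addrC -reim.
have er' : iC * toC (imC rho) - toC (reC rho) = - cj rho.
  by apply: complexP; rewrite !reimE; ring.
have v0 : v 0 0 = - cj rho * v 2 0.
  by rewrite /rho cjM cjV cjN !cjK invrN mulrN opprK mulrVK// unitfE.
have v1 : v 1 0 = rho * v 2 0.
  have h : cj (v 0 0) * v 2 0 = - cj (v 2 0) * v 1 0.
    by move/eqP: cz; rewrite mulrN addrC subr_eq0 => /eqP ->.
  have n2 : - cj (v 2 0) != 0 by rewrite oppr_eq0 cj_eq0.
  by rewrite /rho mulrAC h mulrAC divff// mul1r.
have vE : v = v 2 0 *: normal_vec (imC rho, reC rho).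
  apply/matrixP => i j; rewrite ord1.
  have [->|[->|->]] : i = 0 \/ i = 1 \/ i = 2.
    by case: i => [[|[|[|//]]] ?]; [left|right; left|right; right]; apply/val_inj.
  - by rewrite [RHS]mxE normal_vecE /= er' v0 mulrC.
  - by rewrite [RHS]mxE normal_vecE /= er v1 mulrC.
  - by rewrite [RHS]mxE normal_vecE mulr1.
split.
  split=> //; rewrite /open_D /=.
  (* Both |v_0| and |v_1| equal |rho||v_2|, so <w,w> = (2|rho|^2 - 1)|v_2|^2, and <w,w> < 0 becomes
     |rho|^2 < 1/2. *)
  have np : nC (v 0 0) = nC rho * nC (v 2 0) by rewrite v0 nCM nCN nC_cj.
  have np' : nC (v 1 0) = nC rho * nC (v 2 0) by rewrite v1 nCM.
  rewrite np np' in hn; rewrite addrC -nC2.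
  have n2 : 0 < nC (v 2 0) ^+ 2 by rewrite exprn_gt0// nC_gt0.
  have : nC y.1 ^+ 2 + nC y.2 ^+ 2 < 1 := yB.
  rewrite exprMn in hn => lt; rewrite -(ltr_pM2r n2).
  by move: (nC rho ^+ 2 * nC (v 2 0) ^+ 2) hn => t; lra.
apply/(toCP2_eq (Phi_vec_neq0 _ zd) (affine_vec_neq0 y)).
exists (v 2 0)^-1; rewrite invr_eq0; split=> //.
by rewrite Phi_vecE ev {2}vE -scalemxAr scalerA mulVf// scale1r.
Qed.

Lemma affine_vec_affine (v : 'cV[C]_3) : Wneg v -> toCP2 (affine_vec (affine (toCP2 v))) = toCP2 v.
Proof.
move=> vW; have v2 := Wneg_neq0 vW; rewrite affine_toCP2 ?Wneg_vec_neq0//.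
apply/toCP2_eq; rewrite ?affine_vec_neq0 ?Wneg_vec_neq0//.
exists (v 2 0)^-1; rewrite invr_eq0; split=> //.
apply/matrixP => i j; rewrite ord1.
have [->|[->|->]] : i = 0 \/ i = 1 \/ i = 2.
  by case: i => [[|[|[|//]]] ?]; [left|right; left|right; right]; apply/val_inj.
all: by rewrite affine_vecE [RHS]mxE /= ?mulVf// mulrC.
Qed.

Lemma open_closed_D (ab : R * R) : open_D ab -> closed_D ab.
Proof. exact: ltW. Qed.

Lemma Phi_CH2 x : (disc `*` open_D) x -> CH2 (Phi F x).
Proof. by case: x => z ab [/= zd abD]; exists (Phi_vec F (z, ab)) => //; exact: Phi_vec_Wneg. Qed.

Lemma Phi_bij : set_bij (disc `*` open_D) CH2 (Phi F).
Proof.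
split.
- by move=> x; exact: Phi_CH2.
- move=> x y; rewrite !inE => -[x1 x2] [y1 y2]; apply: Phi_inj; rewrite inE.
    by split=> //; exact: open_closed_D.
  by split=> //; exact: open_closed_D.
- move=> _ [v vW <-].
  have yB : unit_ball2 (affine (toCP2 v)).
    by rewrite -affine_CH2; exists (toCP2 v) => //; exists v.
  have [xD e] := Phi_invP yB; exists (Phi_inv (affine (toCP2 v))) => //.
  by rewrite e affine_vec_affine.
Qed.

Lemma Phi_invK x : (disc `*` open_D) x -> Phi_inv (affine (Phi F x)) = x.
Proof.
move=> xD; have yB : unit_ball2 (affine (Phi F x)).
  by rewrite -affine_CH2; exists (Phi F x) => //; exact: Phi_CH2.
have [xD' e] := Phi_invP yB.
have [_ inj _] := Phi_bij; apply: inj; rewrite ?inE//.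
case: x xD {yB xD'} e => z ab [/= zd abD] ->.
by apply: affine_vec_affine; exact: Phi_vec_Wneg.
Qed.

Lemma Phi_inv_smooth : Fsmooth (@unit_ball2 R) Phi_inv.
Proof.
move=> n; have oB := @open_unit_ball2 R.
have Hz := zeta_smooth hF s_gt0 G_bound q_bound E_bound n.
have fd : findim (C * (C * C))%type by do ?[apply: findim_prod]; exact: findimC.
have IP : Fn n unit_ball2 (fun y => (zeta F y, y)) by apply: (Fn_pair oB) => //; exact: Fn_id.
have H j : Fn n unit_ball2 (fun y => frame_coef F (affine_vec y) j (zeta F y)).
  apply: (Fn_comp fd oB (B := joint_dom) (f := fun y => (zeta F y, y)) (g := joint_coef F j)) => //.
    by move=> y /(zetaP hF s_gt0 G_bound q_bound E_bound)[].
  exact: (joint_coef_smooth hF).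
have Hr : Fn n unit_ball2 (fun y => frame_coef F (affine_vec y) 0 (zeta F y) / frame_coef F (affine_vec y) 2 (zeta F y)).
  by apply: (FnCM oB) => //; apply: (FnCV oB) => //; exact: coef2_neq0.
by apply: (Fn_pair oB) => //; apply: (Fn_pair oB); [exact: (Fn_imC oB)|exact: (Fn_reC oB)].
Qed.

Lemma open_discD : open (disc `*` open_D : set (C * (R * R))).
Proof.
have o1 : open [set x : C * (R * R) | disc x.1].
  by apply: (@open_comp _ _ fst disc); [move=> x _; exact: cvg_fst|exact: open_disc].
have o2 : open [set x : C * (R * R) | open_D x.2].
  apply: (@open_comp _ _ snd open_D); first by move=> x _; exact: cvg_snd.
  apply: (@open_comp _ _ (fun ab : R * R => ab.1 ^+ 2 + ab.2 ^+ 2) [set t | t < 2^-1]).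
    move=> ab _; rewrite /continuous_at !expr2; under eq_fun do rewrite !expr2.
    by apply: cvgD; apply: cvgM; (exact: cvg_fst || exact: cvg_snd).
  exact: open_lt.
have -> : disc `*` open_D = [set x : C * (R * R) | disc x.1] `&` [set x | open_D x.2] by [].
exact: openI.
Qed.

Lemma Phi_vec_smooth i : Fsmooth [set x : C * (R * R) | disc x.1] (fun x => Phi_vec F x i 0).
Proof.
move=> n; pose A := [set x : C * (R * R) | disc x.1].
have oA : open A.
  by apply: (@open_comp _ _ fst disc); [move=> x _; exact: cvg_fst|exact: open_disc].
have HF k : Fn n A (fun x => F x.1 i k).
  apply: (Fn_comp (findimC (R := R)) oA (B := disc) (f := fst) (g := fun z => F z i k)) => //.
    exact: Fn_fst.
  exact: (frame_smooth hF).
have fd : findim (R * R)%type by apply: findim_prod; exact: findimR.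
have Ha : Fn n A (fun x => x.2.1).
  apply: (Fn_comp fd oA (B := setT) (f := snd) (g := fst)) => //; [exact: Fn_snd|exact: Fn_fst].
have Hb : Fn n A (fun x => x.2.2).
  apply: (Fn_comp fd oA (B := setT) (f := snd) (g := snd)) => //; exact: Fn_snd.
have Hia := FnCM oA (Fn_cst n A iC) (Fn_toC oA Ha).
apply: (Fn_ext (f := fun x => (iC * toC x.2.1 - toC x.2.2) * F x.1 i 0 + (iC * toC x.2.1 + toC x.2.2) * F x.1 i 1 + F x.1 i 2) oA).
  by move=> x _; rewrite Phi_vec_entry.
exact: (FnD oA (FnD oA (FnCM oA (FnB oA Hia (Fn_toC oA Hb)) (HF 0)) (FnCM oA (FnD oA Hia (Fn_toC oA Hb)) (HF 1))) (HF 2)).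
Qed.

Lemma affine_Phi_smooth : smooth (disc `*` open_D) (@affine R \o Phi F).
Proof.
move=> n; apply: Fn_Cn; have oA := open_discD.
have sub : disc `*` open_D `<=` [set x : C * (R * R) | disc x.1] by move=> x [].
have H i := Fn_sub sub (Phi_vec_smooth i n).
have H2 : Fn n (disc `*` open_D) (fun x => (Phi_vec F x 2 0)^-1).
  apply: (FnCV oA) => // -[z ab] [/= zd abD]; apply: Wneg_neq0; exact: Phi_vec_Wneg.
apply: (Fn_ext (f := fun x => (Phi_vec F x 0 0 / Phi_vec F x 2 0, Phi_vec F x 1 0 / Phi_vec F x 2 0)) oA).
  by move=> [z ab] [/= zd abD]; rewrite /Phi affine_toCP2// Phi_vec_neq0.
by apply: (Fn_pair oA); apply: (FnCM oA).
Qed.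

Lemma Phi_diffeo : diffeo_CH2 (disc `*` open_D) (Phi F).
Proof.
split; [exact: Phi_bij|exact: affine_Phi_smooth|exists Phi_inv; split].
  by move=> n; rewrite affine_CH2; apply: Fn_Cn; exact: Phi_inv_smooth.
by move=> x; exact: Phi_invK.
Qed.

Lemma Phi_continuous x : disc x.1 -> {for x, continuous (Phi F)}.
Proof.
case: x => z ab /= zd; apply: toCP2_continuous; first exact: Phi_vec_neq0.
move=> i; exact: (Phi_vec_smooth i 0).
Qed.

Lemma Phi_closure x : (disc `*` closed_D) x -> closure CH2 (Phi F x).
Proof.
case: x => z [a b] [/= zd abD] U HU.
(* Shrinking the fibre coordinate by a factor t < 1 moves the point into the open disc bundle;
   continuity as t tends to 1 puts a point of CH^2 into U. *)
have c : (fun t : R => (z, (t * a, t * b))) @ (1 : R) --> (z, (a, b)).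
  have c1 : (fun _ : R => z) @ (1 : R) --> z by exact: cvg_cst.
  have c2 (k : R) : (fun t : R => t * k) @ (1 : R) --> k.
    by rewrite -[X in _ --> X]mul1r; apply: cvgM; [exact: cvg_id|exact: cvg_cst].
  exact: (cvg_pair c1 (cvg_pair (c2 a) (c2 b))).
have cP : Phi F x @[x --> (z, (a, b))] --> Phi F (z, (a, b)) by exact: (@Phi_continuous (z, (a, b)) zd).
have := cvg_comp _ _ c cP U HU; rewrite /= => N.
have {}N : \forall t \near (1 : R), U (Phi F (z, (t * a, t * b))) by exact: N.
have /nbhs_ballP[e /= e0 H] := N.
pose d := Num.min e 1 / 2.
have m0 : 0 < Num.min e 1 by rewrite lt_min e0 ltr01.
have d0 : 0 < d by rewrite divr_gt0.
have dm : d < Num.min e 1 by rewrite ltr_pdivrMr// ltr_pMr// ltr1n.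
have [de d1] : d < e /\ d < 1 by move: dm; rewrite lt_min => /andP[].
exists (Phi F (z, ((1 - d) * a, (1 - d) * b))); split.
  apply: Phi_CH2; split=> //; rewrite /open_D /= !exprMn -mulrDr.
  move: abD; rewrite /closed_D /=; set t := a ^+ 2 + b ^+ 2 => tD.
  have t0 : 0 <= t by rewrite addr_ge0// sqr_ge0.
  have k1 : (1 - d) ^+ 2 < 1 by rewrite expr_lt1//; lra.
  have k0 : 0 <= (1 - d) ^+ 2 by exact: sqr_ge0.
  apply: le_lt_trans (_ : (1 - d) ^+ 2 * 2^-1 < _); first by rewrite ler_wpM2l.
  by rewrite gtr_pMl// invr_gt0.
by apply: H; rewrite /ball /= opprB addrC subrK gtr0_norm.
Qed.

End NormalBundleMap.

(** * Maximum principle on the surface *)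

Section MaximumPrinciple.
Context {R : realType}.
Local Notation C := (Rcomplex R).
Variables (s : C -> R) (Q : C -> C) (F : C -> 'M[C]_3).
Hypothesis hF : legendrian_frame s Q F.
Hypothesis s_gt0 : forall z, disc z -> 0 < s z.
Implicit Types z : C.
Local Notation E := (conformal_ratio s).
Local Notation v := (conformal_log s).
Local Notation G := (frame_G s).

Lemma second_derive_conformal_log z sg (e : C) a b : disc z -> wirtinger G z a b -> nC e = 1 ->
  (forall w, disc w -> sg * v z <= sg * v w) ->
  0 <= sg * (2 * reC ((a * e + b * cj e) * e)).
Proof.
move=> zd W e1 H; pose r := 1 - nC z.
have r0 : 0 < r by rewrite subr_gt0 disc_nC.
have inD (t : R) : `|t - 0| < r -> disc (toC t * e + z).
  rewrite subr0 => tr; rewrite /disc /= -/(nC _); apply: le_lt_trans (nCD _ _) _.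
  by rewrite nCM e1 mulr1 nC_toC -ltrBrDr.
have z0 : toC 0 * e + z = z by rewrite toC0 mul0r add0r.
have dv w : disc w -> is_diff w (fun w => sg * v w) (fun h => sg * (2 * reC (G w * h))).
  by move=> wd; have D := is_diffZ sg (is_diff_log hF s_gt0 wd); exact: D.
have dG : is_diff (toC 0 * e + z) (fun w => sg * (2 * reC (G w * e)))
    (fun h => sg * (2 * reC ((a * h + b * cj h) * e))).
  rewrite z0; have D := is_diff_lin reC_continuous (wirtingerM W (wirtinger_cst (toC (sg * 2) * e) z)).
  apply: is_diff_ext D => w.
    by rewrite -[LHS]/(reC (G w * (toC (sg * 2) * e))); move: (G w) => g; rewrite !reimE; ring.
  rewrite -[LHS]/(reC ((a * (toC (sg * 2) * e) + G z * 0) * w + (b * (toC (sg * 2) * e) + G z * 0) * cj w)).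
  by move: (G z) => g; rewrite !reimE; ring.
apply: (@second_derive_at_local_min R (fun t => sg * v (toC t * e + z))
  (fun t => sg * (2 * reC (G (toC t * e + z) * e))) 0 r _ r0).
- move=> t /inD td.
  exact: (is_derive_comp_diff (c := fun t => toC t * e + z) (dv _ td) (is_derive_affine e z t)).
- exact: (is_derive_comp_diff (c := fun t => toC t * e + z) dG (is_derive_affine e z 0)).
- by move=> t /inD td; rewrite z0; exact: H.
Qed.

(* The sign [sg] treats minima and maxima of u at once. *)
Lemma conformal_log_laplacian_ge0 z sg : disc z ->
  (forall w, disc w -> sg * v z <= sg * v w) ->
  0 <= sg * (4 * (nC (frame_q s Q z) ^+ 2 + s z ^+ 2) - 8 / (1 - nC z ^+ 2) ^+ 2).
Proof.
move=> zd H; have [a [b [W <-]]] := wirtinger_G hF s_gt0 zd.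
have h1 := second_derive_conformal_log zd W nC1 H.
have h2 := second_derive_conformal_log zd W nC_iC H.
have := addr_ge0 h1 h2; rewrite -mulrDr -mulrDr -reCD.
congr (_ <= _ * _).
by rewrite cj1 cj_i !reimE; ring.
Qed.

End MaximumPrinciple.

(** * Bounds for small solutions on the compact surface *)

Section Surface.
Context {R : realType}.
Local Notation C := (Rcomplex R).
Variables (S : riemannSurface R) (h : conformalMetric S) (U : cubicDifferential S).
Variable u : S -> R.
Implicit Types x y : S.

Lemma smooth_fun_continuous : smooth_fun u -> continuous u.
Proof.
move=> su x; pose i := chart_at x; have ix : chart_dom i x := mem_chart_at x.
have c : u (chart_inv i (chart_map i y)) @[y --> x] --> u (chart_inv i (chart_map i x)).
  apply: (@continuous_comp _ _ _ (chart_map i) (u \o chart_inv i)).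
    exact: chart_map_continuous.
  by apply: (su i 0); exists x.
rewrite /continuous_at -{2}(chart_mapK ix); apply: cvg_trans c; apply: near_eq_cvg.
have : nbhs x (chart_dom i) by apply: open_nbhs_nbhs; split=> //; exact: chart_dom_open.
by apply: filterS => y iy; rewrite chart_mapK.
Qed.

Lemma cubic_norm2_ge0 x : 0 <= cubic_norm2 h U x.
Proof.
apply: divr_ge0; first exact: sqr_ge0.
by apply: exprn_ge0; apply: ltW; apply: dens_gt0; exact: mem_chart_at.
Qed.

(** Smallness made pointwise. The bound k ensures that the supremum in [small_fun] really is an
    upper bound. *)
Lemma small_cubic_norm2 k : (forall x, cubic_norm2 h U x <= k) -> small_fun h U u ->
  forall x, 16 * cubic_norm2 h U x <= expR (u x) ^+ 3.
Proof.
move=> Uk sm x; have e0 : 0 <= expR (u x) ^+ 3 by apply: exprn_ge0; exact: expR_ge0.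
have [U0|/sm/(_ x) {}sm] := pselect (cubic_zero U).
  by rewrite /cubic_norm2 U0 ?normr0 ?expr0n ?mul0r ?mulr0//; exact: mem_chart_at.
pose M := sup (range (cubic_norm2 h U)).
have xM : cubic_norm2 h U x <= M.
  by apply: ub_le_sup; [exists k => _ [y _ <-]; exact: Uk|exists x].
(* Away from this trivial case 16 M > 0, so [ln] is inverted by the exponential. *)
have [->|n0] := eqVneq (cubic_norm2 h U x) 0; first by rewrite mulr0.
have M0 : 0 < 16 * M.
  by rewrite mulr_gt0//; apply: lt_le_trans xM; rewrite lt_neqAle eq_sym n0 cubic_norm2_ge0.
apply: le_trans (_ : 16 * M <= _); first by rewrite ler_pM2l.
rewrite -expRM_natl -[X in X <= _]lnK ?posrE// ler_expR [_ * u x]mulrC -ler_pdivrMr//; exact: sm.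
Qed.

Variable p : C -> S.
Hypothesis hp : poincare_cover p h.
Implicit Types z w : C.

Local Notation s := (frame_s p h u).
Local Notation Q := (pull_coef p U).
Local Notation E z := (expR (u (p z))).

Definition disc_dens z : R := 4 / (1 - nC z ^+ 2) ^+ 2.

Lemma disc_dens_gt0 z : disc z -> 0 < disc_dens z.
Proof. by move=> zd; apply: divr_gt0 => //; apply: exprn_gt0; exact: disc_1N. Qed.

Lemma frame_s2 z : disc z -> s z ^+ 2 = E z * disc_dens z / 2.
Proof.
move=> zd; have [_ _ hd] := hp; rewrite /frame_s hd// -/(disc_dens z) sqr_sqrtr//.
by apply: divr_ge0 => //; apply: mulr_ge0; [exact: expR_ge0|apply: ltW; exact: disc_dens_gt0].
Qed.

Lemma frame_s_gt0 z : disc z -> 0 < s z.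
Proof.
move=> zd; have [_ _ hd] := hp; rewrite sqrtr_gt0 hd// -/(disc_dens z).
by apply: divr_gt0 => //; apply: mulr_gt0; [exact: expR_gt0|exact: disc_dens_gt0].
Qed.

Lemma conformal_ratio_cover z : disc z -> conformal_ratio s z = E z.
Proof.
by move=> zd; rewrite /conformal_ratio frame_s2// /disc_dens; field; rewrite gt_eqF// disc_1N.
Qed.

Lemma pull_coef_norm z : disc z ->
  nC (Q z) ^+ 2 = cubic_norm2 h U (p z) * disc_dens z ^+ 3.
Proof.
move=> zd; have [_ _ /(_ z zd) hd] := hp; rewrite /disc_dens -[nC z]/(`|z|) -hd.
rewrite /pull_coef /cubic_norm2 /pull_dens nCM nCX -[`|cover_deriv p z|]/(nC _) -[`|coef _ _ _|]/(nC _).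
have := dens_gt0 h (mem_chart_at (p z)).
move: (dens _ _ _) (nC (coef _ _ _)) (nC (cover_deriv _ _)) => d a c d0.
by field; rewrite gt_eqF.
Qed.

Lemma frame_q_norm z : disc z ->
  nC (frame_q s Q z) ^+ 2 = 8 * cubic_norm2 h U (p z) / E z ^+ 3 * s z ^+ 2.
Proof.
move=> zd; rewrite /frame_q nCM nCV nCX nC_toC ger0_norm ?sqrtr_ge0// exprMn pull_coef_norm//.
rewrite exprVn frame_s2//; have := expR_gt0 (u (p z)); have := disc_dens_gt0 zd.
move: (disc_dens z) (expR _) (cubic_norm2 _ _ _) => g e n g0 e0.
by field; rewrite !gt_eqF.
Qed.

Hypothesis Scompact : compact [set: S].
Hypothesis su : smooth_fun u.
Hypothesis sm : small_fun h U u.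
Hypothesis Ubound : forall x, cubic_norm2 h U x <= 1 / 10000.
Variable F : C -> 'M[C]_3.
Hypothesis hF : legendrian_frame s Q F.

(** The disc is not compact, so the extremum is found on the surface and lifted through the
    surjective p; the second derivative test then takes place in the global coordinate of the
    disc. *)
Lemma extremum_on_disc sg : exists2 z, disc z &
  (forall w, disc w -> sg * u (p z) <= sg * u (p w)) /\
  0 <= sg * (16 * cubic_norm2 h U (p z) / E z ^+ 2 + 2 * E z - 2).
Proof.
have [] := @compact_EVT_min S R (fun x => sg * u x) setT _ Scompact.
- by exists (p 0).
- apply: continuous_subspaceT => x; apply: cvgM; first exact: cvg_cst.
  exact: smooth_fun_continuous.
move=> x _ xmin; have [[_ ps _] _ _] := hp.
have [z zd zx] : (p @` disc) x by rewrite ps.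
have zmin w : sg * u (p z) <= sg * u (p w) by rewrite zx; apply: xmin; rewrite inE.
exists z => //; split=> //.
have lE w : disc w -> conformal_log s w = u (p w).
  by move=> wd; rewrite /conformal_log conformal_ratio_cover// expRK.
have : forall w, disc w -> sg * conformal_log s z <= sg * conformal_log s w.
  by move=> w wd; rewrite !lE.
move=> /(@conformal_log_laplacian_ge0 R s Q F hF frame_s_gt0 z sg zd).
rewrite frame_q_norm// frame_s2//.
have -> : 8 / (1 - nC z ^+ 2) ^+ 2 = 2 * disc_dens z.
  by rewrite /disc_dens; field; rewrite gt_eqF// disc_1N.
have := expR_gt0 (u (p z)); have g0 := disc_dens_gt0 zd.
move: (disc_dens z) g0 (expR _) (cubic_norm2 _ _ _) => g g0 e n e0.
have -> : sg * (4 * (8 * n / e ^+ 3 * (e * g / 2) + e * g / 2) - 2 * g)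
  = g * (sg * (16 * n / e ^+ 2 + 2 * e - 2)) by field; rewrite gt_eqF.
by rewrite pmulr_rge0.
Qed.

(** At a maximum of u the test gives 2e <= 2 - 16n/e^2 <= 2. At a minimum it gives 2e >= 2 -
    16n/e^2, and once e is bounded below the last term is at most 36n <= 36/10000. *)
Lemma conformal_ratio_bounds z : disc z -> 499 / 500 <= conformal_ratio s z <= 1.
Proof.
move=> zd; rewrite conformal_ratio_cover//; apply/andP; split.
  have [w wd [H K]] := extremum_on_disc 1.
  have {}H : E w <= E z by rewrite ler_expR; have := H z zd; rewrite !mul1r.
  apply: le_trans H.
  move: K; have := small_cubic_norm2 Ubound sm (p w); have := Ubound (p w).
  have := cubic_norm2_ge0 (p w); have := expR_gt0 (u (p w)).
  move: (expR _) (cubic_norm2 _ _ _) => e n e0 n0 n1 n2; rewrite mul1r => K.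
  (* Smallness enters here: 16n <= e^3 turns 16n/e^2 + 2e >= 2 into 3e >= 2 and excludes values of e
     near 0. *)
  have e2 : 2 / 3 <= e.
    have : 16 * n / e ^+ 2 <= e by rewrite ler_pdivrMr ?exprn_gt0// -exprS.
    lra.
  have : 16 * n / e ^+ 2 <= 36 * n.
    rewrite ler_pdivrMr ?exprn_gt0//.
    have : (2 / 3) ^+ 2 <= e ^+ 2 by apply: lerXn2r; rewrite ?nnegrE// ltW.
    by move=> /(ler_wpM2l n0); move: (e ^+ 2) => f; lra.
  lra.
have [w wd [H K]] := extremum_on_disc (-1).
have {}H : E z <= E w by rewrite ler_expR; have := H z zd; rewrite !mulN1r lerN2.
apply: (le_trans H).
move: K; have := cubic_norm2_ge0 (p w); have := expR_gt0 (u (p w)).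
move: (expR _) (cubic_norm2 _ _ _) => e n e0 n0; rewrite mulN1r => K.
have : 0 <= 16 * n / e ^+ 2 by apply: divr_ge0; [exact: mulr_ge0|exact: sqr_ge0].
lra.
Qed.

Lemma frame_q_small z : disc z -> nC (frame_q s Q z) ^+ 2 <= s z ^+ 2 / 1000.
Proof.
move=> zd; rewrite frame_q_norm// mulrC ler_wpM2l ?sqr_ge0//.
have /andP[e1 _] := conformal_ratio_bounds zd; rewrite conformal_ratio_cover// in e1.
have := Ubound (p z); move: (expR _) e1 (cubic_norm2 _ _ _) => e e1 n n1.
have e0 : 0 < e by lra.
rewrite ler_pdivrMr ?exprn_gt0//.
have k0 : 0 <= 499 / 500 :> R by lra.
have := lerXn2r 3 k0 (ltW e0) e1; move: (e ^+ 3) => f; lra.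
Qed.

End Surface.

Theorem proposition7p2 (R : realType) :
  exists kappa : R, 0 < kappa /\
  forall (S : riemannSurface R) (h : conformalMetric S)
         (U : cubicDifferential S) (u : S -> R)
         (p : Rcomplex R -> S) (F : Rcomplex R -> 'M[Rcomplex R]_3),
    compact [set: S] ->
    (forall x, curvature h x = -1) ->
    solution h U u ->
    small_fun h U u ->
    poincare_cover p h ->
    legendrian_frame (frame_s p h u) (pull_coef p U) F ->
    (forall x, cubic_norm h U x < kappa) ->
    diffeo_CH2 (disc `*` open_D) (Phi F) /\
    [/\ forall x, (disc `*` closed_D) x -> Phi_vec F x != 0,
        forall x, (disc `*` closed_D) x -> closure CH2 (Phi F x),
        {within disc `*` closed_D, continuous (Phi F)} &
        set_inj (disc `*` closed_D) (Phi F)].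
Proof.
(* kappa^2 = 1/10000 gives e^u >= 1 - 18/10000 >= 499/500 and then |q|^2 <= s^2/1000; all later
   estimates start from these two bounds and e^u <= 1. *)
exists (1 / 100); split; first by rewrite divr_gt0.
move=> S h U u p F cS _ [su _] sm hp hF Uk.
have Ubound x : cubic_norm2 h U x <= 1 / 10000.
  have := ltW (Uk x); rewrite -(@ler_pXn2r _ 2) ?nnegrE ?sqrtr_ge0 ?divr_ge0//.
  by rewrite sqr_sqrtr ?cubic_norm2_ge0//; lra.
have s0 z : disc z -> 0 < frame_s p h u z by exact: frame_s_gt0.
have Eb := conformal_ratio_bounds hp cS su sm Ubound hF.
have qb := frame_q_small hp cS su sm Ubound hF.
have Gs := frame_G_bound hF s0 Eb qb.
have qs := frame_q_bound s0 qb.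
have Em z : disc z -> 499 / 500 <= conformal_ratio (frame_s p h u) z by move=> /Eb/andP[].
split; first exact: (Phi_diffeo hF s0 Gs qs Em).
split.
- by move=> [z ab] [/= zd _]; exact: (Phi_vec_neq0 hF).
- by move=> x; exact: (Phi_closure hF).
- apply: continuous_in_subspaceT => x; rewrite inE => -[xd _].
  exact: (Phi_continuous hF xd).
- exact: (Phi_inj hF s0 Gs qs Em).
Qed.
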